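(* Suppose that for every polynomial-time uniform family of quantum circuits $\{U_n\}_{n\in\mathbb{N}}$ ($U_n$ acting on $n$ qubits), the quantum model $f_n(\mathbf{x})=\operatorname{Tr}[\rho(\mathbf{x})O_n]$ on inputs $\mathbf{x}\in\{0,1\}^n$, with $\rho(\mathbf{x})=\bigotimes_{i=1}^n X^{x_i}|0\rangle\langle0|X^{x_i}$ and $O_n=U_n^\dagger Z_1U_n$, admits a shadow model $\tilde f_n$ such that for every $\mathbf{x}\in\{0,1\}^n$, $|f_n(\mathbf{x})-\tilde f_n(\mathbf{x})|<0.15$ with probability at least $2/3$ over the generation of the advice and the internal randomness of the classical algorithm of $\tilde f_n$. Then $\mathsf{BQP}\subseteq\mathsf{P/poly}$. Consequently, if $\mathsf{BQP}\not\subseteq\mathsf{P/poly}$, there exist quantum models that are not shadowfiable.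
   Context: $X$ is the Pauli-X gate, $Z_1$ the Pauli-Z operator on the first qubit. Shadow model: let $W_1,\ldots,W_M$ be a (possibly adaptively chosen) sequence of $\mathrm{poly}(m)$-time $m$-qubit quantum circuits, each applied to $|0\rangle^{\otimes m}$ and measured in the computational basis; the outcomes form the advice $\omega=(\omega_1,\ldots,\omega_M)$, with $m,M$ polynomial in $n$. A shadow model is $\tilde f(\mathbf{x})=\mathcal{A}(\mathbf{x},\omega)$ for a classical probabilistic $O(\mathrm{poly}(M,m,n))$-time algorithm $\mathcal{A}$. A model is shadowfiable if for all $\varepsilon,\delta>0$ it admits a shadow model with $m,M\in O(\mathrm{poly}(n,1/\varepsilon,1/\delta))$ that is $\varepsilon$-close to it on all inputs with probability at least $1-\delta$. $\mathsf{BQP}$: languages decided with bounded error $1/3$ by polynomial-time uniform quantum circuit families measuring the first qubit; $\mathsf{P/poly}$: languages decided by deterministic polynomial-time algorithms with polynomial-length advice depending only on the input length. *)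

(* Defs.v *)
(* algC (algebraic complex numbers) for amplitudes,
   an explicit single-tape Turing machine model for classical computation. *)
From HB Require Import structures.
From mathcomp Require Import all_boot all_order all_algebra all_field.
Set Implicit Arguments. Unset Strict Implicit. Unset Printing Implicit Defensive.
Import Order.TTheory GRing.Theory Num.Theory.
Local Open Scope ring_scope.

(* Classical computation: deterministic single-tape Turing machines.   *)

(* tape alphabet: blank, bits, and a separator used to encode tuples *)
Inductive sym := Blank | S0 | S1 | Sep.
Inductive move := MoveL | MoveR | Stay.

(* finitely many states 'I_(k.+2); state 0 is initial, state 1 halting *)
Record TM := { tm_k : nat ;
  tm_delta : 'I_tm_k.+2 -> sym -> 'I_tm_k.+2 * sym * move }.

Record config (M : TM) := Config
  { c_state : 'I_(tm_k M).+2; c_left : seq sym; c_head : sym; c_right : seq sym }.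

Definition halted (M : TM) (c : config M) : bool := val (c_state c) == 1%N.

Definition step (M : TM) (c : config M) : config M :=
  if halted c then c else
  let: (q', s', d) := tm_delta (c_state c) (c_head c) in
  match d with
  | Stay => Config q' (c_left c) s' (c_right c)
  | MoveL => match c_left c with
             | [::] => Config q' [::] Blank (s' :: c_right c)
             | a :: l => Config q' l a (s' :: c_right c) end
  | MoveR => match c_right c with
             | [::] => Config q' (s' :: c_left c) Blank [::]
             | a :: r => Config q' (s' :: c_left c) a r end
  end.

Definition init_config (M : TM) (input : seq sym) : config M :=
  match input with
  | [::] => Config ord0 [::] Blank [::]
  | a :: r => Config ord0 [::] a r end.

Definition run (M : TM) (fuel : nat) (input : seq sym) : config M :=
  iter fuel (@step M) (init_config M input).

Fixpoint take_nonblank (s : seq sym) : seq sym :=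
  match s with
  | [::] => [::]
  | Blank :: _ => [::]
  | a :: r => a :: take_nonblank r end.

(* the output: the maximal blank-free word starting at the head *)
Definition output_of (M : TM) (c : config M) : seq sym :=
  take_nonblank (c_head c :: c_right c).

Definition nonblank (s : seq sym) : bool :=
  all (fun a => if a is Blank then false else true) s.

(* polynomial bound c * n^c + c *)
Definition pbound (c n : nat) : nat := (c * n ^ c + c)%N.

(* M halts within pbound c |input| steps on every (blank-free) input *)
Definition poly_time (M : TM) (c : nat) : Prop :=
  forall input : seq sym, nonblank input ->
    halted (run M (pbound c (size input)) input).

(* output of a machine with time bound c (empty if not halted) *)
Definition tm_out (M : TM) (c : nat) (input : seq sym) : seq sym :=
  let cf := run M (pbound c (size input)) input in
  if halted cf then output_of cf else [::].

(* encodings *)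
Definition bits := seq bool.
Definition enc_bits (x : bits) : seq sym := map (fun b : bool => if b then S1 else S0) x.
Fixpoint encode (xs : seq bits) : seq sym :=
  match xs with
  | [::] => [::]
  | [:: x] => enc_bits x
  | x :: r => enc_bits x ++ Sep :: encode r end.
Definition unary (n : nat) : seq sym := nseq n S1.

Fixpoint split_sep (s : seq sym) : seq (seq sym) :=
  match s with
  | [::] => [:: [::]]
  | Sep :: r => [::] :: split_sep r
  | a :: r => match split_sep r with
              | f :: fs => (a :: f) :: fs
              | [::] => [:: [:: a]] end end.

(* binary numeral, most significant symbol first *)
Definition nat_of_field (f : seq sym) : nat :=
  foldl (fun acc a => (acc * 2 + (if a is S1 then 1 else 0))%N) 0%N f.

(* Quantum circuits over the gate set {H, T, CNOT}.                    *)
(* Qubit i (0-based, qubit "1" of the paper is i = 0) corresponds to   *)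
(* bit i of a computational-basis index in 'I_(2^n).                    *)

Inductive gate := GH of nat | GT of nat | GCNOT of nat & nat | GId.
Definition circuit := seq gate.

Definition gate_of (t i j : nat) : gate :=
  match t with 0 => GH i | 1 => GT i | 2 => GCNOT i j | _ => GId end.

Fixpoint parse_gates (fs : seq nat) : circuit :=
  match fs with
  | t :: i :: j :: rest => gate_of t i j :: parse_gates rest
  | _ => [::] end.

(* decoding a circuit from a machine output: fields t,i,j per gate *)
Definition circuit_of (s : seq sym) : circuit :=
  parse_gates (map nat_of_field (split_sep s)).

Definition bitn (a i : nat) : bool := odd (a %/ 2 ^ i).
Definition flipn (i a : nat) : nat := if bitn a i then (a - 2 ^ i)%N else (a + 2 ^ i)%N.

Definition sqrt2 : algC := sqrtC 2.

Definition H_mat (n i : nat) : 'M[algC]_(2 ^ n) :=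
  if (i < n)%N then
    \matrix_(a, b) (if ((a : nat) == b) || ((a : nat) == flipn i b) then
                       (if bitn a i && bitn b i then - sqrt2^-1 else sqrt2^-1)
                     else 0)
  else 1%:M.

Definition T_mat (n i : nat) : 'M[algC]_(2 ^ n) :=
  if (i < n)%N then
    \matrix_(a, b) (if (a : nat) == b then
                      (if bitn a i then (1 + 'i) / sqrt2 else 1) else 0)
  else 1%:M.

Definition CNOT_mat (n c t : nat) : 'M[algC]_(2 ^ n) :=
  if [&& (c < n)%N, (t < n)%N & c != t] then
    \matrix_(a, b) ((a : nat) == (if bitn b c then flipn t b else b))%:R
  else 1%:M.

Definition gate_mat (n : nat) (g : gate) : 'M[algC]_(2 ^ n) :=
  match g with
  | GH i => H_mat n i | GT i => T_mat n i | GCNOT c t => CNOT_mat n c t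
  | GId => 1%:M end.

(* unitary of a circuit: gates applied in list order *)
Definition circ_mat (n : nat) (C : circuit) : 'M[algC]_(2 ^ n) :=
  foldl (fun U g => gate_mat n g *m U) 1%:M C.

Definition adjoint (n : nat) (U : 'M[algC]_n) : 'M[algC]_n := map_mx (fun z => z^*) (U^T).

(* basis index of a bit string (x_1 is the least significant bit) *)
Definition idx (x : bits) : nat := foldr (fun (b : bool) acc => (b + 2 * acc)%N) 0%N x.
Definition bits_of (m a : nat) : bits := mkseq (bitn a) m.

Definition basis (n k : nat) : 'cV[algC]_(2 ^ n) := \col_a ((a : nat) == k)%:R.

(* rho(x) = (tensor_i X^{x_i}|0><0|X^{x_i}) = |x><x| *)
Definition rho (n : nat) (x : bits) : 'M[algC]_(2 ^ n) :=
  \matrix_(a, b) (((a : nat) == idx x) && ((b : nat) == idx x))%:R.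

(* Z on the first qubit *)
Definition Z1 (n : nat) : 'M[algC]_(2 ^ n) :=
  \matrix_(a, b) (if (a : nat) == b then (if bitn a 0 then -1 else 1) else 0).

Definition observable (n : nat) (C : circuit) : 'M[algC]_(2 ^ n) :=
  adjoint (circ_mat n C) *m Z1 n *m circ_mat n C.

(* quantum model f_n(x) = Tr[rho(x) O_n], O_n = U_n^dag Z_1 U_n,
   where U_n is the circuit output by G on input 1^n *)
Definition qmodel (G : TM) (cG : nat) (x : bits) : algC :=
  let n := size x in
  \tr (rho n x *m observable n (circuit_of (tm_out G cG (unary n)))).

(* Shadow models.                                                       *)

(* probability of outcome a when measuring W|0^m> in the computational basis *)
Definition meas_prob (m : nat) (W : circuit) (a : 'I_(2 ^ m)) : algC :=
  `|(circ_mat m W *m basis m 0) a 0| ^+ 2.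

(* expectation of G(omega) over adaptively generated advice omega:
   the k-th circuit W hist depends on the previous outcomes hist *)
Fixpoint adv_exp (m : nat) (W : seq bits -> circuit) (k : nat) (hist : seq bits)
  (G : seq bits -> algC) : algC :=
  match k with
  | 0 => G hist
  | k'.+1 => \sum_(a < 2 ^ m) meas_prob (W hist) a *
                adv_exp m W k' (rcons hist (bits_of m a)) G
  end.

(* the real value (-1)^s * N / 2^e denoted by the output "s # N # e" *)
Definition dyadic (s : seq sym) : algC :=
  let fs := split_sep s in
  (-1) ^+ odd (nat_of_field (nth [::] fs 0)) *
  (nat_of_field (nth [::] fs 1))%:R / 2 ^+ nat_of_field (nth [::] fs 2).

(* probability (over advice omega and random string r of length rl) that the
   classical algorithm A on input (x, omega, r) outputs a value close to fx *)
Definition shadow_success (close : algC -> algC -> bool) (fx : algC) (A : TM) (cA : nat)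
  (m M rl : nat) (W : seq bits -> circuit) (x : bits) : algC :=
  adv_exp m W M [::] (fun om =>
    \sum_(r < 2 ^ rl)
      (close fx (dyadic (tm_out A cA (encode (x :: om ++ [:: bits_of rl r])))))%:R
      / 2 ^+ rl).

(* f admits a shadow model with m(n), M(n) <= bnd n, closeness predicate
   close, holding on every input with probability at least p *)
Definition admits_shadow (f : bits -> algC) (bnd : nat -> nat)
  (close : algC -> algC -> bool) (p : algC) : Prop :=
  exists (A : TM) (cA : nat) (rl m M : nat -> nat) (crl cs : nat)
         (W : nat -> seq bits -> circuit),
    [/\ poly_time A cA,
        (forall n, rl n <= pbound crl n)%N,
        (forall n, m n <= bnd n /\ M n <= bnd n)%N,
        (forall n hist, size (W n hist) <= pbound cs (m n))%N &
        forall x : bits, p <= shadow_success close (f x) A cA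
                            (m (size x)) (M (size x)) (rl (size x)) (W (size x)) x].

Definition shadowfiable (f : bits -> algC) : Prop :=
  exists c : nat, forall eps delta : algC, 0 < eps -> 0 < delta ->
    forall K L : nat, eps^-1 <= K%:R -> delta^-1 <= L%:R ->
      admits_shadow f (fun n => pbound c (n + K + L))
        (fun a b => `|a - b| <= eps) (1 - delta).

(* Complexity classes. A language is a predicate on bit strings.        *)

Definition language := bits -> Prop.

(* probability that measuring the first qubit of C|x,0..0> gives 1 *)
Definition accept_prob (q : nat) (C : circuit) (x : bits) : algC :=
  \sum_(a < 2 ^ q | bitn a 0) `|(circ_mat q C *m basis q (idx x)) a 0| ^+ 2.

Definition BQP (L : language) : Prop :=
  exists (G : TM) (cG : nat) (q : nat -> nat) (cq : nat),
    [/\ poly_time G cG,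
        (forall n, n <= q n <= pbound cq n)%N &
        forall x : bits,
          let C := circuit_of (tm_out G cG (unary (size x))) in
          (L x -> 2%:R / 3%:R <= accept_prob (q (size x)) C x) /\
          (~ L x -> accept_prob (q (size x)) C x <= 1 / 3%:R)].

Definition PPoly (L : language) : Prop :=
  exists (A : TM) (cA : nat) (adv : nat -> bits) (ca : nat),
    [/\ poly_time A cA,
        (forall n, size (adv n) <= pbound ca n)%N &
        forall x : bits, L x <-> tm_out A cA (encode [:: x; adv (size x)]) = [:: S1]].

Definition BQP_sub_PPoly : Prop := forall L, BQP L -> PPoly L.

(* Main.v *)
(** Let a language be decided by circuits C_n on q qubits. Moving qubit i to position i * 2^k
   embeds C_n into N qubits as soon as (q - 1) * 2^k < N <= q * 2^k: gates on qubits beyond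
   the q-th, which act trivially in C_n, then still do so, and no comparison with the
   (possibly uncomputable) q is needed. The low k bits of N - 1 are free to spell out n and
   k, so a single machine produces the embedded circuits from 1^N, and the model it defines
   takes the value 1 - 2 p(x) on the spread-out input, p being the acceptance probability.
   The sign of a 0.15-approximation decides the language.

   The samples of a shadow model are turned into advice by an Adleman argument. Give every
   input the weight (2/3)^right * (3/2)^wrong; a random sample multiplies the expected total
   weight by at most 2/3 * 2/3 + 1/3 * 3/2 = 17/18, so after 17 (n + 1) well-chosen samples
   the total is below 1 and the majority vote is right on every input of length n.

   Both machines are written in a small language of loops over stacks, which is compiled to
   single-tape machines by keeping the stacks one after the other on the tape. *)
Require Import Defs.
From HB Require Import structures.
From mathcomp Require Import all_boot all_order all_algebra all_field.
From mathcomp Require Import zify ring.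
From Stdlib Require Import ClassicalEpsilon Classical.
Set Implicit Arguments. Unset Strict Implicit. Unset Printing Implicit Defensive.
Import Order.TTheory GRing.Theory Num.Theory.

(** * Control graphs on one tape *)

(** The obstacle is uniformity. The model on inputs of length N has exactly N qubits and a circuit
    computed from 1^N alone, whereas the language is decided on q(n) qubits for an arbitrary
    polynomially bounded q; so N must be at least q(n), determine n, and keep every invalid gate
    invalid. The number 2^k of admissible values of N can be kept quadratic in n, so that N is
    polynomial in n.

    The machine for the language cannot compute N either. Its advice is therefore a program for an
    interpreter, telling position by position where a bit of x goes and where a constant 0.

    Samples of a shadow model come from an adaptive process. Choosing them one at a time against the
    total weight requires averaging over a single sample only, without independent repetitions or
    tail bounds; the sum over inputs plays the part of the union bound. The two weights are inverse
    to each other, so their product is (3/2)^(wrong - right), which is below 1 exactly when the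
    right votes win.

    Only signs are voted on: 1 - 2 p has distance at least 1/3 from every number of the wrong sign,
    more than 0.15. *)

Definition sym_code (a : sym) : bool * bool :=
  match a with
  | Blank => (false, false) | S0 => (false, true)
  | Sep => (true, false) | S1 => (true, true) end.
Definition sym_decode (p : bool * bool) : sym :=
  match p with
  | (false, false) => Blank | (false, true) => S0
  | (true, false) => Sep | (true, true) => S1 end.
Lemma sym_codeK : cancel sym_code sym_decode. Proof. by case. Qed.
HB.instance Definition _ := Finite.copy sym (can_type sym_codeK).

Lemma nonblankE s : nonblank s = (Blank \notin s).
Proof. by rewrite /nonblank; elim: s => //= a s ->; rewrite in_cons negb_or; case: a. Qed.

Definition tape := (seq sym * sym * seq sym)%type.
Definition zip_tape (l w : seq sym) : tape := (l, head Blank w, behead w).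
Definition tape_move (d : move) (T : tape) : tape :=
  let: (l, h, r) := T in
  match d with
  | Stay => T
  | MoveL => (behead l, head Blank l, h :: r)
  | MoveR => (h :: l, head Blank r, behead r) end.

Section Machines.
Variable R : finType.

(* A control graph with a finite register [R]; leaving through [None] hands the
   tape and the register over to whatever comes next. *)
Record mach := Mach { mQ : finType; ment : mQ;
  mdel : mQ -> R -> sym -> option mQ * R * sym * move }.

Definition mcfg (M : mach) := (option (mQ M) * R * tape)%type.

Definition mstep (M : mach) (c : mcfg M) : mcfg M :=
  match c with
  | (Some q, r, (l, h, t)) =>
      let: (q', r', s', d) := mdel q r h in (q', r', tape_move d (l, s', t))
  | _ => c end.

Lemma iter_exited M t r T : iter t (@mstep M) (None, r, T) = (None, r, T).
Proof. by elim: t => //= t ->. Qed.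

Definition mact (f : R -> R) : mach :=
  @Mach unit tt (fun _ r a => (None, f r, a, Stay)).

Definition mseq (M1 M2 : mach) : mach :=
  @Mach (mQ M1 + mQ M2)%type (inl (ment M1)) (fun q r a =>
    match q with
    | inl q1 => let: (oq, r', s, d) := mdel q1 r a in
        (Some (if oq is Some q' then inl q' else inr (ment M2)), r', s, d)
    | inr q2 => let: (oq, r', s, d) := mdel q2 r a in (omap inr oq, r', s, d)
    end).

Definition mif (c : R -> bool) (M1 M2 : mach) : mach :=
  @Mach (option (mQ M1 + mQ M2)) None (fun q r a =>
    match q with
    | None => (Some (Some (if c r then inl (ment M1) else inr (ment M2))), r, a, Stay)
    | Some (inl q1) => let: (oq, r', s, d) := mdel q1 r a in
                       (omap (Some \o inl) oq, r', s, d)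
    | Some (inr q2) => let: (oq, r', s, d) := mdel q2 r a in
                       (omap (Some \o inr) oq, r', s, d)
    end).

Definition mwhile (c : R -> bool) (M : mach) : mach :=
  @Mach (option (mQ M)) None (fun q r a =>
    match q with
    | None => (if c r then Some (Some (ment M)) else None, r, a, Stay)
    | Some q1 => let: (oq, r', s, d) := mdel q1 r a in (Some oq, r', s, d)
    end).

Definition exits (M : mach) (q : mQ M) r T t r' T' : Prop :=
  exists2 t', t' <= t & iter t' (@mstep M) (Some q, r, T) = (None, r', T').

Lemma exits_weaken M (q : mQ M) r T t u r' T' :
  t <= u -> exits q r T t r' T' -> exits q r T u r' T'.
Proof. by move=> tu [t' tt' E]; exists t' => //; exact: leq_trans tu. Qed.

Lemma exits_seq M1 M2 r T t1 r1 T1 t2 r2 T2 :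
  exits (ment M1) r T t1 r1 T1 -> exits (ment M2) r1 T1 t2 r2 T2 ->
  exits (ment (mseq M1 M2)) r T (t1 + t2) r2 T2.
Proof.
move=> [u1 u1t E1] [u2 u2t E2].
(* The fuel [u1] may exceed the running time of [M1], but the composite starts [M2] at the very step
   at which [M1] exits; hence a possibly shorter time [u]. *)
have A1 : exists2 u, u <= u1 &
    iter u (@mstep (mseq M1 M2)) (Some (inl (ment M1)), r, T) =
    (Some (inr (ment M2)), r1, T1).
  move: (ment M1) r T E1 {u1t}; elim: u1 => [//|u IH] q r [[l h] w].
  rewrite iterSr /=; case E: (mdel q r h) => [[[[q'|] r'] s'] d] => [/IH|].
    by case=> v vu Ev; exists v.+1 => //; rewrite iterSr /= E.
  by rewrite iter_exited => -[<- <-]; exists 1 => //=; rewrite E.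
have A2 : forall u q r T, iter u (@mstep M2) (Some q, r, T) = (None, r2, T2) ->
    iter u (@mstep (mseq M1 M2)) (Some (inr q), r, T) = (None, r2, T2).
  elim=> [//|u IH] q r' [[l h] w]; rewrite !iterSr /=.
  case: (mdel q r' h) => [[[[q'|] r''] s'] d] /=; first exact: IH.
  by rewrite !iter_exited => -[<- <-].
case: A1 => u uu1 A1; exists (u2 + u); first lia.
by rewrite iterD A1 A2.
Qed.

Lemma exits_if (c : R -> bool) M1 M2 r T t r' T' :
  (if c r then exits (ment M1) r T t r' T' else exits (ment M2) r T t r' T') ->
  exits (ment (mif c M1 M2)) r T t.+1 r' T'.
Proof.
have A1 : forall u q r T, iter u (@mstep M1) (Some q, r, T) = (None, r', T') ->
    iter u (@mstep (mif c M1 M2)) (Some (Some (inl q)), r, T) = (None, r', T').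
  elim=> [//|u IH] q r0 [[l h] w]; rewrite !iterSr /=.
  case: (mdel q r0 h) => [[[[q'|] r''] s'] d] /=; first exact: IH.
  by rewrite !iter_exited => -[<- <-].
have A2 : forall u q r T, iter u (@mstep M2) (Some q, r, T) = (None, r', T') ->
    iter u (@mstep (mif c M1 M2)) (Some (Some (inr q)), r, T) = (None, r', T').
  elim=> [//|u IH] q r0 [[l h] w]; rewrite !iterSr /=.
  case: (mdel q r0 h) => [[[[q'|] r''] s'] d] /=; first exact: IH.
  by rewrite !iter_exited => -[<- <-].
case: T => [[l h] w]; case E: (c r) => -[u ut Eu]; exists u.+1 => //;
  rewrite iterSr /= E; [exact: A1 | exact: A2].
Qed.

Lemma exits_while_stop (c : R -> bool) M r T :
  ~~ c r -> exits (ment (mwhile c M)) r T 1 r T.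
Proof. by case: T => [[l h] w] /negbTE E; exists 1 => //=; rewrite E. Qed.

Lemma exits_while_step (c : R -> bool) M r T t1 r1 T1 t2 r2 T2 :
  c r -> exits (ment M) r T t1 r1 T1 -> exits (ment (mwhile c M)) r1 T1 t2 r2 T2 ->
  exits (ment (mwhile c M)) r T (t1 + t2).+1 r2 T2.
Proof.
move=> cr [u1 u1t E1] [u2 u2t E2].
have [u uu1 A1] : exists2 u, u <= u1 &
    iter u (@mstep (mwhile c M)) (Some (Some (ment M)), r, T) = (Some None, r1, T1).
  move: (ment M) {cr} r T E1 {u1t}; elim: u1 => [//|u IH] q r [[l h] w].
  rewrite iterSr /=; case E: (mdel q r h) => [[[[q'|] r'] s'] d] => [/IH|].
    by case=> v vu Ev; exists v.+1 => //; rewrite iterSr /= E.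
  by rewrite iter_exited => -[<- <-]; exists 1 => //=; rewrite E.
exists (u2 + u).+1; first lia.
rewrite -addnS iterD iterSr; case: T E1 A1 => [[l h] w] E1 A1 /=.
by rewrite cr /= A1.
Qed.

Lemma exits_act f r T : exits (ment (mact f)) r T 1 (f r) T.
Proof. by case: T => [[l h] w]; exists 1. Qed.

(** The state counts the separators still to be crossed; the walk ends on the one that opens stack
    [i]. *)
Definition mwalk (i : nat) : mach :=
  @Mach 'I_i.+1 ord_max (fun c r a =>
    if a == Sep then
      if val c == 0 then (None, r, a, Stay) else (Some (inord c.-1), r, a, MoveR)
    else (Some c, r, a, MoveR)).

Lemma exits_walk i r l pre post :
  count_mem Sep pre = i ->
  exits (ment (mwalk i)) r (zip_tape l (pre ++ Sep :: post)) (size pre).+1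
        r (zip_tape (rev pre ++ l) (Sep :: post)).
Proof.
move=> Hc; exists (size pre).+1 => //.
suff W : forall (c : 'I_i.+1) l', c = count_mem Sep pre :> nat ->
    iter (size pre).+1 (@mstep (mwalk i)) (Some c, r, zip_tape l' (pre ++ Sep :: post)) =
    (None, r, zip_tape (rev pre ++ l') (Sep :: post)) by apply: W.
elim: pre {Hc} => [|a pre IH] c l' Hc.
  have -> : c = ord0 by apply: val_inj.
  by [].
rewrite [size _]/= iterSr rev_cons cat_rcons.
move: Hc; rewrite [count_mem _ _]/=; case: (altP (a =P Sep)) => Ha Hc.
  have c0 : (nat_of_ord c == 0) = false by rewrite Hc.
  apply: etrans (IH (inord c.-1) (a :: l') _); last first.
    have ci := ltn_ord c; rewrite Hc add1n in ci.
    by rewrite inordK Hc add1n //; exact: ltnW.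
  by congr (iter _ _ _); rewrite Ha /= c0.
apply: etrans (IH c (a :: l') Hc).
by congr (iter _ _ _); rewrite /= (negbTE Ha).
Qed.

Definition blanks (s : seq sym) := all (pred1 Blank) s.

Lemma blanks_behead s : blanks s -> blanks (behead s).
Proof. by case: s => //= a s /andP[]. Qed.
Lemma blanks_head s : blanks s -> head Blank s = Blank.
Proof. by case: s => //= a s /andP[/eqP]. Qed.

(** Room is made on the left: the cell of the separator receives the new symbol, and the separator
    with all that precedes it moves one cell to the left, each symbol being carried in the state.
    The first blank met ends the shift, so the prefix has to be blank-free. *)
Definition mins (g : R -> sym) : mach :=
  @Mach (option sym) None (fun q r a =>
    match q with
    | None => (Some (Some a), r, g r, MoveL)
    | Some c => if a == Blank then (None, r, c, Stay) else (Some (Some a), r, c, MoveL)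
    end).

Lemma exits_ins g r l pre post :
  nonblank pre -> blanks l ->
  exits (ment (mins g)) r (zip_tape (rev pre ++ l) (Sep :: post)) (size pre).+2
        r (zip_tape (behead l) (pre ++ Sep :: g r :: post)).
Proof.
move=> pb lb; exists (size (rev pre)).+2; first by rewrite size_rev.
suff W : forall u c v, Blank \notin u -> iter (size u).+1 (@mstep (mins g))
      (Some (Some c), r, zip_tape (behead (u ++ l)) (head Blank (u ++ l) :: v)) =
    (None, r, zip_tape (behead l) (rev u ++ c :: v)).
  by rewrite iterSr (W (rev pre) Sep (g r :: post)) ?revK // mem_rev -nonblankE.
elim=> [|a u IH] c v ub; first by rewrite /= blanks_head.
rewrite [size _]/= iterSr rev_cons cat_rcons.
move: ub; rewrite in_cons negb_or eq_sym => /andP[/negbTE ab ub].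
apply: etrans (IH a (c :: v) ub).
by congr (iter _ _ _); rewrite /= ab.
Qed.

(** States: [inl None] on the separator; [inl (Some None)] on the symbol behind it;
    [inl (Some (Some b))] on the way back to the left end, where [b] tells whether a hole was made;
    [inr c] shifting the prefix one cell to the right with [c] in hand, until the blank of the hole
    is filled. The test [e] recognizes an empty stack. *)
Definition mrem (e : sym -> bool) (g : R -> option sym -> R) : mach :=
  @Mach (option (option bool) + sym)%type (inl None) (fun q r a =>
    match q with
    | inl None => (Some (inl (Some None)), r, a, MoveR)
    | inl (Some None) =>
        if e a then (Some (inl (Some (Some false))), g r None, a, MoveL)
        else (Some (inl (Some (Some true))), g r (Some a), Blank, MoveL)
    | inl (Some (Some b)) =>
        if a == Blank then (if b then Some (inr Blank) else None, r, a, MoveR)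
        else (Some (inl (Some (Some b))), r, a, MoveL)
    | inr c => if a == Blank then (Some (inl (Some (Some false))), r, c, MoveL)
               else (Some (inr a), r, c, MoveR)
    end).

Lemma mrem_back e g b r l u v :
  Blank \notin u -> blanks l ->
  iter (size u).+1 (@mstep (mrem e g))
    (Some (inl (Some (Some b))), r, zip_tape (behead (u ++ l)) (head Blank (u ++ l) :: v)) =
  (if b then Some (inr Blank) else None, r, zip_tape (Blank :: behead l) (rev u ++ v)).
Proof.
move=> ub lb; elim: u ub v => [|a u IH] ub v.
  by rewrite /= blanks_head.
rewrite [size _]/= iterSr.
move: ub; rewrite in_cons negb_or eq_sym => /andP[/negbTE ab ub].
rewrite rev_cons cat_rcons; apply: etrans (IH ub (a :: v)).
by congr (iter _ _ _); rewrite /= ab.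
Qed.

Lemma mrem_shift e g r c l u v :
  Blank \notin u ->
  iter (size u).+1 (@mstep (mrem e g))
    (Some (inr c), r, zip_tape l (u ++ Blank :: v)) =
  (Some (inl (Some (Some false))), r,
   tape_move MoveL (zip_tape (rev (belast c u) ++ l) (last c u :: v))).
Proof.
elim: u c l => [|a u IH] c l ub //.
rewrite [size _]/= iterSr.
move: ub; rewrite in_cons negb_or eq_sym => /andP[/negbTE ab ub].
rewrite [belast _ _]/= rev_cons cat_rcons; apply: etrans (IH a (c :: l) ub).
by congr (iter _ _ _); rewrite /= ab.
Qed.

Lemma exits_rem_none (e : sym -> bool) g r l pre post :
  nonblank pre -> blanks l -> e (head Blank post) ->
  exits (ment (mrem e g)) r (zip_tape (rev pre ++ l) (Sep :: post)) (size pre + 4)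
        (g r None) (zip_tape (Blank :: behead l)
                     (pre ++ Sep :: head Blank post :: behead post)).
Proof.
rewrite nonblankE -mem_rev => pb lb ea; exists (size (Sep :: rev pre)).+3.
  by rewrite /= size_rev; lia.
have Sb : Blank \notin Sep :: rev pre by rewrite in_cons.
have := @mrem_back e g false (g r None) l (Sep :: rev pre)
   (head Blank post :: behead post) Sb lb.
rewrite rev_cons revK cat_rcons => <-; rewrite 2!iterSr; congr (iter _ _ _).
by rewrite /= ea.
Qed.

Lemma exits_rem_some (e : sym -> bool) g r l pre a post :
  nonblank pre -> blanks l -> ~~ e a ->
  exits (ment (mrem e g)) r (zip_tape (rev pre ++ l) (Sep :: a :: post)) (3 * size pre + 7)
        (g r (Some a)) (zip_tape [:: Blank, Blank & behead l] (pre ++ Sep :: post)).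
Proof.
rewrite nonblankE => pb lb /negbTE ea.
(* From the last summand to the first: two steps that blank the deleted cell, the way back, the
   shift of the prefix into the hole, the way back again. *)
exists ((size (rev pre)).+1 + ((size (rcons pre Sep)).+1 + ((size (Sep :: rev pre)).+1 + 2))).
  by rewrite /= size_rcons size_rev; lia.
have pb' : Blank \notin rev pre by rewrite mem_rev.
have Sb : Blank \notin Sep :: rev pre by rewrite in_cons.
have Sb' : Blank \notin rcons pre Sep by rewrite mem_rcons.
rewrite iterD iterD iterD.
have -> : iter 2 (@mstep (mrem e g)) (Some (ment (mrem e g)), r,
     zip_tape (rev pre ++ l) [:: Sep, a & post]) =
   (Some (inl (Some (Some true))), g r (Some a),
     zip_tape (behead ((Sep :: rev pre) ++ l))
       (head Blank ((Sep :: rev pre) ++ l) :: Blank :: post)).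
  by rewrite /= ea.
rewrite mrem_back // rev_cons revK mrem_shift // belast_rcons last_rcons.
rewrite rev_cons cat_rcons.
have := @mrem_back e g false (g r (Some a)) [:: Blank, Blank & behead l] (rev pre)
   (Sep :: post) pb'.
by rewrite revK /= => <- //; exact: blanks_behead.
Qed.

End Machines.

(** * Polynomial bounds *)

Definition polyb (f : nat -> nat) := exists c, forall n, f n <= pbound c n.

(** Powers of n + 2 are closed under products and compositions by mere addition and multiplication
    of exponents, because the base is at least 2 and absorbs constants. *)
Lemma polybP f : polyb f <-> exists d, forall n, f n <= n.+2 ^ d.
Proof.
split=> [[c H]|[d H]].
  exists (c + c) => n; apply: leq_trans (H n) _; rewrite /pbound.
  case: c {H} => [|c]; first by rewrite mul0n.
  rewrite addnC -mulnS expnD; apply: leq_mul.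
    by apply: leq_trans (ltnW (ltn_expl c.+1 (ltnSn 1))) _; rewrite leq_exp2r.
  by rewrite ltn_exp2r.
(* The witness is factor and exponent at once: for positive n the bound n + 2 <= 3 * n yields the
   factor 3 ^ d, and d <= 3 ^ d enlarges the exponent. At 0 the additive constant does the work. *)
exists (3 ^ d) => n; apply: leq_trans (H n) _; rewrite /pbound.
case: n => [|n]; first by apply: leq_trans (leq_addl _ _); case: (d) => // e; rewrite leq_exp2r.
apply: leq_trans (leq_addr _ _).
apply: (@leq_trans ((3 * n.+1) ^ d)); first by case: (d) => // e; rewrite leq_exp2r //; lia.
rewrite expnMn leq_mul2l leq_pexp2l ?orbT //.
exact: ltnW (ltn_expl _ _).
Qed.

Lemma polyb_le f g : polyb g -> (forall n, f n <= g n) -> polyb f.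
Proof. by move=> [c H] fg; exists c => n; apply: leq_trans (fg n) (H n). Qed.

Lemma polyb_const k : polyb (fun=> k).
Proof. by exists k => n; rewrite /pbound leq_addl. Qed.

Lemma polyb_id : polyb id.
Proof. by exists 1 => n; rewrite /pbound expn1 mul1n leq_addr. Qed.

Lemma polybD f g : polyb f -> polyb g -> polyb (fun n => f n + g n).
Proof.
move=> /polybP[a Ha] /polybP[b Hb]; apply/polybP; exists (a + b).+1 => n.
have: n.+2 ^ a <= n.+2 ^ (a + b) by rewrite leq_pexp2l // leq_addr.
have: n.+2 ^ b <= n.+2 ^ (a + b) by rewrite leq_pexp2l // leq_addl.
by rewrite expnS; move: (Ha n) (Hb n) (_ ^ (a + b)) => ? ? ? ? ?; nia.
Qed.

Lemma polybM f g : polyb f -> polyb g -> polyb (fun n => f n * g n).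
Proof.
move=> /polybP[a Ha] /polybP[b Hb]; apply/polybP; exists (a + b) => n.
by rewrite expnD leq_mul.
Qed.

Lemma polyb_comp f g : polyb f -> polyb g -> polyb (fun n => f (g n)).
Proof.
move=> /polybP[a Ha] /polybP[b Hb]; apply/polybP; exists (b.+2 * a) => n.
apply: leq_trans (Ha _) _; rewrite expnM; case: a {Ha} => // a; rewrite leq_exp2r //.
have := Hb n; have: 0 < n.+2 ^ b by rewrite expn_gt0.
by rewrite !expnS; move: (_ ^ b) => ?; nia.
Qed.

Lemma polybX f k : polyb f -> polyb (fun n => f n ^ k).
Proof.
move=> Hf; elim: k => [|k IH]; first by apply: polyb_le (polyb_const 1) _.
by apply: polyb_le (polybM Hf IH) _ => n; rewrite expnS.
Qed.

Lemma polyb_pbound c f : polyb f -> polyb (fun n => pbound c (f n)).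
Proof. by apply: polyb_comp; exists c. Qed.

Lemma polybS f : polyb f -> polyb (fun n => (f n).+1).
Proof. by move=> H; apply: polyb_le (polybD (polyb_const 1) H) _. Qed.

Ltac polyb_tac := repeat first
  [ assumption | exact: polyb_const | exact: polyb_id
  | apply: polybS | apply: polybD | apply: polybM | apply: polybX | apply: polyb_pbound ].

Lemma pbound_mono c m n : m <= n -> pbound c m <= pbound c n.
Proof.
by move=> mn; rewrite /pbound leq_add2r leq_mul2l; case: c => //= c; rewrite leq_exp2r.
Qed.

(** * From control graphs to Turing machines *)

Section TMOfMach.
Variables (R : finType) (M : mach R) (r0 : R).
Let S : finType := (mQ M * R)%type.

Definition mach_state (c : option (mQ M) * R) : 'I_(2 + #|S|) :=
  match c with
  | (Some q, r) => rshift 2 (enum_rank ((q, r) : S))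
  | (None, _) => lshift #|S| (Ordinal (isT : 1 < 2)) end.

(** States 0 and 1 are reserved as initial and halting, while [enum_rank] may number the entry state
    arbitrarily; a first step jumps there, which is why the fuel must exceed the running time
    strictly. *)
Definition TM_of_mach : TM := @Build_TM #|S| (fun q a =>
  match split (q : 'I_(2 + #|S|)) with
  | inl _ => (mach_state (Some (ment M), r0), a, Stay)
  | inr j => let: (q1, r1) := (enum_val j : S) in
             let: (q', r', s', d) := mdel q1 r1 a in (mach_state (q', r'), s', d)
  end).

Definition mach_config (c : mcfg M) : config TM_of_mach :=
  let: (q, r, (l, h, t)) := c in @Config TM_of_mach (mach_state (q, r)) l h t.

Lemma step_mach_config q r T :
  step (mach_config (Some q, r, T)) = mach_config (mstep (Some q, r, T)).
Proof.
case: T => [[l h] t]; rewrite /mach_config /step /halted [val _]/= [nat_of_ord _]/=.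
rewrite (_ : (_ == 1) = false) //.
rewrite [tm_delta _ _]/=.
have E : split (rshift 2 (enum_rank ((q, r) : S))) = inr (enum_rank ((q, r) : S)).
  exact: (@unsplitK 2 _ (inr _)).
rewrite E enum_rankK /=.
case: (mdel q r h) => [[[q' r'] s'] d].
by case: d => //=; [case: l | case: t].
Qed.

Lemma iter_step_halted (c : config TM_of_mach) t : halted c -> iter t (@step _) c = c.
Proof. by move=> H; elim: t => //= t ->; rewrite /step H. Qed.

Lemma run_TM_of_mach w t r' l h x fuel :
  exits (ment M) r0 (zip_tape [::] w) t r' (l, h, x) -> t < fuel ->
  run TM_of_mach fuel w = mach_config (None, r', (l, h, x)).
Proof.
move=> [u ut E] tf.
have -> : fuel = (fuel - u.+1) + (u + 1) by lia.
rewrite /run !iterD /=.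
have -> : step (init_config TM_of_mach w) = mach_config (Some (ment M), r0, zip_tape [::] w).
  have E0 : split (ord0 : 'I_(2 + #|S|)) = inl ord0.
    by rewrite -(@unsplitK 2 _ (inl ord0)); congr split; apply: val_inj.
  by case: w {E} => [|a w]; rewrite /step /halted /= E0.
have -> : iter u (@step _) (mach_config (Some (ment M), r0, zip_tape [::] w)) =
          mach_config (None, r', (l, h, x)).
  move: (ment M) r0 (zip_tape [::] w) E {ut tf}; elim: u => [//|u IH] q r T.
  rewrite !iterSr step_mach_config.
  case: (mstep (Some q, r, T)) => [[[q1|] r1] T1]; first exact: IH.
  by rewrite iter_exited => <-; rewrite iter_step_halted //; case: T1 => [[? ?] ?].
exact: iter_step_halted.
Qed.

End TMOfMach.

(** * Stacks on a tape *)

(** The word [io] comes last, so that a raw input becomes a layout by writing separators in front of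
    it, and the result can be read off in place. The top of each stack is next to its separator,
    where insertions and deletions happen. *)
Definition layout (ss : seq (seq bool)) (io : seq sym) : seq sym :=
  flatten [seq Sep :: enc_bits x | x <- ss] ++ Sep :: io.

Lemma enc_bits_nonblank x : nonblank (enc_bits x).
Proof. by elim: x => //= -[]. Qed.

Lemma nonblank_cat s t : nonblank (s ++ t) = nonblank s && nonblank t.
Proof. exact: all_cat. Qed.

Lemma flatten_bits_nonblank (ss : seq (seq bool)) :
  nonblank (flatten [seq Sep :: enc_bits x | x <- ss]).
Proof.
by elim: ss => //= x ss IH; rewrite nonblank_cat enc_bits_nonblank.
Qed.

Lemma count_flatten_bits (ss : seq (seq bool)) :
  count_mem Sep (flatten [seq Sep :: enc_bits x | x <- ss]) = size ss.
Proof.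
elim: ss => //= x ss IH; rewrite count_cat IH.
by rewrite (_ : count_mem Sep (enc_bits x) = 0) //; elim: x => //= -[].
Qed.

Lemma layout_nth ss io i : i < size ss ->
  layout ss io = flatten [seq Sep :: enc_bits x | x <- take i ss] ++
    Sep :: enc_bits (nth [::] ss i) ++ layout (drop i.+1 ss) io.
Proof.
move=> Hi; rewrite /layout -{1}(cat_take_drop i ss) map_cat flatten_cat -!catA.
by rewrite (drop_nth [::] Hi) /= -?catA.
Qed.

Lemma layout_set ss io i x : i < size ss ->
  layout (set_nth [::] ss i x) io = flatten [seq Sep :: enc_bits x | x <- take i ss] ++
    Sep :: enc_bits x ++ layout (drop i.+1 ss) io.
Proof.
move=> Hi; rewrite set_nthE Hi /layout map_cat flatten_cat -!catA.
by rewrite /= -?catA.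
Qed.

Lemma layout_head ss io : exists w, layout ss io = Sep :: w.
Proof. by case: ss => [|x ss] /=; eexists. Qed.

Section StackPrograms.
Variable R : finType.
Implicit Types (M : mach R) (r : R) (ss : seq (seq bool)) (io : seq sym).

Definition pstate := (R * seq (seq bool) * seq sym)%type.

(* [runs M s n s'] : on every tape holding the stacks of [s] one after the other,
   [M] exits with those of [s'] after at most [n] stack operations; each of them costs
   a bounded number of sweeps over the part of the tape in use. *)
Definition runs M (s : pstate) (n : nat) (s' : pstate) : Prop :=
  let: (r, ss, io) := s in let: (r', ss', io') := s' in
  nonblank io ->
  [/\ nonblank io', size ss' = size ss,
      size (layout ss' io') <= size (layout ss io) + n
    & forall B l z, size (layout ss io) + n <= B -> blanks l -> blanks z ->
      exists l' z', [/\ blanks l', blanks z' &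
        exits (ment M) r (zip_tape l (layout ss io ++ z)) (n * (4 * B + 10))
              r' (zip_tape l' (layout ss' io' ++ z'))]].

Lemma runs_weaken M s n m s' : runs M s n s' -> n <= m -> runs M s m s'.
Proof.
case: s s' => [[r ss] io] [[r' ss'] io'] H nm /H [H1 H2 H3 H4]; split=> //.
  by apply: leq_trans H3 _; rewrite leq_add2l.
move=> B l z HB lb zb; have [|||l' [z' [? ? E]]] := H4 B l z => //.
  by apply: leq_trans HB; rewrite leq_add2l.
by exists l', z'; split=> //; apply: exits_weaken E; rewrite leq_mul2r nm orbT.
Qed.

Lemma runs_act f r ss io : runs (mact f) (r, ss, io) 1 (f r, ss, io).
Proof.
move=> nb; split=> //; first by rewrite leq_addr.
move=> B l z _ lb zb; exists l, z; split=> //.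
by apply: exits_weaken (exits_act _ _ _); lia.
Qed.

Lemma runs_seq M1 M2 s n1 s1 n2 s2 :
  runs M1 s n1 s1 -> runs M2 s1 n2 s2 -> runs (mseq M1 M2) s (n1 + n2) s2.
Proof.
case: s s1 s2 => [[r ss] io] [[r1 ss1] io1] [[r2 ss2] io2] H1 H2 nb.
have [nb1 S1' L1 E1] := H1 nb; have [nb2 S2 L2 E2] := H2 nb1.
split=> //; [by rewrite S2 | by apply: leq_trans L2 _; lia|].
move=> B l z HB lb zb.
have [|||l1 [z1 [lb1 zb1 F1]]] := E1 B l z => //; first lia.
have [|||l2 [z2 [lb2 zb2 F2]]] := E2 B l1 z1 => //; first lia.
by exists l2, z2; split=> //; rewrite mulnDl; apply: exits_seq F1 F2.
Qed.

Lemma runs_if (c : R -> bool) M1 M2 r ss io n s' :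
  (if c r then runs M1 (r, ss, io) n s' else runs M2 (r, ss, io) n s') ->
  runs (mif c M1 M2) (r, ss, io) n.+1 s'.
Proof.
case: s' => [[r' ss'] io'] H nb.
have [M [HM HE]] : exists M, runs M (r, ss, io) n (r', ss', io') /\
    forall T t r' T', exits (ment M) r T t r' T' ->
      exits (ment (mif c M1 M2)) r T t.+1 r' T'.
  case: (c r) H (@exits_if _ c M1 M2 r) => H E; first by exists M1.
  by exists M2.
have [H1 H2 H3 H4] := HM nb; split=> //; first lia.
move=> B l z HB lb zb; have [|||l' [z' [? ? E]]] := H4 B l z => //; first lia.
by exists l', z'; split=> //; apply: exits_weaken (HE _ _ _ _ E); lia.
Qed.

Lemma runs_while_stop (c : R -> bool) M r ss io :
  ~~ c r -> runs (mwhile c M) (r, ss, io) 1 (r, ss, io).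
Proof.
move=> cr nb; split=> //; first by rewrite leq_addr.
move=> B l z _ lb zb; exists l, z; split=> //.
by apply: exits_weaken (exits_while_stop _ _ cr); lia.
Qed.

Lemma runs_while_step (c : R -> bool) M r ss io n1 s1 n2 s2 :
  c r -> runs M (r, ss, io) n1 s1 -> runs (mwhile c M) s1 n2 s2 ->
  runs (mwhile c M) (r, ss, io) (n1 + n2).+1 s2.
Proof.
case: s1 s2 => [[r1 ss1] io1] [[r2 ss2] io2] cr H1 H2 nb.
have [nb1 S1' L1 E1] := H1 nb; have [nb2 S2 L2 E2] := H2 nb1.
split=> //; [by rewrite S2 | by apply: leq_trans L2 _; lia|].
move=> B l z HB lb zb.
have [|||l1 [z1 [lb1 zb1 F1]]] := E1 B l z => //; first lia.
have [|||l2 [z2 [lb2 zb2 F2]]] := E2 B l1 z1 => //; first lia.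
exists l2, z2; split=> //; apply: exits_weaken (exits_while_step cr F1 F2); lia.
Qed.

Definition mpush i (g : R -> bool) := mseq (mwalk R i) (mins (fun r => if g r then S1 else S0)).
(** A bit stack ends at the separator of the next component; the word [io] has nothing behind it and
    ends at a blank, hence the different tests here and in [mpop_io]. *)
Definition mpop i (g : R -> option bool -> R) :=
  mseq (mwalk R i) (mrem (pred1 Sep) (fun r o => g r (omap (pred1 S1) o))).
Definition mpush_io k (g : R -> sym) := mseq (mwalk R k) (mins g).
Definition mpop_io k (g : R -> option sym -> R) := mseq (mwalk R k) (mrem (pred1 Blank) g).

Lemma runs_push i g r ss io : i < size ss ->
  runs (mpush i g) (r, ss, io) 1 (r, set_nth [::] ss i (g r :: nth [::] ss i), io).
Proof.
move=> Hi nb.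
rewrite layout_set // (layout_nth io Hi);
  set pre := flatten _; move: (layout _ _) => tl.
have pn : nonblank pre by apply: flatten_bits_nonblank.
have pc : count_mem Sep pre = i by rewrite count_flatten_bits size_take Hi.
split=> //; first by rewrite size_set_nth; apply/maxn_idPr.
  by rewrite !size_cat /= !size_cat /=; lia.
move=> B l z HB lb zb; exists (behead l), z; split=> //; first exact: blanks_behead.
have := exits_seq (exits_walk r l (enc_bits (nth [::] ss i) ++ tl ++ z) pc)
  (exits_ins (fun r => if g r then S1 else S0) r (enc_bits (nth [::] ss i) ++ tl ++ z) pn lb).
rewrite -!catA /= -?catA /= => E; apply: exits_weaken E.
by move: HB; rewrite size_cat /=; lia.
Qed.

Lemma runs_push_io k g r ss io : size ss = k -> g r != Blank ->
  runs (mpush_io k g) (r, ss, io) 1 (r, ss, g r :: io).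
Proof.
move=> Hk gb nb; rewrite /layout; set pre := flatten _.
have pn : nonblank pre by apply: flatten_bits_nonblank.
have pc : count_mem Sep pre = k by rewrite count_flatten_bits.
split=> //; first by move: gb nb; rewrite !nonblankE in_cons negb_or eq_sym => -> ->.
  by rewrite !size_cat /=; lia.
move=> B l z HB lb zb; exists (behead l), z; split=> //; first exact: blanks_behead.
have := exits_seq (exits_walk r l (io ++ z) pc) (exits_ins g r (io ++ z) pn lb).
rewrite -!catA /= -?catA /= => E; apply: exits_weaken E.
by move: HB; rewrite size_cat /=; lia.
Qed.

Lemma runs_pop i g r ss io : i < size ss ->
  runs (mpop i g) (r, ss, io) 1
    (g r (ohead (nth [::] ss i)), set_nth [::] ss i (behead (nth [::] ss i)), io).
Proof.
move=> Hi nb; rewrite layout_set // (layout_nth io Hi); set pre := flatten _.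
have pn : nonblank pre by apply: flatten_bits_nonblank.
have pc : count_mem Sep pre = i by rewrite count_flatten_bits size_take Hi.
split=> //; first by rewrite size_set_nth; apply/maxn_idPr.
  by rewrite !size_cat /= !size_cat; case: (nth _ _ _) => //= *; lia.
move=> B l z HB lb zb; move: HB.
have [w ->] := layout_head (drop i.+1 ss) io.
case: (nth [::] ss i) => [|b x] HB.
  exists (Blank :: behead l), z; split=> //; first exact: blanks_behead.
  have := exits_seq (exits_walk r l (Sep :: w ++ z) pc)
    (@exits_rem_none _ (pred1 Sep) (fun r o => g r (omap (pred1 S1) o)) r l pre
       (Sep :: w ++ z) pn lb isT).
  rewrite -!catA /= -?catA /= => E; apply: exits_weaken E.
  by move: HB; rewrite size_cat /=; lia.
exists [:: Blank, Blank & behead l], z; split=> //; first exact: blanks_behead.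
have := exits_seq (exits_walk r l ((if b then S1 else S0) :: enc_bits x ++ Sep :: w ++ z) pc)
  (@exits_rem_some _ (pred1 Sep) (fun r o => g r (omap (pred1 S1) o)) r l pre
     (if b then S1 else S0) (enc_bits x ++ Sep :: w ++ z) pn lb _).
rewrite /= -!catA /= -!catA /= (_ : ((if b then S1 else S0) == S1) = b); last by case: (b).
(* A walk of size pre + 1 followed by a deletion of 3 * size pre + 7: the dearest operation, and the
   origin of the price 4 * B + 10. *)
move=> E; apply: exits_weaken (E _); last by case: (b).
by move: HB; rewrite size_cat /=; lia.
Qed.

Lemma runs_pop_io k g r ss io : size ss = k ->
  runs (mpop_io k g) (r, ss, io) 1 (g r (ohead io), ss, behead io).
Proof.
move=> Hk nb; rewrite /layout; set pre := flatten _.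
have pn : nonblank pre by apply: flatten_bits_nonblank.
have pc : count_mem Sep pre = k by rewrite count_flatten_bits.
split=> //; first by case: (io) nb => //= a s /andP[].
  by rewrite !size_cat; case: (io) => //= *; lia.
move=> B l z HB lb zb; case: io nb HB => [|a io] nb HB.
  exists (Blank :: behead l), (head Blank z :: behead z); split=> //.
  - exact: blanks_behead.
  - by rewrite /= blanks_head //= blanks_behead.
  have := exits_seq (exits_walk r l z pc)
    (@exits_rem_none _ (pred1 Blank) g r l pre z pn lb _).
  rewrite -!catA /= -?catA /= => E; apply: exits_weaken (E _); last by rewrite blanks_head.
  by move: HB; rewrite size_cat /=; lia.
exists [:: Blank, Blank & behead l], z; split=> //; first exact: blanks_behead.
have := exits_seq (exits_walk r l (a :: io ++ z) pc)
  (@exits_rem_some _ (pred1 Blank) g r l pre a (io ++ z) pn lb _).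
rewrite -!catA /= -?catA /= => E; apply: exits_weaken (E _).
  by move: HB; rewrite size_cat /=; lia.
by case: (a) nb.
Qed.

Definition mone (f : sym -> sym) (d : move) : mach R :=
  @Mach R unit tt (fun _ r a => (None, r, f a, d)).

Lemma exits_one f d r l h w :
  exits (ment (mone f d)) r (l, h, w) 1 r (tape_move d (l, f h, w)).
Proof. by exists 1. Qed.

Fixpoint mseps k : mach R :=
  if k is k'.+1 then mseq (mone (fun=> Sep) MoveL) (mseps k') else mone (fun=> Sep) Stay.

Lemma exits_seps k r v :
  exits (ment (mseps k)) r (zip_tape [::] (Blank :: v)) k.+1
        r (zip_tape [::] (nseq k.+1 Sep ++ v)).
Proof.
elim: k v => [|k IH] v; first exact: exits_one.
have := exits_seq (exits_one (fun=> Sep) MoveL r [::] Blank v) (IH (Sep :: v)).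
by rewrite -{1}[Sep :: v]cat1s catA -(nseqD k.+1 1) addn1.
Qed.

Definition mframe k M : mach R :=
  mseq (mone id MoveL) (mseq (mseps k) (mseq M (mseq (mwalk R k) (mone id MoveR)))).

Lemma take_nonblank_cat s z : nonblank s -> blanks z -> take_nonblank (s ++ z) = s.
Proof.
elim: s => [|a s IH] /=; first by case: z => //= a z _ /andP[/eqP ->].
by move=> /andP[an sn] zb; rewrite IH //; case: a an.
Qed.

(** At most b stack operations on a tape of length at most k + 1 + n + b cost polynomial time.
    Leftover stacks and registers do no harm: the frame ends with the head on the first symbol of
    [io], and the output is read from there up to the first blank. *)
Lemma TM_of_runs (r0 : R) M k (F : seq sym -> seq sym) b :
  polyb b ->
  (forall w, nonblank w -> exists r ss, runs M (r0, nseq k [::], w) (b (size w)) (r, ss, F w)) ->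
  exists T c, poly_time T c /\ forall w, nonblank w -> tm_out T c w = F w.
Proof.
move=> bp H.
pose B n := k.+1 + n + b n.
have [c Hc] : polyb (fun n => (1 + (k.+1 + (b n * (4 * B n + 10) + (B n + 2)))).+1).
  by rewrite /B; polyb_tac.
have main w : nonblank w -> exists cf : config (TM_of_mach (mframe k M) r0),
    [/\ run _ (pbound c (size w)) w = cf, halted cf & output_of cf = F w].
  move=> nb; have [r [ss Hw]] := H w nb.
  have [nb' S L E] := Hw nb; rewrite size_nseq in S.
  have L0 : layout (nseq k [::]) w = nseq k.+1 Sep ++ w.
    by rewrite /layout; elim: (k) => //= j /= <-.
  have sL0 : size (layout (nseq k [::]) w) = k.+1 + size w.
    by rewrite L0 size_cat size_nseq.
  (* On the empty input the head starts on a blank; moving left leaves this cell explicitly to the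
     right of the separators, and it has to be counted among the trailing blanks. *)
  have [|||l [z [lb zb X]]] := E (B (size w)) [::] (nseq (size w == 0) Blank) => //.
  - by rewrite sL0.
  - by case: (size w == 0).
  set pre := flatten [seq Sep :: enc_bits x | x <- ss].
  have pc : count_mem Sep pre = k by rewrite count_flatten_bits.
  have W0 : zip_tape [::] (layout (nseq k [::]) w ++ nseq (size w == 0) Blank) =
            zip_tape [::] (nseq k.+1 Sep ++ head Blank w :: behead w).
    by rewrite L0; case: (w) => [|a w'] /=; rewrite ?cats0 -?catA.
  rewrite W0 /layout -catA -/pre in X.
  have Y := exits_seq (exits_one id MoveL r0 [::] (head Blank w) (behead w))
    (exits_seq (exits_seps k r0 (head Blank w :: behead w))
      (exits_seq X (exits_seq (exits_walk r l (F w ++ z) pc)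
         (exits_one id MoveR r (rev pre ++ l) Sep (F w ++ z))))).
  have := @run_TM_of_mach _ (mframe k M) r0 w _ _ _ _ _ (pbound c (size w)) Y _ => R1.
  eexists; split; first apply: R1.
  - apply: leq_trans (Hc (size w)).
    have : size pre <= B (size w).
      by move: L; rewrite sL0 /layout size_cat /= -/pre /B; lia.
    by rewrite ltnS !leq_add2l => ?; rewrite addn1 addn2.
  - by [].
  - by rewrite -[RHS](take_nonblank_cat nb' zb) /output_of; case: (F w ++ z).
exists (TM_of_mach (mframe k M) r0), c; split=> [w|w] /main [cf [E1 E2 E3]].
  by rewrite E1.
by rewrite /tm_out E1 E2 E3.
Qed.

End StackPrograms.

Arguments runs {R} M s n s' : simpl never.
Arguments runs_act {R} f r ss io.
Arguments runs_push {R i} g r {ss} io.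
Arguments runs_pop {R i} g r {ss} io.
Arguments runs_push_io {R k} g r {ss} io.
Arguments runs_pop_io {R k} g r {ss} io.

(** * Simulating a Turing machine on two stacks *)

Section Simulation.
Variable A : TM.

(** Besides the simulated state [rq]: [ra] and [rb] hold symbols, [rt] the first half of a symbol
    being popped, [rgo] and [rf] control outer and inner loops, and [r1], [r2], [r3] are scratch
    bits. *)
Record reg := Reg { rq : 'I_(tm_k A).+2; ra : sym; rb : sym; rt : bool;
  rgo : bool; rf : bool; r1 : bool; r2 : bool; r3 : bool }.
Definition reg_code (r : reg) :=
  (rq r, ra r, rb r, (rt r, rgo r, rf r), (r1 r, r2 r, r3 r)).
Definition reg_decode p :=
  let: (q, a, b, (t, go, f), (x, y, z)) := p in @Reg q a b t go f x y z.
Lemma reg_codeK : cancel reg_code reg_decode. Proof. by case. Qed.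
HB.instance Definition _ := Finite.copy reg (can_type reg_codeK).

Implicit Types (r : reg) (rest : seq (seq bool)) (io : seq sym).

Definition set_q q r := let: Reg _ a b t go f x y z := r in Reg q a b t go f x y z.
Definition set_a a r := let: Reg q _ b t go f x y z := r in Reg q a b t go f x y z.
Definition set_b b r := let: Reg q a _ t go f x y z := r in Reg q a b t go f x y z.
Definition set_t t r := let: Reg q a b _ go f x y z := r in Reg q a b t go f x y z.
Definition set_go go r := let: Reg q a b t _ f x y z := r in Reg q a b t go f x y z.
Definition set_f f r := let: Reg q a b t go _ x y z := r in Reg q a b t go f x y z.
Definition set_1 x r := let: Reg q a b t go f _ y z := r in Reg q a b t go f x y z.
Definition set_2 y r := let: Reg q a b t go f x _ z := r in Reg q a b t go f x y z.
Definition set_3 z r := let: Reg q a b t go f x y _ := r in Reg q a b t go f x y z.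

Definition mskip : mach reg := mact id.

(* Stacks over the full tape alphabet: every symbol takes two entries of a bit stack. *)
Definition dbl (s : seq sym) : seq bool :=
  flatten [seq [:: (sym_code a).1; (sym_code a).2] | a <- s].

Definition mpushS i (g : reg -> sym) : mach reg :=
  mseq (mpush i (fun r => (sym_code (g r)).2)) (mpush i (fun r => (sym_code (g r)).1)).
Definition mpopS i (g : reg -> sym -> reg) : mach reg :=
  mseq (mpop i (fun r o => set_t (odflt false o) r))
       (mpop i (fun r o => g r (sym_decode (rt r, odflt false o)))).

Lemma set_nthK (T : Type) (d x y : T) s i : set_nth d (set_nth d s i x) i y = set_nth d s i y.
Proof. by elim: s i => [|a s IH] [|i] //=; [elim: i => //= i -> | rewrite IH]. Qed.

Lemma size_set_nth_lt (T : Type) (d x : T) s i : i < size s -> size (set_nth d s i x) = size s.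
Proof. by move=> H; rewrite size_set_nth; apply/maxn_idPr. Qed.

Lemma runs_pushS i g r ss io w : i < size ss -> nth [::] ss i = dbl w ->
  runs (mpushS i g) (r, ss, io) 2 (r, set_nth [::] ss i (dbl (g r :: w)), io).
Proof.
move=> Hi E; have H1 := runs_push (fun r => (sym_code (g r)).2) r io Hi.
have := @runs_push _ _ (fun r => (sym_code (g r)).1) r _ io
  (_ : i < size (set_nth [::] ss i ((sym_code (g r)).2 :: nth [::] ss i))).
rewrite size_set_nth_lt // set_nthK nth_set_nth /= eqxx => /(_ Hi) H2.
rewrite E in H1 H2; exact (runs_seq H1 H2).
Qed.

(** [Blank] is coded by two false bits, and false is also what a pop of an empty stack yields; an
    exhausted stack thus behaves like an infinite blank half of a tape. *)
Lemma runs_popS i g r ss io w : i < size ss -> nth [::] ss i = dbl w ->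
  runs (mpopS i g) (r, ss, io) 2
    (g (set_t (sym_code (head Blank w)).1 r) (head Blank w),
     set_nth [::] ss i (dbl (behead w)), io).
Proof.
move=> Hi E; have H1 := runs_pop (fun r o => set_t (odflt false o) r) r io Hi.
have := @runs_pop _ _ (fun r o => g r (sym_decode (rt r, odflt false o)))
  (set_t (odflt false (ohead (nth [::] ss i))) r) _ io
  (_ : i < size (set_nth [::] ss i (behead (nth [::] ss i)))).
rewrite size_set_nth_lt // set_nthK nth_set_nth /= eqxx => /(_ Hi) H2.
have := runs_seq H1 H2; rewrite E.
by case: w {E H1 H2} => [|[] w]; case: r => *.
Qed.

(** Stack 0 is the left part of the tape, stack 1 the head followed by the right part. The state is
    replaced last, since the tests and pushes before it recompute the transition from [rq] and [ra];
    a left move parks its symbol in [rb] for the same reason. *)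
Definition simstep : mach reg :=
  let dl r := tm_delta (rq r) (ra r) in
  mseq (mpopS 1 (fun r a => set_a a r))
  (mseq (mif (fun r => if (dl r).2 is MoveR then true else false)
           (mpushS 0 (fun r => (dl r).1.2))
           (mseq (mpushS 1 (fun r => (dl r).1.2))
             (mif (fun r => if (dl r).2 is MoveL then true else false)
               (mseq (mpopS 0 (fun r a => set_b a r)) (mpushS 1 rb)) mskip)))
  (mact (fun r => set_q (dl r).1.1 r))).

Definition simloop : mach reg := mwhile (fun r => val (rq r) != 1) simstep.

(** The stack [w] is only asked to read like head and right part: a right move past the end leaves
    it empty where the configuration has an explicit blank. *)
Lemma runs_simstep (c : config A) w rest io a b t go f x y z : ~~ halted c ->
  head Blank w = c_head c -> behead w = c_right c ->
  exists a' b' t' w',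
    [/\ runs simstep (Reg (c_state c) a b t go f x y z, [:: dbl (c_left c), dbl w & rest], io)
          12 (Reg (c_state (step c)) a' b' t' go f x y z,
              [:: dbl (c_left (step c)), dbl w' & rest], io),
        head Blank w' = c_head (step c), behead w' = c_right (step c),
        size w' <= (size w).+2 & size (c_left (step c)) <= (size (c_left c)).+1].
Proof.
move=> /negbTE nh hw bw.
set ss := [:: _, _ & rest].
have S1' := @runs_popS 1 (fun r a => set_a a r) (Reg (c_state c) a b t go f x y z) ss io w
  isT erefl.
rewrite hw bw /= in S1'.
move: S1'; set t1 := (sym_code _).1 => S1'.
rewrite /simstep.
case E: (tm_delta (c_state c) (c_head c)) => [[q' s'] d].
set r1' := Reg _ (c_head c) b t1 go f x y z in S1'.
have fin b2 t2 ss' :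
    runs (mact (fun r => set_q (tm_delta (rq r) (ra r)).1.1 r))
      (Reg (c_state c) (c_head c) b2 t2 go f x y z, ss', io) 1
      (Reg q' (c_head c) b2 t2 go f x y z, ss', io).
  have := runs_act (fun r => set_q (tm_delta (rq r) (ra r)).1.1 r)
    (Reg (c_state c) (c_head c) b2 t2 go f x y z) ss' io.
  by rewrite /= E.
case: d E => E.
- have -> : step c = Config q' (behead (c_left c)) (head Blank (c_left c)) (s' :: c_right c).
    by rewrite /step nh E; case: (c_left c).
  have P1' := @runs_pushS 1 (fun r => (tm_delta (rq r) (ra r)).1.2) r1'
     [:: dbl (c_left c), dbl (c_right c) & rest] io (c_right c) isT erefl.
  have P2 := @runs_popS 0 (fun r a => set_b a r) r1'
     [:: dbl (c_left c), dbl (s' :: c_right c) & rest] io (c_left c) isT erefl.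
  have P3 := @runs_pushS 1 rb (Reg (c_state c) (c_head c) (head Blank (c_left c))
      (sym_code (head Blank (c_left c))).1 go f x y z)
     [:: dbl (behead (c_left c)), dbl (s' :: c_right c) & rest] io (s' :: c_right c) isT erefl.
  rewrite /= E in P1' P2 P3.
  exists (c_head c), (head Blank (c_left c)), (sym_code (head Blank (c_left c))).1,
    (head Blank (c_left c) :: s' :: c_right c).
  split=> //=; first last.
  + by rewrite size_behead; lia.
  + by rewrite -bw size_behead; case: (w) => //= *; lia.
  apply: (@runs_weaken _ _ _ (2 + (((2 + (2 + 2).+1)).+1 + 1))) => //.
  apply: (runs_seq S1'); apply: runs_seq (fin _ _ _).
  apply: runs_if; rewrite /= E; apply: (runs_seq P1'); apply: runs_if.
  by rewrite /= E; apply: (runs_seq P2 P3).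
- have -> : step c = Config q' (s' :: c_left c) (head Blank (c_right c)) (behead (c_right c)).
    by rewrite /step nh E; case: (c_right c).
  have P1' := @runs_pushS 0 (fun r => (tm_delta (rq r) (ra r)).1.2) r1'
     [:: dbl (c_left c), dbl (c_right c) & rest] io (c_left c) isT erefl.
  rewrite /= E in P1'.
  exists (c_head c), b, t1, (c_right c).
  split=> //=; last by rewrite -bw size_behead; lia.
  apply: (@runs_weaken _ _ _ (2 + (2.+1 + 1))) => //.
  apply: (runs_seq S1'); apply: runs_seq (fin _ _ _).
  by apply: runs_if; rewrite /= E.
- have -> : step c = Config q' (c_left c) s' (c_right c) by rewrite /step nh E.
  have P1' := @runs_pushS 1 (fun r => (tm_delta (rq r) (ra r)).1.2) r1'
     [:: dbl (c_left c), dbl (c_right c) & rest] io (c_right c) isT erefl.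
  rewrite /= E in P1'.
  exists (c_head c), b, t1, (s' :: c_right c).
  split=> //=; last by rewrite -bw size_behead; case: (w) => //= *; lia.
  apply: (@runs_weaken _ _ _ (2 + ((2 + 1.+1).+1 + 1))) => //.
  apply: (runs_seq S1'); apply: runs_seq (fin _ _ _).
  apply: runs_if; rewrite /= E; apply: (runs_seq P1'); apply: runs_if.
  by rewrite /= E; apply: runs_act.
Qed.

Lemma runs_simloop (c : config A) n w rest io a b t go f x y z :
  head Blank w = c_head c -> behead w = c_right c -> halted (iter n (@step A) c) ->
  exists a' b' t' w',
    [/\ runs simloop (Reg (c_state c) a b t go f x y z, [:: dbl (c_left c), dbl w & rest], io)
          (13 * n + 1) (Reg (c_state (iter n (@step A) c)) a' b' t' go f x y z,
              [:: dbl (c_left (iter n (@step A) c)), dbl w' & rest], io),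
        head Blank w' = c_head (iter n (@step A) c), behead w' = c_right (iter n (@step A) c),
        size w' <= size w + 2 * n & size (c_left (iter n (@step A) c)) <= size (c_left c) + n].
Proof.
elim: n c w a b t => [|n IH] c w a b t hw bw hn.
  exists a, b, t, w; split=> //; try by rewrite addn0.
  by apply: runs_while_stop; rewrite negbK.
rewrite iterSr in hn *.
have [hc|nhc] := boolP (halted c).
  have Ec : step c = c by rewrite /step hc.
  rewrite Ec in hn *; have [a' [b' [t' [w' [H1 H2 H3 H4 H5]]]]] := IH c w a b t hw bw hn.
  exists a', b', t', w'; split=> //; try lia.
  by apply: runs_weaken H1 _; lia.
have [a1 [b1 [t1 [w1 [H1 H2 H3 H4 H5]]]]] := runs_simstep rest io a b t go f x y z nhc hw bw.
have [a' [b' [t' [w' [F1 F2 F3 F4 F5]]]]] := IH (step c) w1 a1 b1 t1 H2 H3 hn.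
exists a', b', t', w'; split=> //; try lia.
by apply: runs_weaken (runs_while_step _ H1 F1) _; [exact: nhc | lia].
Qed.

End Simulation.

(** * Loops over a stack *)

Section Loops.
Variable A : TM.
Implicit Types (r : reg A) (ss : seq (seq bool)) (io : seq sym).

Definition mdrain i : mach (reg A) :=
  mseq (mact (set_f true)) (mwhile (@rf A) (mpop i (fun r o => set_f (isSome o) r))).

Definition mmove i (M : mach (reg A)) : mach (reg A) :=
  mseq (mact (set_f true)) (mwhile (@rf A)
    (mseq (mpop i (fun r o => set_f (isSome o) (set_1 (odflt false o) r)))
          (mif (@rf A) M (mskip A)))).

(** A left fold over stack [i] from its top. [Gs s y] and [Gio s] show the accumulator [s] as stacks
    and word, with [y] what remains on stack [i]; the body updates the accumulator without touching
    that stack. *)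
Lemma runs_move (T : Type) i M c r (s : T) x (f : T -> bool -> T)
    (Gs : T -> seq bool -> seq (seq bool)) (Gio : T -> seq sym) :
  (forall s y, i < size (Gs s y)) -> (forall s y, nth [::] (Gs s y) i = y) ->
  (forall s y y', set_nth [::] (Gs s y) i y' = Gs s y') ->
  (forall s y b, runs M (set_f true (set_1 b r), Gs s y, Gio s) c
                   (set_f true (set_1 b r), Gs (f s b) y, Gio (f s b))) ->
  runs (mmove i M) (r, Gs s x, Gio s) ((c + 3) * size x + 6)
    (set_f false (set_1 false r), Gs (foldl f s x) [::], Gio (foldl f s x)).
Proof.
move=> Hi Hn Hs HM.
have pop s' y r' : runs
    (mpop i (fun r o => set_f (isSome o) (set_1 (odflt false o) r))) (r', Gs s' y, Gio s') 1
    (set_f (isSome (ohead y)) (set_1 (odflt false (ohead y)) r'), Gs s' (behead y), Gio s').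
  have := runs_pop (fun r o => set_f (isSome o) (set_1 (odflt false o) r)) r' (Gio s') (Hi s' y).
  by rewrite Hn Hs.
suff W : forall s r', (forall b b', set_f b (set_1 b' r') = set_f b (set_1 b' r)) -> rf r' ->
    runs (mwhile (@rf A)
    (mseq (mpop i (fun r o => set_f (isSome o) (set_1 (odflt false o) r)))
          (mif (@rf A) M (mskip A)))) (r', Gs s x, Gio s) ((c + 3) * size x + 5)
    (set_f false (set_1 false r), Gs (foldl f s x) [::], Gio (foldl f s x)).
  rewrite addnS -add1n; apply: (runs_seq (runs_act _ _ _ _)); apply: W; by case: (r).
elim: x => [|b x IH] {}s r' Er fr.
  apply: (@runs_weaken _ _ _ (1 + 1.+1 + 1).+1) => //; last by rewrite muln0.
  apply: (runs_while_step fr (runs_seq (pop _ _ _) _)); last first.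
    by apply: runs_while_stop; case: (r).
  apply: runs_if; rewrite Er /= ifN; last by case: (r).
  exact: runs_act.
apply: (@runs_weaken _ _ _ (1 + c.+1 + ((c + 3) * size x + 5)).+1); last first.
  by rewrite /= mulnS; lia.
apply: (runs_while_step fr (runs_seq (pop _ _ _) _)); last first.
  apply: (IH (f s b) (set_f true (set_1 b r))); last by case: (r).
  by move=> ? ?; case: (r).
apply: runs_if; rewrite Er /= ifT; last by case: (r).
exact: HM.
Qed.

Lemma runs_drain i r ss io : i < size ss ->
  runs (mdrain i) (r, ss, io) (2 * size (nth [::] ss i) + 4)
    (set_f false r, set_nth [::] ss i [::], io).
Proof.
move=> Hi; rewrite addnS -add1n; apply: (runs_seq (runs_act _ _ _ _)).
have: rf (set_f true r) by case: r.
have <- : set_f false (set_f true r) = set_f false r by case: r.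
move: (set_f true r) => r'.
have pop ss' r0 : i < size ss' -> runs (mpop i (fun r o => set_f (isSome o) r)) (r0, ss', io) 1
    (set_f (isSome (ohead (nth [::] ss' i))) r0, set_nth [::] ss' i (behead (nth [::] ss' i)), io).
  exact: runs_pop.
elim: {ss}(nth _ ss i) {-2}ss (erefl (nth [::] ss i)) Hi r' => [|b x IH] ss E Hi r' fr.
  have := pop ss r' Hi; rewrite E /= => P.
  apply: (@runs_weaken _ _ _ (1 + 1).+1) => //.
  by apply: (runs_while_step fr P); apply: runs_while_stop; case: (r').
have := pop ss r' Hi; rewrite E /= => P.
have := IH (set_nth [::] ss i x) _ _ (set_f true r') _.
rewrite nth_set_nth /= eqxx set_nthK size_set_nth_lt // => /(_ erefl Hi) Q.
apply: (@runs_weaken _ _ _ (1 + (2 * size x + 3)).+1); last by rewrite mulnS; lia.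
apply: (runs_while_step fr P).
by have := Q _; rewrite (_ : set_f false (set_f true r') = set_f false r'); [apply; case: (r')|case: (r')].
Qed.

End Loops.

Arguments runs_drain {A i} r {ss} io.

(** * The majority machine *)

(** The sign of a dyadic output is the parity of its first field, hence the last bit before the
    first separator; an empty field denotes 0, so that the default to start from is false. *)
Fixpoint last_bit (v : bool) (w : seq sym) : bool :=
  match w with S0 :: w' => last_bit false w' | S1 :: w' => last_bit true w' | _ => v end.

Lemma last_bit_nonblank v w : last_bit v (take_nonblank w) = last_bit v w.
Proof. by elim: w v => //= -[] w IH v /=. Qed.

(* [V] holds the current leader once per vote of its lead. *)
Definition cast (v : bool) (V : seq bool) : seq bool :=
  if V is u :: V' then if v == u then [:: v, v & V'] else V' else [:: v].

Section VotingMachine.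
Variables (A : TM) (cA : nat).
Hypothesis HA : poly_time A cA.
Implicit Types (r : reg A) (ss : seq (seq bool)) (io : seq sym).

Definition mscan : mach (reg A) :=
  mseq (mact (fun r => set_f true (set_1 false r)))
    (mwhile (@rf A) (mpopS 1 (fun r a => set_a a
       (match a with S0 => set_1 false r | S1 => set_1 true r | _ => set_f false r end)))).

Lemma runs_scan q a b t go f x y z l w rest io : exists a' t' w',
  runs mscan (Reg q a b t go f x y z : reg A, [:: l, dbl w & rest], io) (3 * size w + 5)
    (Reg q a' b t' go false (last_bit false w) y z, [:: l, dbl w' & rest], io) /\
  size w' <= size w.
Proof.
suff W : forall v a t, exists a' t' w',
  runs (mwhile (@rf A) (mpopS 1 (fun r a => set_a a
       (match a with S0 => set_1 false r | S1 => set_1 true r | _ => set_f false r end))))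
    (Reg q a b t go true v y z : reg A, [:: l, dbl w & rest], io) (3 * size w + 4)
    (Reg q a' b t' go false (last_bit v w) y z, [:: l, dbl w' & rest], io) /\
  size w' <= size w.
  have [a' [t' [w' [H1 H2]]]] := W false a t.
  exists a', t', w'; split=> //; rewrite addnS -add1n.
  by apply: (runs_seq (runs_act _ _ _ _)).
elim: w {a t} => [|c w IH] v a t.
  exists Blank, false, [::]; split=> //.
  apply: (@runs_weaken _ _ _ (2 + 1).+1) => //; apply: runs_while_step => //.
    exact: (@runs_popS _ 1 _ _ _ _ [::]).
  exact: runs_while_stop.
have P := @runs_popS A 1 (fun r a => set_a a
       (match a with S0 => set_1 false r | S1 => set_1 true r | _ => set_f false r end))
   (Reg q a b t go true v y z) [:: l, dbl (c :: w) & rest] io (c :: w) isT erefl.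
have fr : rf (Reg q a b t go true v y z : reg A) by [].
case: c P => P; rewrite /= in P.
- exists Blank, false, w; split=> //.
  apply: (@runs_weaken _ _ _ (2 + 1).+1); last by rewrite /=; lia.
  apply: (runs_while_step fr P).
  exact: runs_while_stop.
- have [a' [t' [w' [H1 H2]]]] := IH false S0 false.
  exists a', t', w'; split; last exact: leqW.
  apply: (@runs_weaken _ _ _ (2 + (3 * size w + 4)).+1); last by rewrite /=; lia.
  exact: (runs_while_step fr P H1).
- have [a' [t' [w' [H1 H2]]]] := IH true S1 true.
  exists a', t', w'; split; last exact: leqW.
  apply: (@runs_weaken _ _ _ (2 + (3 * size w + 4)).+1); last by rewrite /=; lia.
  exact: (runs_while_step fr P H1).
- exists Sep, true, w; split=> //.
  apply: (@runs_weaken _ _ _ (2 + 1).+1); last by rewrite /=; lia.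
  apply: (runs_while_step fr P).
  exact: runs_while_stop.
Qed.

Definition mvote : mach (reg A) :=
  mseq (mpop 4 (fun r o => set_2 (isSome o) (set_3 (odflt false o) r)))
    (mif (@r2 A) (mif (fun r => r1 r == r3 r) (mseq (mpush 4 (@r1 A)) (mpush 4 (@r1 A))) (mskip A))
       (mpush 4 (@r1 A))).

Lemma runs_vote q a b t go f x y z s0 s1 s2 s3 V io : exists y' z',
  runs mvote (Reg q a b t go f x y z : reg A, [:: s0; s1; s2; s3; V], io) 5
    (Reg q a b t go f x y' z', [:: s0; s1; s2; s3; cast x V], io).
Proof.
have P := @runs_pop _ 4 (fun r o => set_2 (isSome o) (set_3 (odflt false o) r))
  (Reg q a b t go f x y z : reg A) [:: s0; s1; s2; s3; V] io isT.
case: V P => [|u V] P; rewrite /= in P.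
  exists false, false; apply: (@runs_weaken _ _ _ (1 + 1.+1)) => //.
  apply: (runs_seq P); apply: runs_if => /=.
  exact: (runs_push (@r1 A) _ _ (_ : 4 < size [:: s0; s1; s2; s3; [::]])).
exists true, u; rewrite /=; case: ifP => E.
  apply: (@runs_weaken _ _ _ (1 + (1 + 1).+2)) => //.
  apply: (runs_seq P); apply: runs_if => /=; apply: runs_if; rewrite /= E.
  have P1 := runs_push (@r1 A) (Reg q a b t go f x true u) io
    (isT : 4 < size [:: s0; s1; s2; s3; V]).
  have P2 := runs_push (@r1 A) (Reg q a b t go f x true u) io
    (isT : 4 < size [:: s0; s1; s2; s3; x :: V]).
  exact: (runs_seq P1 P2).
apply: (@runs_weaken _ _ _ (1 + 1.+2)) => //.
apply: (runs_seq P); apply: runs_if => /=; apply: runs_if; rewrite /= E.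
exact: runs_act.
Qed.

(** The drains erase the simulated tape, and the final move puts the input bits used by this run
    back on stack 2, so that the next run finds the whole input again. *)
Definition mrun : mach (reg A) :=
  mseq (mact (set_q ord0)) (mseq (simloop A) (mseq mscan (mseq mvote
    (mseq (mdrain A 0) (mseq (mdrain A 1) (mmove 3 (mpush 2 (@r1 A)))))))).

Definition out_vote (buf : seq sym) : bool := last_bit false (tm_out A cA buf).

Lemma runs_run q a b t go f x y z buf X X' V io : nonblank buf ->
  exists q' a' b' t' f' x' y' z',
  runs mrun (Reg q a b t go f x y z : reg A, [:: [::]; dbl buf; X; X'; V], io)
    (100 + 40 * (size buf + size X' + pbound cA (size buf)))
    (Reg q' a' b' t' go f' x' y' z',
     [:: [::]; [::]; catrev X' X; [::]; cast (out_vote buf) V], io).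
Proof.
move=> nb; set n := pbound cA (size buf).
have hn : halted (iter n (@step A) (init_config A buf)) := HA nb.
have ini : c_state (init_config A buf) = ord0 /\ c_left (init_config A buf) = [::].
  by case: (buf).
have [||a1 [b1 [t1 [w [P2 hw bw sw sl]]]]] :=
  @runs_simloop A (init_config A buf) n buf [:: X; X'; V] io a b t go f x y z _ _ hn.
- by case: (buf).
- by case: (buf).
rewrite {1}ini.1 {1}ini.2 in P2.
have P1 := runs_act (set_q ord0) (Reg q a b t go f x y z : reg A)
   [:: [::]; dbl buf; X; X'; V] io.
rewrite ini.2 /= add0n in sl.
pose c := run A n buf; rewrite -[iter _ _ _]/c in hn hw bw P2 sl.
have Ev : out_vote buf = last_bit false w.
  rewrite /out_vote /tm_out -/n -/c hn /output_of last_bit_nonblank -hw -bw.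
  by case: (w).
have [a2 [t2 [w2 [P3 sw2]]]] :=
  runs_scan (c_state c) a1 b1 t1 go f x y z (dbl (c_left c)) w [:: X; X'; V] io.
have [y3 [z3 P4]] := runs_vote (c_state c) a2 b1 t2 go false (last_bit false w) y z
  (dbl (c_left c)) (dbl w2) X X' V io.
have P5 := runs_drain (Reg (c_state c) a2 b1 t2 go false (last_bit false w) y3 z3) io
  (isT : 0 < size [:: dbl (c_left c); dbl w2; X; X'; cast (last_bit false w) V]).
have P6 := runs_drain (Reg (c_state c) a2 b1 t2 go false (last_bit false w) y3 z3) io
  (isT : 1 < size [:: [::]; dbl w2; X; X'; cast (last_bit false w) V]).
have P7 := @runs_move A (seq bool) 3 (mpush 2 (@r1 A)) 1
  (Reg (c_state c) a2 b1 t2 go false (last_bit false w) y3 z3) X X'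
  (fun s b => b :: s) (fun s y => [:: [::]; [::]; s; y; cast (last_bit false w) V])
  (fun _ => io) (fun _ _ => isT) (fun _ _ => erefl) (fun _ _ _ => erefl) _.
exists (c_state c), a2, b1, t2, false, false, y3, z3; rewrite Ev.
have Eck : catrev X' X = foldl (fun s b => b :: s) X X'.
  by elim: (X') (X) => //= d X1 IH X0.
have sd s : size (dbl s) = 2 * size s.
  by elim: s => //= d s IH; rewrite IH; lia.
rewrite Eck; apply: runs_weaken (runs_seq P1 (runs_seq P2 (runs_seq P3 (runs_seq P4
  (runs_seq P5 (runs_seq P6 (P7 _))))))) _ => /=.
  by move=> s u e; apply: runs_push.
by rewrite !sd; lia.
Qed.

End VotingMachine.

(** * Advice as a program *)

Definition is1 (a : sym) := a == S1.

(* Advice is read three bits at a time: 00b and 01b stack a 0 and a 1, 10b a separator,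
   110 the next bit of the input, and 111 runs [A] on what has been stacked and votes. *)
Fixpoint tokens (io : seq sym) : seq (bool * bool * bool) :=
  match io with
  | [:: a, b, c & io'] => (is1 a, is1 b, is1 c) :: tokens io'
  | [:: a; b] => [:: (is1 a, is1 b, false)]
  | [:: a] => [:: (is1 a, false, false)]
  | [::] => [::] end.

Lemma tokens_cons a io : tokens (a :: io) =
  (is1 a, ohead io == Some S1, ohead (behead io) == Some S1) :: tokens (behead (behead io)).
Proof. by case: io => [|b [|c io]]. Qed.

(** In order: the input bits not yet used, those used in the current run, the word being assembled
    for [A], and the votes. *)
Record bstate := BState { bx : seq bool; bx' : seq bool; bbuf : seq sym; bv : seq bool }.

(** Stacking reverses the input. This is the order needed later: words for [A] are assembled by
    pushing, from their last symbol to their first. *)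
Fixpoint leading_bits (io : seq sym) (x : seq bool) : seq bool * seq sym :=
  match io with
  | S0 :: io' => leading_bits io' (false :: x)
  | S1 :: io' => leading_bits io' (true :: x)
  | _ => (x, behead io) end.

Lemma leading_bits_enc x io y :
  leading_bits (enc_bits x ++ Sep :: io) y = (catrev x y, io).
Proof. by elim: x y => [|[] x IH] y //=. Qed.

Lemma size_leading_bits io x :
  size (leading_bits io x).1 <= size x + size io /\ size (leading_bits io x).2 <= size io.
Proof.
elim: io x => [|[] io IH] x //=; rewrite ?addn0 //; split; try lia;
  by case: (IH (false :: x)) (IH (true :: x)) => /= ? ? [? ?]; lia.
Qed.

Section VotingLoop.
Variables (A : TM) (cA : nat).
Hypothesis HA : poly_time A cA.
Implicit Types (r : reg A) (ss : seq (seq bool)) (io : seq sym).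

Definition bstep (s : bstate) (tok : bool * bool * bool) : bstate :=
  let: BState x x' buf v := s in
  match tok with
  | (false, b, _) => BState x x' ((if b then S1 else S0) :: buf) v
  | (true, false, _) => BState x x' (Sep :: buf) v
  | (true, true, false) =>
      if x is b :: y then BState y (b :: x') ((if b then S1 else S0) :: buf) v else s
  | (true, true, true) => BState (catrev x' x) [::] [::] (cast (out_vote A cA buf) v) end.

Definition bstacks (s : bstate) : seq (seq bool) :=
  [:: [::]; dbl (bbuf s); bx s; bx' s; bv s].

Definition mnext : mach (reg A) :=
  mseq (mpop 2 (fun r o => set_f (isSome o) (set_1 (odflt false o) r)))
    (mif (@rf A) (mseq (mpush 3 (@r1 A)) (mpushS 1 (fun r => if r1 r then S1 else S0))) (mskip A)).

Definition mtoken : mach (reg A) :=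
  mif (fun r => r1 r && r2 r) (mif (@r3 A) (mrun A) mnext)
    (mpushS 1 (fun r => if r1 r then Sep else if r2 r then S1 else S0)).

Definition token_cost n := 110 + 40 * (n + pbound cA n).

Lemma runs_token q a b t go f x y z s io n :
  nonblank (bbuf s) -> size (bbuf s) + size (bx' s) <= n ->
  exists q' a' b' t' f' x' y' z',
  runs mtoken (Reg q a b t go f x y z : reg A, bstacks s, io) (token_cost n)
    (Reg q' a' b' t' go f' x' y' z', bstacks (bstep s (x, y, z)), io).
Proof.
case: s => X X' buf V /= nb Hn.
have [|xy] := boolP (x && y).
  case: x y => [] // [] // _; case: z.
    have [q' [a' [b' [t' [f' [x' [y' [z' P]]]]]]]] :=
      runs_run HA q a b t go f true true true X X' V io nb.
    exists q', a', b', t', f', x', y', z'.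
    apply: (@runs_weaken _ _ _ (100 + 40 * (size buf + size X' + pbound cA (size buf))).+2).
      by apply: runs_if => /=; apply: runs_if.
    have := @pbound_mono cA (size buf) n; rewrite /token_cost; lia.
  have P := @runs_pop _ 2 (fun r o => set_f (isSome o) (set_1 (odflt false o) r))
    (Reg q a b t go f true true false : reg A) [:: [::]; dbl buf; X; X'; V] io isT.
  case: X P => [|u X] P; rewrite /= in P.
    exists q, a, b, t, false, false, true, false.
    apply: (@runs_weaken _ _ _ (1 + 2).+2) => //.
    apply: runs_if => /=; apply: runs_if => /=; apply: (runs_seq P).
    by apply: runs_if => /=; apply: runs_act.
  exists q, a, b, t, true, u, true, false.
  apply: (@runs_weaken _ _ _ (1 + (1 + 2).+1).+2) => //.
  apply: runs_if => /=; apply: runs_if => /=; apply: (runs_seq P).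
  apply: runs_if => /=.
  have P1 := runs_push (@r1 A) (Reg q a b t go true u true false) io
    (isT : 3 < size [:: [::]; dbl buf; X; X'; V]).
  have P2 := @runs_pushS A 1 (fun r => if r1 r then S1 else S0)
    (Reg q a b t go true u true false)  [:: [::]; dbl buf; X; u :: X'; V] io buf isT erefl.
  exact: (runs_seq P1 P2).
exists q, a, b, t, f, x, y, z.
have P2 := @runs_pushS A 1 (fun r => if r1 r then Sep else if r2 r then S1 else S0)
    (Reg q a b t go f x y z) [:: [::]; dbl buf; X; X'; V] io buf isT erefl.
apply: (@runs_weaken _ _ _ 3) => //; apply: runs_if => /=; rewrite (negbTE xy).
by case: x y xy P2 => [] [].
Qed.

Definition mloop : mach (reg A) :=
  mwhile (@rgo A)
    (mseq (mpop_io 5 (fun r o => set_go (isSome o) (set_1 (o == Some S1) r)))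
      (mif (@rgo A)
        (mseq (mpop_io 5 (fun r o => set_2 (o == Some S1) r))
        (mseq (mpop_io 5 (fun r o => set_3 (o == Some S1) r)) mtoken)) (mskip A))).

(** A token lengthens the stored data by at most one symbol, and running [A] empties the buffer and
    gives the input back; so every simulated run gets an input of linear size, and its time bound
    stays polynomial. *)
Lemma bstep_inv s tok : nonblank (bbuf s) ->
  nonblank (bbuf (bstep s tok)) /\
  size (bbuf (bstep s tok)) + (size (bx (bstep s tok)) + size (bx' (bstep s tok)))
    <= size (bbuf s) + (size (bx s) + size (bx' s)) + 1.
Proof.
case: s tok => X X' buf V [[[] []] []] /= nb; try by split=> //; lia.
  by split=> //; rewrite catrevE size_cat size_rev; lia.
case: X => [|u X] /=; split=> //; [lia | by case: u | lia].
Qed.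

(** The list [io0] is only a measure for the induction, as one token removes up to three symbols.
    The sum bounded by [n] never grows: each token takes at least one symbol from [io] and adds at
    most one elsewhere. *)
Lemma runs_loop io0 : forall io q a b t f x y z s n,
  size io <= size io0 ->
  nonblank (bbuf s) -> size (bbuf s) + (size (bx s) + size (bx' s)) + size io <= n ->
  exists q' a' b' t' f' x' y' z',
  runs mloop (Reg q a b t true f x y z : reg A, bstacks s, io)
     ((token_cost n + 5) * size io + 5)
    (Reg q' a' b' t' false f' x' y' z', bstacks (foldl bstep s (tokens io)), [::]).
Proof.
elim: io0 => [|a0 io0 IH] io q a b t f x y z s n.
  case: io => //= _ nb _; exists q, a, b, t, f, false, y, z.
  apply: (@runs_weaken _ _ _ (1 + 1.+1 + 1).+1); last by rewrite muln0.
  have P := @runs_pop_io _ 5 (fun r o => set_go (isSome o) (set_1 (o == Some S1) r))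
    (Reg q a b t true f x y z : reg A) (bstacks s) [::] erefl.
  refine (@runs_while_step _ (@rgo A) _ _ _ _ _ _ _ _ _ (runs_seq P (runs_if _)) _) => //=.
    exact: runs_act.
  exact: runs_while_stop.
case: io => [|c io] Hs nb Hn.
  by apply: IH.
have P := @runs_pop_io _ 5 (fun r o => set_go (isSome o) (set_1 (o == Some S1) r))
    (Reg q a b t true f x y z : reg A) (bstacks s) (c :: io) erefl.
have P2 := @runs_pop_io _ 5 (fun r o => set_2 (o == Some S1) r)
    (Reg q a b t true f (c == S1) y z : reg A) (bstacks s) io erefl.
have P3 := @runs_pop_io _ 5 (fun r o => set_3 (o == Some S1) r)
    (Reg q a b t true f (c == S1) (ohead io == Some S1) z : reg A) (bstacks s)
    (behead io) erefl.
rewrite tokens_cons [foldl _ _ _]/=.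
set tok := (is1 c, _, _); set io' := behead (behead io).
have [|q1 [a1 [b1 [t1 [f1 [x1 [y1 [z1 P4]]]]]]]] :=
  @runs_token q a b t true f (c == S1) (ohead io == Some S1) (ohead (behead io) == Some S1)
  s io' n nb; first by move: Hn; rewrite /=; lia.
have sio : size io' <= size io by rewrite !size_behead; lia.
have [nb' Hb] := bstep_inv tok nb.
have [||q2 [a2 [b2 [t2 [f2 [x2 [y2 [z2 P5]]]]]]]] :=
  IH io' q1 a1 b1 t1 f1 x1 y1 z1 (bstep s tok) n _ nb' _.
- by move: Hs => /=; lia.
- by move: Hn Hb => /=; lia.
exists q2, a2, b2, t2, f2, x2, y2, z2.
apply: (@runs_weaken _ _ _ (1 + (1 + (1 + token_cost n)).+1 +
   ((token_cost n + 5) * size io' + 5)).+1); last first.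
  have : (token_cost n + 5) * size io' <= (token_cost n + 5) * size io.
    by rewrite leq_mul2l sio orbT.
  by rewrite /= mulnS; move: (_ * size io') (_ * size io) => ? ? ?; lia.
refine (@runs_while_step _ (@rgo A) _ _ _ _ _ _ _ _ _ (runs_seq P (runs_if _)) P5) => //=.
exact: (runs_seq P2 (runs_seq P3 P4)).
Qed.

Definition mread : mach (reg A) :=
  mseq (mact (set_f true)) (mwhile (@rf A)
    (mseq (mpop_io 5 (fun r o => match o with
        | Some S0 => set_1 false r | Some S1 => set_1 true r | _ => set_f false r end))
      (mif (@rf A) (mpush 2 (@r1 A)) (mskip A)))).

Lemma runs_read q a b t go f x y z s0 s1 X s3 s4 io : exists x',
  runs mread (Reg q a b t go f x y z : reg A, [:: s0; s1; X; s3; s4], io)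
    (4 * size io + 6)
    (Reg q a b t go false x' y z,
     [:: s0; s1; (leading_bits io X).1; s3; s4], (leading_bits io X).2).
Proof.
suff W : forall X x, exists x',
  runs (mwhile (@rf A)
    (mseq (mpop_io 5 (fun r o => match o with
        | Some S0 => set_1 false r | Some S1 => set_1 true r | _ => set_f false r end))
      (mif (@rf A) (mpush 2 (@r1 A)) (mskip A))))
    (Reg q a b t go true x y z : reg A, [:: s0; s1; X; s3; s4], io)
    (4 * size io + 5)
    (Reg q a b t go false x' y z,
     [:: s0; s1; (leading_bits io X).1; s3; s4], (leading_bits io X).2).
  have [x' P] := W X x; exists x'; rewrite addnS -add1n.
  by apply: (runs_seq (runs_act _ _ _ _)).
elim: io {X x f} => [|c io IH] X x.
  exists x; apply: (@runs_weaken _ _ _ (1 + 1.+1 + 1).+1) => //.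
  have P := @runs_pop_io _ 5 (fun r o => match o with
        | Some S0 => set_1 false r | Some S1 => set_1 true r | _ => set_f false r end)
    (Reg q a b t go true x y z : reg A) [:: s0; s1; X; s3; s4] [::] erefl.
  refine (@runs_while_step _ (@rf A) _ _ _ _ _ _ _ _ _ (runs_seq P (runs_if _)) _) => //=.
    exact: runs_act.
  exact: runs_while_stop.
have P := @runs_pop_io _ 5 (fun r o => match o with
        | Some S0 => set_1 false r | Some S1 => set_1 true r | _ => set_f false r end)
    (Reg q a b t go true x y z : reg A) [:: s0; s1; X; s3; s4] (c :: io) erefl.
have push v := runs_push (@r1 A) (Reg q a b t go true v y z) io
  (isT : 2 < size [:: s0; s1; X; s3; s4]).
have stop x1 : runs (mwhile (@rf A)
    (mseq (mpop_io 5 (fun r o => match o with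
        | Some S0 => set_1 false r | Some S1 => set_1 true r | _ => set_f false r end))
      (mif (@rf A) (mpush 2 (@r1 A)) (mskip A))))
    (Reg q a b t go false x1 y z : reg A, [:: s0; s1; X; s3; s4], io) 1
    (Reg q a b t go false x1 y z : reg A, [:: s0; s1; X; s3; s4], io).
  exact: runs_while_stop.
case: c P => P; rewrite /= in P.
- exists x; apply: (@runs_weaken _ _ _ (1 + 1.+1 + 1).+1); last by rewrite /=; lia.
  refine (@runs_while_step _ (@rf A) _ _ _ _ _ _ _ _ _ (runs_seq P (runs_if _)) (stop _)) => //=.
  exact: runs_act.
- have [x' P5] := IH (false :: X) false; exists x'.
  apply: (@runs_weaken _ _ _ (1 + 1.+1 + (4 * size io + 5)).+1); last by rewrite /=; lia.
  refine (@runs_while_step _ (@rf A) _ _ _ _ _ _ _ _ _ (runs_seq P (runs_if _)) P5) => //=.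
- have [x' P5] := IH (true :: X) true; exists x'.
  apply: (@runs_weaken _ _ _ (1 + 1.+1 + (4 * size io + 5)).+1); last by rewrite /=; lia.
  refine (@runs_while_step _ (@rf A) _ _ _ _ _ _ _ _ _ (runs_seq P (runs_if _)) P5) => //=.
- exists x; apply: (@runs_weaken _ _ _ (1 + 1.+1 + 1).+1); last by rewrite /=; lia.
  refine (@runs_while_step _ (@rf A) _ _ _ _ _ _ _ _ _ (runs_seq P (runs_if _)) (stop _)) => //=.
  exact: runs_act.
Qed.

Definition mmajority : mach (reg A) :=
  mseq mread (mseq (mact (set_go true)) (mseq mloop
    (mseq (mpop 4 (fun r o => set_1 (o == Some true) r))
          (mpush_io 5 (fun r => if r1 r then S1 else S0))))).

Definition majority_out (w : seq sym) : seq sym :=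
  let: (x, io) := leading_bits w [::] in
  [:: if ohead (bv (foldl bstep (BState x [::] [::] [::]) (tokens io))) == Some true
      then S1 else S0].

Lemma majority_TM : exists T c, poly_time T c /\
  forall w, nonblank w -> tm_out T c w = majority_out w.
Proof.
(* Input and program have at most n symbols each, so 2 * n bounds all stored data while the program
   is run. *)
pose b n := 4 * n + 20 + (token_cost (2 * n) + 5) * n.
apply: (@TM_of_runs _ (Reg ord0 Blank Blank false false false false false false : reg A)
  mmajority 5 majority_out b).
  by rewrite /b /token_cost; polyb_tac.
move=> w nw.
have [x P1] := runs_read ord0 Blank Blank false false false false false false
  [::] [::] [::] [::] [::] w.
have [X [io E]] : exists X io, leading_bits w [::] = (X, io).
  by case: (leading_bits _ _) => X io; exists X, io.
have [sX sio] := size_leading_bits w [::]; rewrite /majority_out.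
rewrite E /= in P1 sX sio *.
have [|||q [a [b1 [t [f [x1 [y1 [z1 P2]]]]]]]] := @runs_loop io io ord0 Blank Blank false false x
  false false (BState X [::] [::] [::]) (2 * size w) => //; first by rewrite /=; lia.
move: P2; set s := foldl _ _ _ => P2.
have P3 := runs_pop (fun r o => set_1 (o == Some true) r)
  (Reg q a b1 t false f x1 y1 z1 : reg A) [::] (isT : 4 < size (bstacks s)).
have P4 := @runs_push_io _ 5 (fun r => if r1 r then S1 else S0)
  (Reg q a b1 t false f (ohead (bv s) == Some true) y1 z1 : reg A)
  [:: [::]; dbl (bbuf s); bx s; bx' s; behead (bv s)] [::] erefl _.
do 2 eexists; apply: runs_weaken (runs_seq P1 (runs_seq (runs_act _ _ _ _)
  (runs_seq P2 (runs_seq P3 (P4 _))))) _ => /=.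
  by case: ifP.
rewrite /b; have := leq_mul (leqnn (token_cost (2 * size w) + 5)) sio.
by lia.
Qed.

End VotingLoop.

(** * The machine producing embedded circuits *)

(* Reads a numeral from its low end: digit pairs (1, d) spell [n] in binary, most significant
   digit first, and a 0 closes the list; the second result counts the digits consumed. *)
Fixpoint decode (fuel u n k : nat) : nat * nat :=
  if fuel is fuel'.+1 then
    if odd u then decode fuel' u./2./2 (2 * n + odd u./2) k.+2 else (n, k.+1)
  else (n, k).

(** A digit pair about doubles [n] but divides [u] by four, so (n + 2) * (u + 1) does not increase.
    Hence the decoded length is linear in the given one even on numbers that are no codes, and
    writing it in unary is affordable. *)
Lemma decode_bound fuel u n k S : u < fuel -> (n + 2) * (u + 1) <= S ->
  (decode fuel u n k).1 <= S /\ (decode fuel u n k).2 <= k + 2 * fuel.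
Proof.
elim: fuel u n k => [//|fuel IH] u n k Hu HS /=; case: ifP => ou; last first.
  by split=> /=; nia.
have Eu : u = (odd u./2 + u./2./2.*2).*2.+1.
  by rewrite odd_double_half -{1}(odd_double_half u) ou add1n.
have Hd : odd u./2 <= 1 by case: (odd _).
case: (IH u./2./2 (2 * n + odd u./2) k.+2).
- by lia.
- move: Hd Eu; move: (nat_of_bool _) (u./2./2) => d v Hd Eu.
  by nia.
- by move=> ? ?; split=> //; lia.
Qed.

(* The position of the current field modulo 3: type, first and second qubit of a gate. *)
Definition next_field (c : bool * bool) : bool * bool := (~~ c.1 && ~~ c.2, c.1).

(** Appending k zeros to a binary numeral multiplies it by 2^k: qubit indices are scaled by copying
    symbols, without arithmetic. Gate types are left alone. *)
Fixpoint shift_fields (k : nat) (c : bool * bool) (s : seq sym) : seq sym :=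
  match s with
  | [::] => if c.1 || c.2 then nseq k S0 else [::]
  | Sep :: s' => (if c.1 || c.2 then nseq k S0 else [::]) ++ Sep :: shift_fields k (next_field c) s'
  | a :: s' => a :: shift_fields k c s' end.

Lemma shift_fields_nonblank k c s : nonblank s -> nonblank (shift_fields k c s).
Proof.
have nk : nonblank (nseq k S0) by elim: k.
elim: s c => [|a s IH] c /=; first by case: ifP.
move=> /andP[an sn]; have := IH c sn; have := IH (next_field c) sn.
by case: a an => //= _ H1 H2; rewrite nonblank_cat /= H1 andbT; case: ifP.
Qed.

Lemma size_shift_fields k c s : size (shift_fields k c s) <= (size s).+1 * k.+1.
Proof.
elim: s c => [|a s IH] c /=; first by case: ifP; rewrite ?size_nseq //=; lia.
have := IH c; have := IH (next_field c).
case: a => /=; rewrite ?size_cat /=; try lia.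
by case: ifP; rewrite ?size_nseq /=; lia.
Qed.

Section ShiftingMachine.
Variables (G : TM) (cG : nat).
Hypothesis HG : poly_time G cG.
Implicit Types (r : reg G) (ss : seq (seq bool)) (io : seq sym).

(** Division of a unary number by two: [r3] is toggled at every symbol, one entry is stacked per
    pair, and [r3] is finally the remainder. *)
Definition mhalve : mach (reg G) :=
  mseq (mact (fun r => set_f true (set_3 false r)))
  (mseq (mwhile (@rf G)
     (mseq (mpop_io 5 (fun r o => if o is Some _ then set_3 (~~ r3 r) r else set_f false r))
           (mif (fun r => rf r && ~~ r3 r) (mpush 2 (fun=> true)) (mskip G))))
   (mmove 2 (mpush_io 5 (fun=> S1)))).

Lemma runs_halve q a b t go f x y z s0 s1 s3 s4 io :
  runs mhalve (Reg q a b t go f x y z : reg G, [:: s0; s1; [::]; s3; s4], io)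
    (10 * size io + 20)
    (Reg q a b t go false false y (odd (size io)), [:: s0; s1; [::]; s3; s4],
     nseq (size io)./2 S1).
Proof.
have W : forall io n x z, runs (mwhile (@rf G)
     (mseq (mpop_io 5 (fun r o => if o is Some _ then set_3 (~~ r3 r) r else set_f false r))
           (mif (fun r => rf r && ~~ r3 r) (mpush 2 (fun=> true)) (mskip G))))
   (Reg q a b t go true x y z : reg G, [:: s0; s1; nseq n true; s3; s4], io)
   (4 * size io + 5)
   (Reg q a b t go false x y (odd (z + size io)),
    [:: s0; s1; nseq (n + (z + size io)./2) true; s3; s4], [::]).
  elim=> [|c io' IH] n x' z'; have P := @runs_pop_io _ 5
      (fun r o => if o is Some _ then set_3 (~~ r3 r) r else set_f false r)
      (Reg q a b t go true x' y z' : reg G) [:: s0; s1; nseq n true; s3; s4] _ erefl.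
    apply: (@runs_weaken _ _ _ (1 + 1.+1 + 1).+1) => //.
    have -> : odd (z' + size (@nil sym)) = z' by rewrite addn0 oddb.
    have -> : (z' + size (@nil sym))./2 = 0 by case: (z').
    rewrite addn0.
    refine (@runs_while_step _ (@rf G) _ _ _ _ _ _ _ _ _ (runs_seq (P [::]) (runs_if _)) _) => //=.
      exact: runs_act.
    exact: runs_while_stop.
  apply: (@runs_weaken _ _ _ (1 + 1.+1 + (4 * size io' + 5)).+1); last by rewrite /=; lia.
  have -> : odd (z' + size (c :: io')) = odd (~~ z' + size io') by rewrite !oddD /=; case: (z'); case: (odd (size io')).
  have -> : n + (z' + size (c :: io'))./2 = (n + z') + (~~ z' + size io')./2.
    by case: (z') => /=; lia.
  refine (@runs_while_step _ (@rf G) _ _ _ _ _ _ _ _ _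
    (runs_seq (P (c :: io')) (runs_if _)) (IH (n + z') x' (~~ z'))) => //=.
  have push := runs_push (fun=> true) (Reg q a b t go true x' y (~~ z') : reg G) io'
    (isT : 2 < size [:: s0; s1; nseq n true; s3; s4]).
  case: (z') push => /= push; first by rewrite addn1.
  by rewrite addn0; apply: runs_act.
have P1 := runs_act (fun r => set_f true (set_3 false r)) (Reg q a b t go f x y z : reg G)
  [:: s0; s1; [::]; s3; s4] io.
have P2 := W io 0 x false.
rewrite !add0n in P2.
have P3 := @runs_move G nat 2 (mpush_io 5 (fun=> S1)) 1
  (Reg q a b t go false x y (odd (size io))) 0 (nseq (size io)./2 true)
  (fun s _ => s.+1) (fun s y => [:: s0; s1; y; s3; s4])
  (fun s => nseq s S1) (fun _ _ => isT) (fun _ _ => erefl) (fun _ _ _ => erefl) _.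
have fold_size (n m : nat) : foldl (fun s _ => s.+1) m (nseq n true) = n + m.
  by elim: n m => //= n IH m; rewrite IH addnS addSn.
rewrite fold_size addn0 size_nseq in P3.
apply: runs_weaken (runs_seq P1 (runs_seq P2 (P3 _))) _.
  by move=> s y' b'; exact: (runs_push_io (fun=> S1)).
by rewrite /=; lia.
Qed.

Definition mdouble : mach (reg G) :=
  mseq (mmove 1 (mseq (mpush 2 (fun=> true)) (mpush 2 (fun=> true))))
       (mmove 2 (mpush 1 (fun=> true))).

Lemma runs_double q a b t go f x y z s0 n s3 s4 io :
  runs mdouble (Reg q a b t go f x y z : reg G, [:: s0; nseq n true; [::]; s3; s4], io)
    (13 * n + 12)
    (Reg q a b t go false false y z, [:: s0; nseq (2 * n) true; [::]; s3; s4], io).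
Proof.
have P1 := @runs_move G nat 1 (mseq (mpush 2 (fun=> true)) (mpush 2 (fun=> true))) 2
  (Reg q a b t go f x y z) 0 (nseq n true)
  (fun s _ => s.+2) (fun s y => [:: s0; y; nseq s true; s3; s4])
  (fun s => io) (fun _ _ => isT) (fun _ _ => erefl) (fun _ _ _ => erefl) _.
have P2 := @runs_move G nat 2 (mpush 1 (fun=> true)) 1
  (Reg q a b t go false false y z) 0 (nseq (2 * n) true)
  (fun s _ => s.+1) (fun s y => [:: s0; nseq s true; y; s3; s4])
  (fun s => io) (fun _ _ => isT) (fun _ _ => erefl) (fun _ _ _ => erefl) _.
have f1 k m : foldl (fun s _ => s.+1) m (nseq k true) = k + m.
  by elim: k m => //= k IH m; rewrite IH addnS addSn.
have f2 k m : foldl (fun s _ => s.+2) m (nseq k true) = 2 * k + m.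
  by elim: k m => [|k IH] m //=; rewrite IH mulnS; lia.
rewrite f1 addn0 size_nseq in P2.
rewrite f2 addn0 size_nseq /= in P1.
apply: runs_weaken (runs_seq (P1 _) (P2 _)) _.
- move=> s y' b'.
  have Q1 := runs_push (fun=> true) (set_f true (set_1 b' (Reg q a b t go f x y z : reg G))) io
    (isT : 2 < size [:: s0; y'; nseq s true; s3; s4]).
  have Q2 := runs_push (fun=> true) (set_f true (set_1 b' (Reg q a b t go f x y z : reg G))) io
    (isT : 2 < size [:: s0; y'; nseq s.+1 true; s3; s4]).
  exact: (runs_seq Q1 Q2).
- by move=> s y' b'; apply: runs_push.
- by lia.
Qed.

Definition mdecode : mach (reg G) :=
  mwhile (@rgo G) (mseq mhalve (mseq (mpush 3 (fun=> true))
    (mif (@r3 G)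
      (mseq mhalve (mseq (mpush 3 (fun=> true)) (mseq mdouble
        (mif (@r3 G) (mseq (mpush 1 (fun=> true)) (mpush 1 (fun=> true))) (mskip G)))))
      (mact (set_go false))))).

(** Stack 1 holds 2 * n ones rather than n, because [S1] is coded by two true bits: after decoding
    it is already the tape with the input 1^n of the machine simulated next. Stack 3 holds k in
    unary. *)
Lemma runs_decode fuel : forall q a b t f x y z s0 u n k s4 S io, size io = u -> u < fuel ->
  (n + 2) * (u + 1) <= S -> exists x' z' v, v <= u /\ runs mdecode (Reg q a b t true f x y z : reg G,
      [:: s0; nseq (2 * n) true; [::]; nseq k true; s4], io)
    ((70 * S + 80) * fuel)
    (Reg q a b t false false x' y z',
      [:: s0; nseq (2 * (decode fuel u n k).1) true; [::]; nseq (decode fuel u n k).2 true; s4],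
      nseq v S1).
Proof.
elim: fuel => [//|fuel IH] q a b t f x y z s0 u n k s4 S io Hio Hu HS.
have P1 := @runs_halve q a b t true f x y z s0 (nseq (2 * n) true) (nseq k true) s4 io.
have P2 := runs_push (fun=> true) (Reg q a b t true false false y (odd u) : reg G)
  (nseq u./2 S1) (isT : 3 < size [:: s0; nseq (2 * n) true; [::]; nseq k true; s4]).
rewrite Hio in P1; rewrite /=; case: ifP => ou; last first.
  exists false, false, u./2; split; first by lia.
  apply: (@runs_weaken _ _ _ (10 * u + 20 + (1 + 1.+1) + 1).+1); last by nia.
  refine (@runs_while_step _ (@rgo G) _ _ _ _ _ _ _ _ _ (runs_seq P1 (runs_seq P2
    (runs_if _))) _) => //.
    by rewrite /= ou; apply: runs_act.
  exact: runs_while_stop.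
have P3 := @runs_halve q a b t true false false y true s0 (nseq (2 * n) true)
  (nseq k.+1 true) s4 (nseq u./2 S1).
rewrite size_nseq in P3; set d := odd u./2 in P3 *.
have P4 := runs_push (fun=> true) (Reg q a b t true false false y d : reg G)
  (nseq u./2./2 S1) (isT : 3 < size [:: s0; nseq (2 * n) true; [::]; nseq k.+1 true; s4]).
have P5 := @runs_double q a b t true false false y d s0 (2 * n) (nseq k.+2 true) s4
  (nseq u./2./2 S1).
have Eu : u = (d + u./2./2.*2).*2.+1.
  by rewrite odd_double_half -{1}(odd_double_half u) ou add1n.
have [||x' [z' [v [Hv P6]]]] := IH q a b t false false y d s0 u./2./2 (2 * n + d) k.+2 s4 S _ (size_nseq _ S1) _ _.
- by lia.
- move: Eu; have : d <= 1 by case: (d).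
  by move: (nat_of_bool _) (u./2./2) => e w He Eu; nia.
exists x', z', v; split; first by lia.
apply: (@runs_weaken _ _ _ ((10 * u + 20 + (1 + (10 * half u + 20 + (1 + (13 * (2 * n) + 12 + 2.+1))).+1))
  + (70 * S + 80) * fuel).+1); last first.
  by rewrite mulnS; move: (_ * fuel) => ?; nia.
refine (@runs_while_step _ (@rgo G) _ _ _ _ _ _ _ _ _ (runs_seq P1 (runs_seq P2
    (runs_if _))) P6) => //.
rewrite /= ou; apply: (runs_seq P3 (runs_seq P4 (runs_seq P5 _))).
apply: runs_if => /=; case: (d).
  have Q1 := runs_push (fun=> true) (Reg q a b t true false false y true : reg G)
    (nseq u./2./2 S1) (isT : 1 < size [:: s0; nseq (2 * (2 * n)) true; [::]; nseq k.+2 true; s4]).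
  have Q2 := runs_push (fun=> true) (Reg q a b t true false false y true : reg G)
    (nseq u./2./2 S1) (isT : 1 < size [:: s0; nseq (2 * (2 * n)).+1 true; [::]; nseq k.+2 true; s4]).
  rewrite (_ : 2 * (2 * n + true) = (2 * (2 * n)).+2); last by lia.
  exact: (runs_seq Q1 Q2).
by rewrite addn0; apply: (runs_weaken (runs_act _ _ _ _)).
Qed.

Definition mdrain_io : mach (reg G) :=
  mseq (mact (set_f true)) (mwhile (@rf G) (mpop_io 5 (fun r o => set_f (isSome o) r))).

Lemma runs_drain_io q a b t go f x y z s0 s1 s2 s3 s4 io :
  runs mdrain_io (Reg q a b t go f x y z : reg G, [:: s0; s1; s2; s3; s4], io)
    (2 * size io + 4) (Reg q a b t go false x y z, [:: s0; s1; s2; s3; s4], [::]).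
Proof.
rewrite addnS -add1n; apply: (runs_seq (runs_act _ _ _ _)).
elim: io => [|c io IH].
  have P := @runs_pop_io _ 5 (fun r o => set_f (isSome o) r)
    (Reg q a b t go true x y z : reg G) [:: s0; s1; s2; s3; s4] [::] erefl.
  apply: (@runs_weaken _ _ _ (1 + 1).+1) => //.
  refine (@runs_while_step _ (@rf G) _ _ _ _ _ _ _ _ _ P _) => //.
  exact: runs_while_stop.
have P := @runs_pop_io _ 5 (fun r o => set_f (isSome o) r)
    (Reg q a b t go true x y z : reg G) [:: s0; s1; s2; s3; s4] (c :: io) erefl.
apply: (@runs_weaken _ _ _ (1 + (2 * size io + 3)).+1); last by rewrite /=; lia.
by refine (@runs_while_step _ (@rf G) _ _ _ _ _ _ _ _ _ P IH).
Qed.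

(** Stack 3 is the only copy of k; it is saved on stack 4 while the zeros are written, and then
    restored. *)
Definition mpad : mach (reg G) :=
  mseq (mmove 3 (mseq (mpush 4 (fun=> true)) (mpushS 2 (fun=> S0))))
       (mmove 4 (mpush 3 (fun=> true))).

Lemma runs_pad q a b t go f x y z s0 s1 acc k io :
  runs mpad (Reg q a b t go f x y z : reg G, [:: s0; s1; dbl acc; nseq k true; [::]], io)
    (10 * k + 12)
    (Reg q a b t go false false y z,
     [:: s0; s1; dbl (nseq k S0 ++ acc); nseq k true; [::]], io).
Proof.
have P1 := @runs_move G nat 3 (mseq (mpush 4 (fun=> true)) (mpushS 2 (fun=> S0))) 3
  (Reg q a b t go f x y z) 0 (nseq k true)
  (fun s _ => s.+1) (fun s y => [:: s0; s1; dbl (nseq s S0 ++ acc); y; nseq s true])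
  (fun s => io) (fun _ _ => isT) (fun _ _ => erefl) (fun _ _ _ => erefl) _.
have P2 := @runs_move G nat 4 (mpush 3 (fun=> true)) 1
  (Reg q a b t go false false y z) 0 (nseq k true)
  (fun s _ => s.+1) (fun s y => [:: s0; s1; dbl (nseq k S0 ++ acc); nseq s true; y])
  (fun s => io) (fun _ _ => isT) (fun _ _ => erefl) (fun _ _ _ => erefl) _.
have f1 n m : foldl (fun s _ => s.+1) m (nseq n true) = n + m.
  by elim: n m => //= n IH m; rewrite IH addnS addSn.
rewrite f1 addn0 size_nseq in P2.
rewrite f1 addn0 size_nseq in P1.
apply: runs_weaken (runs_seq (P1 _) (P2 _)) _.
- move=> s y' b'.
  have Q1 := runs_push (fun=> true) (set_f true (set_1 b' (Reg q a b t go f x y z : reg G))) io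
    (isT : 4 < size [:: s0; s1; dbl (nseq s S0 ++ acc); y'; nseq s true]).
  have Q2 := @runs_pushS G 2 (fun=> S0) (set_f true (set_1 b' (Reg q a b t go f x y z : reg G)))
    [:: s0; s1; dbl (nseq s S0 ++ acc); y'; nseq s.+1 true] io (nseq s S0 ++ acc) isT erefl.
  exact: (runs_seq Q1 Q2).
- by move=> s y' b'; apply: runs_push.
- by lia.
Qed.

Definition mfields : mach (reg G) :=
  mwhile (@rgo G) (mseq (mpopS 1 (fun r c => set_a c r))
    (mif (fun r => (ra r == S0) || (ra r == S1)) (mpushS 2 (@ra G))
      (mseq (mif (fun r => r2 r || r3 r) mpad (mskip G))
        (mif (fun r => ra r == Sep)
          (mseq (mpushS 2 (@ra G))
                (mact (fun r => set_2 (~~ r2 r && ~~ r3 r) (set_3 (r2 r) r))))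
          (mact (set_go false)))))).

Lemma runs_fields w : forall q a b t f x c s0 acc k io, exists a' t' f' x' y' z' w',
  runs mfields (Reg q a b t true f x c.1 c.2 : reg G,
      [:: s0; dbl w; dbl acc; nseq k true; [::]], io)
    ((10 * k + 30) * (size w).+1)
    (Reg q a' b t' false f' x' y' z',
      [:: s0; dbl w'; dbl (catrev (shift_fields k c (take_nonblank w)) acc);
          nseq k true; [::]], io).
Proof.
have pad q a b t f x c s0 s1 acc k io : exists f' x',
  runs (mif (fun r => r2 r || r3 r) mpad (mskip G))
    (Reg q a b t true f x c.1 c.2 : reg G, [:: s0; s1; dbl acc; nseq k true; [::]], io)
    (10 * k + 13)
    (Reg q a b t true f' x' c.1 c.2,
      [:: s0; s1; dbl ((if c.1 || c.2 then nseq k S0 else [::]) ++ acc); nseq k true; [::]], io).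
  case E : (c.1 || c.2).
    exists false, false; rewrite addnS; apply: runs_if; rewrite /= E.
    exact: runs_pad.
  exists f, x; rewrite addnS; apply: runs_if; rewrite /= E.
  by apply: runs_weaken (runs_act _ _ _ _) _; lia.
have rpad k s acc : catrev ((if s then nseq k S0 else [::])) acc =
    (if s then nseq k S0 else [::]) ++ acc.
  by case: s => //; rewrite catrevE rev_nseq.
(* An empty stack and an explicit blank both end the output, and in both cases the last field still
   has to receive its zeros. *)
have last_step q a b t f x c s0 w0 acc k io : head Blank w0 = Blank ->
  exists a' t' f' x' y' z' w',
  runs mfields (Reg q a b t true f x c.1 c.2 : reg G,
      [:: s0; dbl w0; dbl acc; nseq k true; [::]], io)
    ((10 * k + 30) * 1)
    (Reg q a' b t' false f' x' y' z',
      [:: s0; dbl w'; dbl (catrev (if c.1 || c.2 then nseq k S0 else [::]) acc);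
          nseq k true; [::]], io).
  move=> Hh; have P := @runs_popS G 1 (fun r c => set_a c r) (Reg q a b t true f x c.1 c.2)
    [:: s0; dbl w0; dbl acc; nseq k true; [::]] io w0 isT erefl.
  rewrite Hh /= in P.
  have [f' [x' P1]] := pad q Blank b false f x c s0 (dbl (behead w0)) acc k io.
  exists Blank, false, f', x', c.1, c.2, (behead w0); rewrite rpad.
  apply: (@runs_weaken _ _ _ ((2 + (10 * k + 13 + 1.+1).+1) + 1).+1); last by lia.
  refine (@runs_while_step _ (@rgo G) _ _ _ _ _ _ _ _ _
    (runs_seq P (runs_if _)) _) => //=.
    apply: (runs_seq P1); apply: runs_if => /=; exact: runs_act.
  exact: runs_while_stop.
elim: w => [|d w IH] q a b t f x c s0 acc k io; first exact: last_step.
have P := @runs_popS G 1 (fun r c => set_a c r) (Reg q a b t true f x c.1 c.2)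
    [:: s0; dbl (d :: w); dbl acc; nseq k true; [::]] io (d :: w) isT erefl.
rewrite /= in P.
have bit (e : sym) : (e == S0) || (e == S1) -> forall t1,
   runs (mif (fun r => (ra r == S0) || (ra r == S1)) (mpushS 2 (@ra G))
      (mseq (mif (fun r => r2 r || r3 r) mpad (mskip G))
        (mif (fun r => ra r == Sep)
          (mseq (mpushS 2 (@ra G))
                (mact (fun r => set_2 (~~ r2 r && ~~ r3 r) (set_3 (r2 r) r))))
          (mact (set_go false)))))
     (Reg q e b t1 true f x c.1 c.2 : reg G,
       [:: s0; dbl w; dbl acc; nseq k true; [::]], io) 3
     (Reg q e b t1 true f x c.1 c.2 : reg G,
       [:: s0; dbl w; dbl (e :: acc); nseq k true; [::]], io).
  move=> He t1; apply: runs_if; rewrite /= He.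
  exact: (@runs_pushS G 2 (@ra G) (Reg q e b t1 true f x c.1 c.2)
    [:: s0; dbl w; dbl acc; nseq k true; [::]] io acc isT erefl).
case: d P => P; rewrite /= in P.
- have [a' [t' [f' [x' [y' [z' [w' Q]]]]]]] :=
    last_step q a b t f x c s0 (Blank :: w) acc k io erefl.
  exists a', t', f', x', y', z', w'.
  by apply: runs_weaken Q _; rewrite leq_mul2l /= orbT.
- have [a' [t' [f' [x' [y' [z' [w' Q]]]]]]] := IH q S0 b false f x c s0 (S0 :: acc) k io.
  exists a', t', f', x', y', z', w'.
  apply: (@runs_weaken _ _ _ ((2 + 3) + ((10 * k + 30) * (size w).+1)).+1); last first.
    by rewrite [size (_ :: _)]/= (mulnS _ (size w).+1); lia.
  by refine (@runs_while_step _ (@rgo G) _ _ _ _ _ _ _ _ _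
    (runs_seq P (bit _ _ _)) Q).
- have [a' [t' [f' [x' [y' [z' [w' Q]]]]]]] := IH q S1 b true f x c s0 (S1 :: acc) k io.
  exists a', t', f', x', y', z', w'.
  apply: (@runs_weaken _ _ _ ((2 + 3) + ((10 * k + 30) * (size w).+1)).+1); last first.
    by rewrite [size (_ :: _)]/= (mulnS _ (size w).+1); lia.
  by refine (@runs_while_step _ (@rgo G) _ _ _ _ _ _ _ _ _
    (runs_seq P (bit _ _ _)) Q).
have [f1 [x1 P1]] := pad q Sep b true f x c s0 (dbl w) acc k io.
set acc1 := _ ++ acc in P1.
have P2 := @runs_pushS G 2 (@ra G) (Reg q Sep b true true f1 x1 c.1 c.2)
    [:: s0; dbl w; dbl acc1; nseq k true; [::]] io acc1 isT erefl.
have P3 := runs_act (fun r => set_2 (~~ r2 r && ~~ r3 r) (set_3 (r2 r) r))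
  (Reg q Sep b true true f1 x1 c.1 c.2 : reg G)
    [:: s0; dbl w; dbl (Sep :: acc1); nseq k true; [::]] io.
have [a' [t' [f' [x' [y' [z' [w' Q]]]]]]] :=
  IH q Sep b true f1 x1 (next_field c) s0 (Sep :: acc1) k io.
exists a', t', f', x', y', z', w'.
have -> : catrev (shift_fields k c (take_nonblank (Sep :: w))) acc =
    catrev (shift_fields k (next_field c) (take_nonblank w)) (Sep :: acc1).
  rewrite /= catrev_catl /= /acc1 -rpad //.
apply: (@runs_weaken _ _ _ ((2 + (10 * k + 13 + (2 + 1).+1).+1) +
    ((10 * k + 30) * (size w).+1)).+1); last first.
  by rewrite [size (_ :: _)]/= (mulnS _ (size w).+1); lia.
refine (@runs_while_step _ (@rgo G) _ _ _ _ _ _ _ _ _ (runs_seq P (runs_if _)) Q) => //=.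
apply: (runs_seq P1); apply: runs_if => /=.
exact: (runs_seq P2 P3).
Qed.

Definition moutput : mach (reg G) :=
  mseq (mact (set_f true)) (mwhile (@rf G)
    (mseq (mpopS 2 (fun r c => set_f (c != Blank) (set_a c r)))
      (mif (@rf G) (mpush_io 5 (@ra G)) (mskip G)))).

Lemma runs_output q a b t go f x y z s0 s1 acc s3 s4 io : nonblank acc ->
  exists a' t', runs moutput
    (Reg q a b t go f x y z : reg G, [:: s0; s1; dbl acc; s3; s4], io) (5 * size acc + 10)
    (Reg q a' b t' go false x y z, [:: s0; s1; [::]; s3; s4], catrev acc io).
Proof.
suff W : forall acc io a t, nonblank acc ->
  exists a' t', runs (mwhile (@rf G)
    (mseq (mpopS 2 (fun r c => set_f (c != Blank) (set_a c r)))
      (mif (@rf G) (mpush_io 5 (@ra G)) (mskip G))))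
    (Reg q a b t go true x y z : reg G, [:: s0; s1; dbl acc; s3; s4], io) (5 * size acc + 9)
    (Reg q a' b t' go false x y z, [:: s0; s1; [::]; s3; s4], catrev acc io).
  move=> nb; have [a' [t' P]] := W acc io a t nb; exists a', t'.
  by rewrite addnS -add1n; apply: (runs_seq (runs_act _ _ _ _)).
elim=> [|c acc' IH] io' a1 t1 /= nb.
  exists Blank, false; apply: (@runs_weaken _ _ _ ((2 + 1.+1) + 1).+1) => //.
  have P := @runs_popS G 2 (fun r c => set_f (c != Blank) (set_a c r))
    (Reg q a1 b t1 go true x y z) [:: s0; s1; dbl [::]; s3; s4] io' [::] isT erefl.
  refine (@runs_while_step _ (@rf G) _ _ _ _ _ _ _ _ _ (runs_seq P (runs_if _)) _) => //=.
    exact: runs_act.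
  exact: runs_while_stop.
move: nb => /andP[cn nb].
have cb : c != Blank by case: (c) cn.
have P := @runs_popS G 2 (fun r c => set_f (c != Blank) (set_a c r))
    (Reg q a1 b t1 go true x y z) [:: s0; s1; dbl (c :: acc'); s3; s4] io' (c :: acc') isT erefl.
rewrite /= cb in P.
have P1 := @runs_push_io _ 5 (@ra G)
    (Reg q c b (sym_code c).1 go true x y z : reg G) [:: s0; s1; dbl acc'; s3; s4] io' erefl cb.
have [a' [t' Q]] := IH (c :: io') c (sym_code c).1 nb; exists a', t'.
apply: (@runs_weaken _ _ _ ((2 + 1.+1) + (5 * size acc' + 9)).+1); last by lia.
by refine (@runs_while_step _ (@rf G) _ _ _ _ _ _ _ _ _ (runs_seq P (runs_if _)) Q).
Qed.

Definition mshift : mach (reg G) :=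
  mseq (mpop_io 5 (fun r _ => set_go true r)) (mseq mdecode (mseq mdrain_io
   (mseq (simloop G) (mseq (mact (fun r => set_go true (set_2 false (set_3 false r))))
    (mseq mfields moutput))))).

(** The code is carried by N - 1 because the admissible N satisfy v * 2^k < N <= (v + 1) * 2^k,
    which says that N - 1 is v followed by k arbitrary bits. *)
Definition shift_out (w : seq sym) : seq sym :=
  let: (n, k) := decode (size w).+1 (size w).-1 0 0 in
  shift_fields k (false, false) (tm_out G cG (unary n)).

Lemma size_take_nonblank s : size (take_nonblank s) <= size s.
Proof. by elim: s => //= -[]. Qed.

Lemma shift_TM : exists T c, poly_time T c /\
  forall w, nonblank w -> tm_out T c w = shift_out w.
Proof.
(* For an input of length n, [S] bounds the decoded length, [P] the running time of [G] on it, [W]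
   the simulated tape and [K] the number of appended zeros. *)
pose S n := 2 * n + 2.
pose P n := pbound cG (S n).
pose W n := S n + 2 * P n.
pose K n := 2 * n.+1.
pose b n := 1 + ((70 * S n + 80) * n.+1 + (2 * n + 4 + (13 * P n + 1 + (1 +
  ((10 * K n + 30) * (W n).+1 + (5 * ((W n).+1 * (K n).+1) + 10)))))).
apply: (@TM_of_runs _ (Reg ord0 Blank Blank false false false false false false : reg G)
  mshift 5 shift_out b).
  by rewrite /b /K /W /P /S; polyb_tac.
move=> w nw; rewrite /shift_out; set N := size w.
have P1 := @runs_pop_io _ 5 (fun r _ => set_go true r)
  (Reg ord0 Blank Blank false false false false false false : reg G) (nseq 5 [::]) w erefl.
have HS : (0 + 2) * (N.-1 + 1) <= S N by rewrite /S; lia.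
have Hfuel : N.-1 < N.+1 by lia.
have [x1 [z1 [v [Hv P2]]]] := @runs_decode N.+1 ord0 Blank Blank false false false false false
  [::] N.-1 0 0 [::] (S N) (behead w) (size_behead w) Hfuel HS.
have [Hn Hk] := decode_bound 0 Hfuel HS.
case: (decode N.+1 N.-1 0 0) Hn Hk P2 => n k /= Hn Hk P2.
have P3 := @runs_drain_io ord0 Blank Blank false false false x1 false z1
  [::] (nseq (2 * n) true) [::] (nseq k true) [::] (nseq v S1).
have du : nseq (2 * n) true = dbl (unary n).
  by elim: (n) => [|m IH] //; rewrite mulnS /dbl /= in IH *; rewrite IH.
rewrite {}du in P2 P3.
have nu : nonblank (unary n) by elim: (n).
set p := pbound cG (size (unary n)).
have hn : halted (iter p (@step G) (init_config G (unary n))) := HG nu.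
have ini : c_state (init_config G (unary n)) = ord0 /\ c_left (init_config G (unary n)) = [::].
  by case: (n).
have [||a2 [b2 [t2 [w2 [P4 hw bw sw _]]]]] :=
  @runs_simloop G (init_config G (unary n)) p (unary n)
   [:: [::]; nseq k true; [::]] [::] Blank Blank false false false x1 false z1 _ _ hn.
- by case: (n).
- by case: (n).
rewrite {1}ini.1 {1}ini.2 in P4.
pose c := run G p (unary n); rewrite -[iter _ _ _]/c in hn hw bw P4.
have Ev : tm_out G cG (unary n) = take_nonblank w2.
  rewrite /tm_out -/p -/c hn /output_of -hw -bw.
  by case: (w2).
have P5 := runs_act (fun r => set_go true (set_2 false (set_3 false r)))
  (Reg (c_state c) a2 b2 t2 false false x1 false z1)
  [:: dbl (c_left c); dbl w2; [::]; nseq k true; [::]] [::].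
have [a3 [t3 [f3 [x3 [y3 [z3 [w3 P6]]]]]]] := @runs_fields w2 (c_state c) a2 b2 t2 false x1
  (false, false) (dbl (c_left c)) [::] k [::].
set s := shift_fields k (false, false) (take_nonblank w2) in P6.
have ns : nonblank s.
  by apply: shift_fields_nonblank; elim: (w2) => //= -[].
have nr : nonblank (catrev s [::]) by rewrite nonblankE -/(rev s) mem_rev -nonblankE.
have [a4 [t4 P7]] := @runs_output (c_state c) a3 b2 t3 false f3 x3 y3 z3 (dbl (c_left c))
  (dbl w3) (catrev s [::]) (nseq k true) [::] [::] nr.
rewrite -[catrev (catrev s [::]) [::]]/(rev (rev s)) revK in P7.
do 2 eexists; rewrite Ev.
apply: runs_weaken (runs_seq P1 (runs_seq P2 (runs_seq P3 (runs_seq P4 (runs_seq P5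
  (runs_seq P6 P7)))))) _.
have Hp : p <= P N by apply: pbound_mono; rewrite size_nseq.
have Hw2 : size w2 <= W N by apply: leq_trans sw _; rewrite size_nseq /W; lia.
have Hs : size (catrev s [::]) <= (W N).+1 * (K N).+1.
  rewrite -/(rev s) size_rev; apply: leq_trans (size_shift_fields _ _ _) _.
  apply: leq_mul; last by rewrite /K; lia.
  by rewrite ltnS; apply: leq_trans (size_take_nonblank _) Hw2.
have H6 : (10 * k + 30) * (size w2).+1 <= (10 * K N + 30) * (W N).+1.
  by apply: leq_mul; rewrite /K; lia.
rewrite /b -/N size_nseq !leq_add2l.
by repeat apply: leq_add => //; lia.
Qed.

End ShiftingMachine.

(** * Encoding of lengths and spreading of bits *)

(** The most significant digit is read first, from the low end; so the code of m./2 lies below the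
    pair 1 + 2 * odd m, a digit in base 4. The bound [j <= c] shows that fuel proportional to the
    number suffices, and the one on 4 ^ j that the code is polynomial in m. *)
Lemma decode_prefix m : exists j c, [/\ c < 4 ^ j, j <= c, 4 ^ j <= 4 * m ^ 2 + (m == 0) &
  forall fuel u k, decode (j + fuel) (u * 4 ^ j + c) 0 k = decode fuel u m (k + 2 * j)].
Proof.
elim/ltn_ind: m => m IH; case: (posnP m) => [->|m0].
  by exists 0, 0; split=> // fuel u k; rewrite muln1 !addn0.
have lt_half : m./2 < m by lia.
have [j [c [Hc Hj Hb Hd]]] := IH m./2 lt_half.
exists j.+1, ((1 + 2 * odd m) * 4 ^ j + c).
have H4 : 0 < 4 ^ j by rewrite expn_gt0.
have Ho : odd m <= 1 by case: (odd m).
have Hm : m = odd m + 2 * m./2 by lia.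
split.
- by rewrite expnS; move: (4 ^ j) H4 Hc => w *; nia.
- by move: (4 ^ j) H4 Hc => w *; nia.
- rewrite expnS addn0 leq_mul2l /=.
  apply: leq_trans Hb _; case: eqP => [->|/eqP mp]; first by rewrite muln0 expn_gt0 m0.
  by rewrite addn0; move: Hm; move: (m./2) (odd m : nat) => h o ->; nia.
- move=> fuel u k.
  have -> : u * 4 ^ j.+1 + ((1 + 2 * odd m) * 4 ^ j + c) =
            (4 * u + (1 + 2 * odd m)) * 4 ^ j + c by rewrite expnS; ring.
  rewrite addSnnS Hd [LHS]/=.
  have -> : odd (4 * u + (1 + 2 * odd m)) by lia.
  have -> : (4 * u + (1 + 2 * odd m))./2 = 2 * u + odd m by lia.
  have -> : odd (2 * u + odd m) = odd m by lia.
  have -> : (2 * u + odd m)./2 = u by lia.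
  by congr decode; lia.
Qed.

(** N - 1 is written as v, a closing zero, and the digit pairs of n; everything below v occupies
    exactly the k bits that the decoder counts. *)
Lemma decode_code n v : exists N k, [/\ decode N.+1 N.-1 0 0 = (n, k),
  v * 2 ^ k < N <= v.+1 * 2 ^ k & 2 ^ k <= 8 * n ^ 2 + 2].
Proof.
have [j [c [Hc Hj Hb Hd]]] := decode_prefix n.
(* The factor 2 in front of v makes room for the closing zero. *)
exists (2 * v * 4 ^ j + c).+1, (2 * j).+1.
have E4 : 2 ^ (2 * j).+1 = 2 * 4 ^ j by rewrite expnS expnM.
split.
- have -> : (2 * v * 4 ^ j + c).+2 = j + (2 * v * 4 ^ j + c - j + 1).+1.
    by move: (_ * 4 ^ j) => w; lia.
  by rewrite /= Hd /= oddM.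
- by rewrite E4; move: (4 ^ j) Hc => w *; nia.
- by rewrite E4; case: (n == 0) Hb; lia.
Qed.

Lemma bitn_idx x j : bitn (idx x) j = nth false x j.
Proof.
rewrite /bitn; elim: x j => [|b x IH] [|j] /=; rewrite ?div0n //.
  by rewrite divn1 oddD oddM /= addbF oddb.
rewrite expnS divnMA -IH; congr (odd (_ %/ _)).
by case: b; lia.
Qed.

Lemma idx_lt x : idx x < 2 ^ size x.
Proof. by elim: x => //= b x IH; rewrite expnS; case: b => /=; lia. Qed.

Lemma bitn_ext a b : (forall i, bitn a i = bitn b i) -> a = b.
Proof.
elim/ltn_ind: a b => a IH b H.
have E i : bitn a./2 i = bitn b./2 i.
  by have := H i.+1; rewrite /bitn expnS !divnMA !divn2.
have O := H 0; rewrite /bitn !divn1 in O.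
case: (posnP a) => [a0|a0]; last first.
  by rewrite -(odd_double_half a) -(odd_double_half b) O (IH a./2 _ b./2) //; lia.
subst a; symmetry; apply/eqP; rewrite -leqn0 leqNgt; apply/negP => b0.
have [m Hm] : exists m, bitn b m.
  elim/ltn_ind: b b0 {IH H E O} => b IHb b0.
  case: (boolP (odd b)) => ob; first by exists 0; rewrite /bitn divn1.
  have [||m Hm] := IHb b./2; try lia.
  by exists m.+1; move: Hm; rewrite /bitn expnS divnMA divn2.
by move: Hm; rewrite -H /bitn div0n.
Qed.

Lemma bitn_small a m i : a < 2 ^ m -> m <= i -> bitn a i = false.
Proof.
move=> Ha Hm; rewrite /bitn divn_small //.
by apply: leq_trans Ha _; rewrite leq_exp2l.
Qed.

Lemma bitn_ge a i : bitn a i -> 2 ^ i <= a.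
Proof. by rewrite leqNgt; apply: contraL => /bitn_small ->. Qed.

Lemma bitn_addX a i j : ~~ bitn a i -> bitn (a + 2 ^ i) j = bitn a j (+) (i == j).
Proof.
move=> Hi; rewrite /bitn; case: (ltngtP i j) => [ij|ji|->].
- rewrite addbF -(subnKC ij) addSnnS expnD !divnMA divnDr // divnn expn_gt0 /=.
  move: Hi; rewrite /bitn; move: (a %/ 2 ^ i) => w ow; rewrite expnS !divnMA.
  by congr (odd (_ %/ _)); lia.
- rewrite addbF -(subnK ji) addnS -addSn expnD divnDMl ?expn_gt0 // oddD oddX /=.
  by rewrite addbF.
- by rewrite divnDr // divnn expn_gt0 /= oddD.
Qed.

Lemma bitn_flipn i a j : bitn (flipn i a) j = bitn a j (+) (i == j).
Proof.
rewrite /flipn; case: ifP => Hi; last by rewrite bitn_addX // Hi.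
have Ha := bitn_ge Hi; set b := (a - 2 ^ i)%N.
have E : a = (b + 2 ^ i)%N by rewrite subnK.
have Hb : ~~ bitn b i.
  by move: Hi; rewrite {1}E /bitn divnDr // divnn expn_gt0 /= oddD; case: (odd _).
by rewrite E bitn_addX // -addbA addbb addbF.
Qed.

Lemma flipn_lt m i a : i < m -> a < 2 ^ m -> flipn i a < 2 ^ m.
Proof.
move=> im am; rewrite /flipn; case: ifP => Hi; first by apply: leq_ltn_trans am; exact: leq_subr.
have := idx_lt (mkseq (bitn (a + 2 ^ i)) m); rewrite size_mkseq.
suff -> : idx (mkseq (bitn (a + 2 ^ i)) m) = (a + 2 ^ i)%N by [].
apply: bitn_ext => j; rewrite bitn_idx; case: (ltnP j m) => jm; first by rewrite nth_mkseq.
rewrite nth_default ?size_mkseq // bitn_addX ?Hi // (bitn_small am jm).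
by rewrite (_ : i == j = false) //; lia.
Qed.

Lemma flipnK i : involutive (flipn i).
Proof. by move=> a; apply: bitn_ext => j; rewrite !bitn_flipn -addbA addbb addbF. Qed.

Lemma flipn_neq i a : flipn i a != a.
Proof.
apply/eqP => E; have := bitn_flipn i a i.
by rewrite E eqxx addbT; case: (bitn a i).
Qed.

Section Spread.
Variables (K q N : nat).
Hypothesis K0 : 0 < K.
Hypothesis q0 : 0 < q.
Hypothesis HqN : q.-1 * K < N <= q * K.

(* Puts bit [i] of [a] in position [i * K]. *)
Definition spread (a : nat) : nat :=
  idx (mkseq (fun j => (K %| j) && bitn a (j %/ K)) N).

(** The lower bound on N keeps the qubits below q valid after scaling, the upper bound keeps all
    others invalid. *)
Lemma mulK_lt i : (i * K < N) = (i < q).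
Proof. by case/andP: HqN => H1 H2; apply/idP/idP => H; nia. Qed.

Lemma bitn_spread a j : bitn (spread a) j = [&& j < N, K %| j & bitn a (j %/ K)].
Proof.
rewrite bitn_idx; case: (ltnP j N) => H; first by rewrite nth_mkseq.
by rewrite nth_default // size_mkseq.
Qed.

Lemma bitn_spreadM a i : i < q -> bitn (spread a) (i * K) = bitn a i.
Proof. by move=> iq; rewrite bitn_spread mulK_lt iq dvdn_mull ?mulnK. Qed.

Lemma spread_lt a : spread a < 2 ^ N.
Proof. by have := idx_lt (mkseq (fun j => (K %| j) && bitn a (j %/ K)) N); rewrite size_mkseq. Qed.

Lemma spread_inj a b : a < 2 ^ q -> b < 2 ^ q -> spread a = spread b -> a = b.
Proof.
move=> Ha Hb E; apply: bitn_ext => i; case: (ltnP i q) => iq.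
  by rewrite -(bitn_spreadM a iq) -(bitn_spreadM b iq) E.
by rewrite (bitn_small Ha iq) (bitn_small Hb iq).
Qed.

Lemma spread_flipn i a : i < q -> spread (flipn i a) = flipn (i * K) (spread a).
Proof.
move=> iq; apply: bitn_ext => j; rewrite bitn_flipn !bitn_spread bitn_flipn.
case: (boolP (K %| j)) => [/dvdnP[k ->]|nd].
  rewrite mulnK // mulK_lt eqn_mul2r eqn0Ngt K0 /=.
  by case: (ltnP k q) => //= qk; case: eqP => //; lia.
rewrite andbF /=; case: eqP => // E; move: nd; rewrite -E dvdn_mull //.
Qed.

End Spread.

(** * Unitarity of circuits *)

Local Open Scope ring_scope.

Definition adjmx m n (U : 'M[algC]_(m, n)) : 'M[algC]_(n, m) := map_mx (fun z => z^*) U^T.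

Lemma adjmxM m n p (U : 'M[algC]_(m, n)) (V : 'M_(n, p)) :
  adjmx (U *m V) = adjmx V *m adjmx U.
Proof. by rewrite /adjmx trmx_mul map_mxM. Qed.

Definition unitary n (U : 'M[algC]_n) := adjmx U *m U = 1%:M.

Lemma unitary1 n : unitary (1%:M : 'M_n).
Proof. by rewrite /unitary /adjmx trmx1 map_mx1 mulmx1. Qed.

Lemma unitaryM n (U V : 'M_n) : unitary U -> unitary V -> unitary (U *m V).
Proof.
by rewrite /unitary => HU HV; rewrite adjmxM -mulmxA [adjmx U *m _]mulmxA HU mul1mx.
Qed.

Lemma unitaryP n (U : 'M_n) :
  (forall a b, \sum_c (U c a)^* * U c b = (a == b)%:R) -> unitary U.
Proof.
move=> H; apply/matrixP => a b; rewrite !mxE -H.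
by apply: eq_bigr => c _; rewrite !mxE.
Qed.

Definition norm2 n (v : 'cV[algC]_n) : algC := \sum_a `|v a 0| ^+ 2.

Lemma norm2E n (v : 'cV_n) : norm2 v = (adjmx v *m v) 0 0.
Proof. by rewrite !mxE; apply: eq_bigr => a _; rewrite !mxE normCK mulrC. Qed.

Lemma norm2_unitary n (U : 'M_n) v : unitary U -> norm2 (U *m v) = norm2 v.
Proof. by move=> HU; rewrite !norm2E adjmxM -mulmxA [adjmx U *m _]mulmxA HU mul1mx. Qed.

Lemma sqrt2_sqr : sqrt2 * sqrt2 = 2.
Proof. by rewrite -expr2 sqrtCK. Qed.

Lemma sqrt2_conj : sqrt2^* = sqrt2.
Proof. by apply: CrealP; apply: ger0_real; rewrite sqrtC_ge0 ler0n. Qed.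

Lemma sqrt2V_sqr : sqrt2^-1 * sqrt2^-1 = 2^-1.
Proof. by rewrite -invfM sqrt2_sqr. Qed.

Lemma sum_natr_eq n (f : 'I_n -> algC) (i : 'I_n) : \sum_c (c == i)%:R * f c = f i.
Proof.
rewrite (bigD1 i) //= eqxx mul1r big1 ?addr0 // => c /negbTE ->.
by rewrite mul0r.
Qed.

Definition flip_ord n i (Hi : (i < n)%N) (b : 'I_(2 ^ n)) : 'I_(2 ^ n) :=
  Ordinal (flipn_lt Hi (ltn_ord b)).

Lemma H_unitary n i : unitary (H_mat n i).
Proof.
rewrite /H_mat; case: ltnP => Hi; last exact: unitary1.
apply: unitaryP => a b.
pose fa := flip_ord Hi a.
have fan : fa != a by rewrite -val_eqE /= flipn_neq.
have ffa : flipn i fa = a by rewrite /= flipnK.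
have cs : (sqrt2^-1)^* = sqrt2^-1 by rewrite fmorphV /= sqrt2_conj.
have bfa : bitn fa i = ~~ bitn a i by rewrite bitn_flipn eqxx addbT.
(* Column [a] is supported on the rows [a] and [fa], which differ in bit i; against the column of
   [fa] the two products have opposite signs. *)
rewrite (bigD1 a) //= (bigD1 fa) //= big1 ?addr0; last first.
  move=> c /andP[]; rewrite -!val_eqE /= => /negbTE c1 /negbTE c2.
  by rewrite !mxE c1 c2 conjC0 mul0r.
rewrite !mxE !eqxx /= bfa orbT.
rewrite (_ : (flipn i a == b) = (a == flipn i b :> nat)); last first.
  by apply/eqP/eqP => [<-|->]; rewrite flipnK.
rewrite (_ : (flipn i a == flipn i b) = (a == b :> nat)); last first.
  by apply/eqP/eqP => [/(can_inj (flipnK i))|->].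
have [E|nE] := eqVneq (a : nat) b.
  rewrite (val_inj E) eqxx /= orbT.
  by case: (bitn b i) => /=; rewrite ?rmorphN /= !cs ?mulrNN sqrt2V_sqr; field.
rewrite (_ : (a == b) = false); last by apply: contraNF nE => /eqP ->.
have [E|nE'] := eqVneq (a : nat) (flipn i b); last by rewrite !mulr0 addr0.
have -> : bitn b i = ~~ bitn a i by rewrite E bitn_flipn eqxx addbT negbK.
by case: (bitn a i) => /=; rewrite ?rmorphN /= !cs; ring.
Qed.

Lemma T_unitary n i : unitary (T_mat n i).
Proof.
rewrite /T_mat; case: ltnP => Hi; last exact: unitary1.
apply: unitaryP => a b; rewrite (bigD1 a) //= big1 ?addr0; last first.
  by move=> c /negbTE ca; rewrite !mxE val_eqE ca conjC0 mul0r.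
have [<-|nab] := eqVneq a b; last first.
  rewrite !mxE (_ : (a == b :> nat) = false) ?mulr0 //.
  by apply: contraNF nab => /eqP /val_inj ->.
rewrite !mxE eqxx.
case: (bitn a i); last by rewrite rmorph1 mulr1.
rewrite rmorphM fmorphV rmorphD rmorph1 /= conjCi sqrt2_conj.
rewrite mulrACA sqrt2V_sqr.
have -> : (1 - 'i) * (1 + 'i) = 2 :> algC.
  by rewrite -subr_sqr expr1n sqrCi opprK.
by rewrite divff // pnatr_eq0.
Qed.

Lemma CNOT_unitary n c t : unitary (CNOT_mat n c t).
Proof.
rewrite /CNOT_mat; case: ifP => [/and3P[Hc Ht ct]|_]; last exact: unitary1.
pose p (b : 'I_(2 ^ n)) := if bitn b c then flip_ord Ht b else b.
have pE (b : 'I_(2 ^ n)) : (if bitn b c then flipn t b else b) = p b by rewrite /p; case: ifP.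
(* The gate permutes the basis by [p]. Control and target differ, so the control bit survives, and
   equal images underwent the same, invertible, change. *)
have bp b : bitn (p b) c = bitn b c.
  by rewrite /p; case: ifP => //= H; rewrite bitn_flipn eq_sym (negbTE ct) addbF.
have pI : injective p.
  move=> a b E; have := bp a; rewrite E bp => Ebit; move: E; rewrite /p Ebit.
  case: ifP => // _ /(congr1 val) /= /(can_inj (flipnK t)) E; exact: val_inj.
apply: unitaryP => a b; under eq_bigr => d _ do rewrite !mxE !pE !val_eqE conjC_nat.
by rewrite sum_natr_eq inj_eq // eq_sym.
Qed.

Lemma gate_unitary n g : unitary (gate_mat n g).
Proof.
by case: g => [i|i|c t|] /=;
  [exact: H_unitary|exact: T_unitary|exact: CNOT_unitary|exact: unitary1].
Qed.

Lemma circ_unitary n C : unitary (circ_mat n C).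
Proof.
rewrite /circ_mat; move: (@unitary1 (2 ^ n)); move: (1%:M).
by elim: C => //= g C IH U HU; apply: IH; apply: unitaryM HU; apply: gate_unitary.
Qed.

Lemma norm2_basis n k : (k < 2 ^ n)%N -> norm2 (basis n k) = 1.
Proof.
move=> Hk; rewrite /norm2 (bigD1 (Ordinal Hk)) //= big1 ?addr0 ?mxE ?eqxx.
  by rewrite normr1 expr1n.
by move=> a; rewrite -val_eqE /= => /negbTE E; rewrite mxE E normr0 expr0n.
Qed.

Lemma circ_prob_total n C k : (k < 2 ^ n)%N ->
  \sum_a `|(circ_mat n C *m basis n k) a 0| ^+ 2 = 1.
Proof.
by move=> Hk; rewrite -[LHS]/(norm2 _) norm2_unitary ?norm2_basis //; apply: circ_unitary.
Qed.

Definition zsign (a : nat) : algC := if bitn a 0 then -1 else 1.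

Lemma tr_rho_observable n C (x : bits) : (idx x < 2 ^ n)%N ->
  \tr (rho n x *m observable n C) =
  \sum_(a < 2 ^ n) zsign a * `|(circ_mat n C *m basis n (idx x)) a 0| ^+ 2.
Proof.
move=> Hk; set U := circ_mat n C; pose i := Ordinal Hk.
have -> : rho n x = basis n (idx x) *m adjmx (basis n (idx x)).
  apply/matrixP => a b; rewrite !mxE big_ord1 !mxE conjC_nat -natrM mulnb.
  by [].
rewrite -mulmxA mxtrace_mulC /mxtrace big_ord1.
have -> : adjmx (basis n (idx x)) *m observable n C *m basis n (idx x) =
  adjmx (U *m basis n (idx x)) *m (Z1 n *m (U *m basis n (idx x))).
  by rewrite adjmxM /observable -/U -[adjoint _]/(adjmx _) !mulmxA.
move: (U *m _) => v; rewrite mxE; apply: eq_bigr => a _.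
rewrite !mxE (bigD1 a) //= big1 ?addr0; last first.
  by move=> b /negbTE ba; rewrite mxE val_eqE eq_sym ba mul0r.
by rewrite mxE eqxx normCK /zsign; case: ifP => _; ring.
Qed.

(** * Embedding a circuit into more qubits *)

Definition shift_gate K g :=
  match g with
  | GH i => GH (i * K) | GT i => GT (i * K)
  | GCNOT c t => GCNOT (c * K) (t * K) | GId => GId end.

Section Embedding.
Variables (K q N : nat).
Hypothesis K0 : (0 < K)%N.
Hypothesis q0 : (0 < q)%N.
Hypothesis HqN : (q.-1 * K < N <= q * K)%N.

Definition spread_ord (b : 'I_(2 ^ q)) : 'I_(2 ^ N) := Ordinal (spread_lt K N b).
(** The isometry that moves qubit i to position i * K and puts 0 on all remaining positions. *)
Definition embed : 'M[algC]_(2 ^ N, 2 ^ q) := \matrix_(a, b) (a == spread_ord b)%:R.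

Lemma spread_ord_inj : injective spread_ord.
Proof.
move=> a b /(congr1 val) /= /(spread_inj K0 q0 HqN (ltn_ord a) (ltn_ord b)).
exact: val_inj.
Qed.

Lemma spread_eq (a b : nat) : (a < 2 ^ q)%N -> (b < 2 ^ q)%N ->
  (spread K N a == spread K N b) = (a == b).
Proof. by move=> Ha Hb; apply/eqP/eqP => [/(spread_inj K0 q0 HqN Ha Hb)|->]. Qed.

(** The two conditions say that [V] maps the span of the spread-out basis states into itself and
    acts there as [U]. *)
Lemma embed_intertwine (V : 'M_(2 ^ N)) (U : 'M_(2 ^ q)) :
  (forall c b, V (spread_ord c) (spread_ord b) = U c b) ->
  (forall a b, (forall c, a != spread_ord c) -> V a (spread_ord b) = 0) ->
  V *m embed = embed *m U.
Proof.
move=> H1 H2; apply/matrixP => a b; rewrite !mxE.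
under eq_bigr => c _ do rewrite mxE mulrC.
rewrite sum_natr_eq; under eq_bigr => c _ do rewrite mxE.
case: (pickP (fun c => a == spread_ord c)) => [c /eqP ->|Hn].
  under eq_bigr => d _ do rewrite (inj_eq spread_ord_inj) eq_sym.
  by rewrite sum_natr_eq H1.
rewrite H2; last by move=> c; rewrite Hn.
by rewrite big1 // => c _; rewrite Hn mul0r.
Qed.

Lemma embed_gate g : gate_mat N (shift_gate K g) *m embed = embed *m gate_mat q g.
Proof.
have lt i : (i * K < N)%N = (i < q)%N := mulK_lt K0 q0 HqN i.
have bit i (b : 'I_(2 ^ q)) : (i < q)%N -> bitn (spread K N b) (i * K) = bitn b i.
  by move=> iq; apply: bitn_spreadM HqN _ _ iq.
case: g => [i|i|c t|] /=; last by rewrite mul1mx mulmx1.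
- rewrite /H_mat lt; case: ifP => [iq|_]; last by rewrite mul1mx mulmx1.
  have fl (b : 'I_(2 ^ q)) : flipn (i * K) (spread K N b) = spread K N (flip_ord iq b).
    by rewrite /= (spread_flipn K0 q0 HqN).
  apply: embed_intertwine => [c b|a b Hn].
    by rewrite !mxE /= fl /= !spread_eq ?ltn_ord ?flipn_lt // !bit.
  rewrite mxE (_ : (a == spread_ord b :> nat) = false) ?fl; last first.
    by apply: contraNF (Hn b) => /eqP /val_inj ->.
  rewrite (_ : (a == spread K N (flip_ord iq b) :> nat) = false) //.
  by apply: contraNF (Hn (flip_ord iq b)) => /eqP E; apply/eqP; apply: val_inj.
- rewrite /T_mat lt; case: ifP => [iq|_]; last by rewrite mul1mx mulmx1.
  apply: embed_intertwine => [c b|a b Hn].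
    by rewrite !mxE /= spread_eq ?ltn_ord // bit.
  rewrite mxE (_ : (a == spread_ord b :> nat) = false) //.
  by apply: contraNF (Hn b) => /eqP /val_inj ->.
- rewrite /CNOT_mat !lt eqn_mul2r [K == 0]eqn0Ngt K0 /=.
  case: ifP => [/and3P[cq tq ct]|_]; last by rewrite mul1mx mulmx1.
  have fl (b : 'I_(2 ^ q)) : (if bitn (spread_ord b) (c * K) then flipn (t * K) (spread_ord b)
      else spread_ord b) = spread_ord (if bitn b c then flip_ord tq b else b) :> nat.
    by rewrite bit //; case: ifP => //= _; rewrite (spread_flipn K0 q0 HqN).
  have fl' (b : 'I_(2 ^ q)) : (if bitn b c then flipn t b else b) =
      (if bitn b c then flip_ord tq b else b) :> nat by case: ifP.
  apply: embed_intertwine => [d b|a b Hn].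
    by rewrite !mxE fl fl' spread_eq ?ltn_ord.
  rewrite mxE fl (_ : (_ == _ :> nat) = false) //.
  by apply: contraNF (Hn (if bitn b c then flip_ord tq b else b)) => /eqP /val_inj ->.
Qed.

Lemma embed_circ C : circ_mat N (map (shift_gate K) C) *m embed = embed *m circ_mat q C.
Proof.
rewrite /circ_mat; have : 1%:M *m embed = embed *m 1%:M by rewrite mul1mx mulmx1.
move: (1%:M : 'M_(2 ^ N)) (1%:M : 'M_(2 ^ q)).
elim: C => //= g C IH V U E; apply: IH.
by rewrite -mulmxA E !mulmxA embed_gate.
Qed.

Lemma embed_basis k : (k < 2 ^ q)%N -> embed *m basis q k = basis N (spread K N k).
Proof.
move=> Hk; apply/matrixP => a b; rewrite !mxE.
under eq_bigr => c _ do rewrite !mxE mulrC -[c == k :> nat]/(c == Ordinal Hk).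
by rewrite sum_natr_eq -val_eqE.
Qed.

Definition spread_bits (x : bits) : bits :=
  mkseq (fun j => (K %| j)%N && nth false x (j %/ K)) N.

Lemma idx_spread_bits x : idx (spread_bits x) = spread K N (idx x).
Proof. by congr idx; apply: eq_mkseq => j; rewrite bitn_idx. Qed.

Lemma accept_shifted C (x : bits) : (size x <= q)%N ->
  \tr (rho N (spread_bits x) *m observable N (map (shift_gate K) C)) =
  1 - 2 * accept_prob q C x.
Proof.
move=> Hx; have Hi : (idx x < 2 ^ q)%N.
  by apply: leq_trans (idx_lt x) _; rewrite leq_exp2l.
rewrite tr_rho_observable ?idx_spread_bits ?spread_lt //.
rewrite -embed_basis // mulmxA embed_circ -mulmxA.
set psi := circ_mat q C *m _.
have amp a : (embed *m psi) a 0 = \sum_c (a == spread_ord c)%:R * psi c 0.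
  by rewrite mxE; apply: eq_bigr => c _; rewrite mxE.
have amp2 (a : 'I_(2 ^ N)) : zsign a * `|(embed *m psi) a 0| ^+ 2 =
    \sum_(c < 2 ^ q) (a == spread_ord c)%:R * (zsign c * `|psi c 0| ^+ 2).
  rewrite amp; case: (pickP (fun c => a == spread_ord c)) => [d /eqP ->|Hn].
    under eq_bigr => c _ do rewrite (inj_eq spread_ord_inj) eq_sym.
    rewrite sum_natr_eq.
    under eq_bigr => c _ do rewrite (inj_eq spread_ord_inj) eq_sym.
    rewrite sum_natr_eq; congr (_ * _).
    (* Scaling fixes position 0, so the measured qubit is the same before and after the
       embedding. *)
    have : bitn (spread K N d) (0 * K) = bitn d 0 by apply: bitn_spreadM HqN _ _ q0.
    by rewrite /zsign mul0n /= => ->.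
  rewrite big1 ?big1 ?normr0 ?expr0n ?mulr0 // => c _; by rewrite Hn mul0r.
under eq_bigr => a _ do rewrite amp2.
rewrite exchange_big /=.
under eq_bigr => c _ do rewrite -mulr_suml.
under eq_bigr => c _.
  rewrite (bigD1 (spread_ord c)) //= eqxx big1 ?addr0 ?mul1r; last first.
    by move=> a /negbTE ->.
  over.
(* The outcome probabilities add up to 1, so the signed sum is 1 minus twice the weight of the
   outcomes with first bit 1. *)
rewrite -{1}(circ_prob_total C Hi) -/psi /accept_prob -/psi [X in 2 * X]big_mkcond mulr_sumr -sumrB.
by apply: eq_bigr => c _; rewrite /zsign; case: ifP => _; ring.
Qed.

End Embedding.

(** * Advice strings *)

Fixpoint pad_fields (k : nat) (c : bool * bool) (fs : seq (seq sym)) : seq (seq sym) :=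
  if fs is f :: fs' then
    (f ++ (if c.1 || c.2 then nseq k S0 else [::])) :: pad_fields k (next_field c) fs'
  else [::].

Lemma split_sep_cons s : exists f fs, split_sep s = f :: fs.
Proof.
elim: s => [|a s [f [fs E]]] /=; first by exists [::], [::].
by case: a; rewrite ?E; do 2 eexists.
Qed.

Lemma split_shift_fields k c s : split_sep (shift_fields k c s) = pad_fields k c (split_sep s).
Proof.
have S0s w (r : seq sym) (b : bool) : split_sep r = [::] :: w ->
    split_sep ((if b then nseq k S0 else [::]) ++ r) = (if b then nseq k S0 else [::]) :: w.
  by case: b => //; elim: k {c} => //= k IH E; rewrite IH.
elim: s c => [|a s IH] c.
  by have := S0s [::] [::] (c.1 || c.2) erefl; rewrite cats0.
have [f [fs E]] := split_sep_cons s.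
have := IH c; have := IH (next_field c); rewrite E /= => E1 E2.
case: a => /=; rewrite ?E2 ?E //=.
by rewrite (S0s (pad_fields k (next_field c) (f :: fs))) //= E1.
Qed.

Lemma nat_of_field_pad f k : nat_of_field (f ++ nseq k S0) = (nat_of_field f * 2 ^ k)%N.
Proof.
rewrite /nat_of_field foldl_cat; move: (foldl _ _ f) => v.
elim: k v => [|k IH] v; first by rewrite expn0 muln1.
by rewrite /= IH addn0 expnS mulnA.
Qed.

Lemma gate_of_shift K t i j : gate_of t (i * K) (j * K) = shift_gate K (gate_of t i j).
Proof. by case: t => [|[|[|t]]]. Qed.

Lemma circuit_of_shift k s :
  circuit_of (shift_fields k (false, false) s) = map (shift_gate (2 ^ k)) (circuit_of s).
Proof.
rewrite /circuit_of split_shift_fields.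
(* Gates take three fields at a time, hence an induction on a bound for the number of fields. After
   three of them the position is again (false, false). *)
have [n Hn] : exists n, (size (split_sep s) <= n)%N by exists (size (split_sep s)).
elim: n (split_sep s) Hn => [|n IH]; first by case.
case=> [|f1 [|f2 [|f3 fs]]] //= Hn.
rewrite cats0 !nat_of_field_pad gate_of_shift IH //; lia.
Qed.

(** * Programs for the voting machine *)

Definition token_bits (t : bool * bool * bool) : bits := [:: t.1.1; t.1.2; t.2].

Lemma tokens_enc ts : tokens (enc_bits (flatten (map token_bits ts))) = ts.
Proof. by elim: ts => [|[[a b] c] ts IH] //=; rewrite IH; case: a b c => [] [] []. Qed.

Definition sym_token (a : sym) : bool * bool * bool :=
  match a with S0 => (false, false, false) | S1 => (false, true, false)
  | _ => (true, false, false) end.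

Definition slot_token (s : bool) : bool * bool * bool :=
  if s then (true, true, false) else (false, false, false).

Fixpoint fill (sl x : bits) : bits :=
  match sl with
  | true :: sl' => head false x :: fill sl' (behead x)
  | false :: sl' => false :: fill sl' x
  | [::] => [::] end.

Section Votes.
Variables (A : TM) (cA : nat).
Local Notation bstep := (bstep A cA).

Lemma bstep_syms w X X' buf V : nonblank w ->
  foldl bstep (BState X X' buf V) (map sym_token (rev w)) = BState X X' (w ++ buf) V.
Proof.
elim: w => //= a w IH /andP[an wn].
by rewrite rev_cons map_rcons -cats1 foldl_cat IH //=; case: a an.
Qed.

Lemma bstep_slots sl x X X' buf V : count id sl = size x ->
  foldl bstep (BState (rev x ++ X) X' buf V) (map slot_token (rev sl)) =
  BState X (x ++ X') (enc_bits (fill sl x) ++ buf) V.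
Proof.
elim: sl x X => [|s sl IH] x X /= Hc; first by move/esym/size0nil: Hc => ->.
rewrite rev_cons map_rcons -cats1 foldl_cat; case: s Hc => /= Hc.
  case: x Hc => // b x /= [Hc].
  by rewrite rev_cons cat_rcons IH.
by rewrite IH.
Qed.

(** The buffer is filled from its end: first the fixed tail [w] backwards, then the spread-out input
    backwards, of which the advice knows only the places of the bits of x. *)
Definition run_tokens (sl : bits) (w : seq sym) : seq (bool * bool * bool) :=
  map sym_token (rev w) ++ map slot_token (rev sl) ++ [:: (true, true, true)].

Lemma bstep_run sl x w V : nonblank w -> count id sl = size x ->
  foldl bstep (BState (rev x) [::] [::] V) (run_tokens sl w) =
  BState (rev x) [::] [::] (cast (out_vote A cA (enc_bits (fill sl x) ++ w)) V).
Proof.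
move=> wn Hc; rewrite /run_tokens !foldl_cat bstep_syms // cats0.
by rewrite -[rev x]cats0 bstep_slots //= !cats0 catrevE cats0.
Qed.

Lemma bstep_runs sl x ws V : all nonblank ws -> count id sl = size x ->
  foldl bstep (BState (rev x) [::] [::] V) (flatten [seq run_tokens sl w | w <- ws]) =
  BState (rev x) [::] [::]
    (foldl (fun V w => cast (out_vote A cA (enc_bits (fill sl x) ++ w)) V) V ws).
Proof.
move=> + Hc; elim: ws V => //= w ws IH V /andP[wn wsn].
by rewrite foldl_cat bstep_run // IH.
Qed.

End Votes.

Lemma foldl_cast (T : Type) (g : T -> bool) (ws : seq T) :
  (size ws < 2 * count g ws)%N -> ohead (foldl (fun V w => cast (g w) V) [::] ws) = Some true.
Proof.
(* Subtraction is truncated, so at most one of the two blocks is nonempty: the stack is the lead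
   written in unary. *)
move=> H; suff -> : foldl (fun V w => cast (g w) V) [::] ws =
    nseq (count g ws - count (predC g) ws) true ++ nseq (count (predC g) ws - count g ws) false.
  have := count_predC g ws.
  by case E : (count g ws - count (predC g) ws)%N => [|d] //=; lia.
elim/last_ind: ws {H} => [|ws w IH] //; rewrite foldl_rcons IH -cats1 !count_cat /= !addn0.
move: (count g ws) (count (predC g) ws) => t f; case: (g w) => /=.
  rewrite addn1 addn0; case: (ltngtP t f) => H.
  - have -> : (t - f = 0)%N by lia.
    have -> : (t.+1 - f = 0)%N by lia.
    by have -> : (f - t = (f - t.+1).+1)%N by lia.
  - have -> : (f - t = 0)%N by lia.
    have -> : (f - t.+1 = 0)%N by lia.
    have -> : (t.+1 - f = (t - f).+1)%N by lia.
    by have -> : (t - f = (t - f).-1.+1)%N by lia.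
  - by subst; rewrite subnn subSnn (_ : (f - f.+1 = 0)%N) //; lia.
rewrite addn1 addn0; case: (ltngtP t f) => H.
- have -> : (t - f = 0)%N by lia.
  have -> : (t - f.+1 = 0)%N by lia.
  have -> : (f.+1 - t = (f - t).+1)%N by lia.
  by have -> : (f - t = (f - t).-1.+1)%N by lia.
- have -> : (f - t = 0)%N by lia.
  have -> : (f.+1 - t = 0)%N by lia.
  by have -> : (t - f = (t - f.+1).+1)%N by lia.
- by subst; rewrite subnn subSnn (_ : (f - f.+1 = 0)%N) //; lia.
Qed.

Lemma foldl_cast_false (T : Type) (g : T -> bool) (ws : seq T) :
  (size ws < 2 * count (predC g) ws)%N ->
  ohead (foldl (fun V w => cast (g w) V) [::] ws) = Some false.
Proof.
move=> H; suff -> : foldl (fun V w => cast (g w) V) [::] ws =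
    map negb (foldl (fun V w => cast (~~ g w) V) [::] ws).
  by have := foldl_cast H; case: (foldl _ _ _) => //= ? ? [->].
suff W : forall V, foldl (fun V w => cast (g w) V) (map negb V) ws =
    map negb (foldl (fun V w => cast (~~ g w) V) V ws) by exact: (W [::]).
elim: ws {H} => //= w ws IH V; rewrite -IH; congr foldl.
by case: V => [|u V] /=; case: (g w) => //; case: u.
Qed.

(** * Places of the input bits among N positions *)

Definition slots (K n s m : nat) : bits :=
  [seq (K %| j)%N && (j %/ K < n)%N | j <- iota s m].

(** The quotient s / K rounded up: the multiples of K smaller than s correspond to the input bits
    already placed before position s. *)
Definition multiples_below (K s : nat) : nat := ((s + K.-1) %/ K)%N.

Section Slots.
Variables (K : nat).
Hypothesis K0 : (0 < K)%N.
Local Notation cf := (multiples_below K).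

Lemma cf_dvd j : (K %| j)%N -> cf j = (j %/ K)%N.
Proof.
move=> /dvdnP[a ->]; rewrite /multiples_below mulnK // divnMDl // divn_small ?addn0 //.
by rewrite prednK.
Qed.

Lemma cfS_dvd j : (K %| j)%N -> cf j.+1 = (j %/ K).+1.
Proof.
move=> /dvdnP[a ->]; rewrite /multiples_below mulnK // addSnnS prednK // divnMDl // divnn K0.
by rewrite addn1.
Qed.

Lemma cfS_ndvd j : ~~ (K %| j)%N -> cf j.+1 = cf j.
Proof.
move=> nd; rewrite /multiples_below addSnnS prednK // divnDr // divnn K0 addn1.
have Hm : (0 < j %% K)%N by rewrite lt0n.
have Hl := ltn_pmod j K0.
rewrite {2}(divn_eq j K) -addnA divnMDl //.
have aux r k : (0 < r -> 0 < k -> r + k.-1 = 1 * k + r.-1)%N by case: r k => [|r] [|k] //=; lia.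
rewrite aux // divnMDl // (@divn_small (j %% K).-1) ?addn0 ?addn1 //.
exact: leq_ltn_trans (leq_pred _) Hl.
Qed.

Lemma fill_slots x s m :
  fill (slots K (size x) s m) (drop (cf s) x) =
  [seq (K %| j)%N && nth false x (j %/ K) | j <- iota s m].
Proof.
elim: m s => //= m IH s; have [d|nd] := boolP (K %| s)%N; last first.
  by rewrite /= -(cfS_ndvd nd) IH.
have [lt|ge] := ltnP (s %/ K) (size x) => /=.
  rewrite cf_dvd // (drop_nth false lt) /=; congr (_ :: _).
  by rewrite -IH cfS_dvd.
rewrite nth_default //; congr (_ :: _); rewrite -IH cfS_dvd // cf_dvd //.
by rewrite !drop_oversize // leqW.
Qed.

Lemma count_slots n s m : (n <= cf (s + m))%N -> count id (slots K n s m) = (n - cf s)%N.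
Proof.
elim: m s => [|m IH] s /=; first by rewrite addn0; lia.
rewrite -addSnnS => H; rewrite -/(slots K n s.+1 m) IH //.
have [d|nd] := boolP (K %| s)%N; last by rewrite cfS_ndvd.
by rewrite cfS_dvd // cf_dvd //=; case: ltnP; lia.
Qed.

End Slots.

Lemma slots_spread_bits K q N (x : bits) : (0 < K)%N -> (size x <= q)%N ->
  (q.-1 * K < N)%N ->
  count id (slots K (size x) 0 N) = size x /\ fill (slots K (size x) 0 N) x = spread_bits K N x.
Proof.
move=> K0 Hx HN.
have c0 : multiples_below K 0 = 0%N by rewrite /multiples_below divn_small // add0n prednK.
split.
  have Hc : (size x <= multiples_below K (0 + N))%N.
    apply: leq_trans Hx _; rewrite /multiples_below leq_divRL //.
    by move: HN; case: (q) => [|q'] //=; rewrite mulSn; lia.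
  by have := count_slots K0 Hc; rewrite c0 subn0.
by have := fill_slots K0 x 0 N; rewrite c0 drop0.
Qed.

(** * Derandomization *)

Section Averaging.

(** If all values exceeded c, the nonnegative terms p a * (X a - c) would have a sum at most 0, so
    all p a would vanish, against their sum being 1. The order of [algC] is partial, whence the
    reality assumptions. *)
Lemma average_le (T : finType) (p X : T -> algC) (c : algC) :
  (forall a, 0 <= p a) -> \sum_a p a = 1 -> (forall a, X a \is Num.real) ->
  c \is Num.real -> \sum_a p a * X a <= c -> exists a, X a <= c.
Proof.
move=> p0 p1 Xr cr H.
have [/existsP//|] := boolP [exists a, X a <= c].
rewrite negb_exists => /forallP Hn; exfalso.
have Hgt a : 0 < X a - c by rewrite subr_gt0 real_ltNge ?Hn.
have S0 : \sum_a p a * (X a - c) <= 0.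
  under eq_bigr => a _ do rewrite mulrBr.
  by rewrite sumrB -mulr_suml p1 mul1r subr_le0.
have T0 a : 0 <= p a * (X a - c) by rewrite mulr_ge0 // ltW.
have E0 : \sum_a p a * (X a - c) = 0 by apply/eqP; rewrite eq_le S0 sumr_ge0.
have pa0 a : p a = 0.
  have E1 : p a * (X a - c) = 0 by apply: (psumr_eq0P (fun a _ => T0 a) E0).
  move/eqP: E1; by rewrite mulf_eq0 (gt_eqF (Hgt a)) orbF => /eqP.
have : 1 = 0 :> algC by rewrite -p1 big1.
by move/eqP; rewrite oner_eq0.
Qed.

Variables (m M rl : nat) (W : seq bits -> circuit).

Definition sample_mean (F : seq bits -> bits -> algC) : algC :=
  adv_exp m W M [::] (fun om => \sum_(r < 2 ^ rl) F om (bits_of rl r) / 2 ^+ rl).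

Lemma meas_prob_ge0 C (a : 'I_(2 ^ m)) : 0 <= meas_prob C a.
Proof. by rewrite /meas_prob exprn_ge0. Qed.

Lemma meas_prob_sum C : \sum_(a < 2 ^ m) meas_prob C a = 1.
Proof. by apply: circ_prob_total; rewrite expn_gt0. Qed.

Lemma adv_exp_lin k hist (I : finType) (w : I -> algC) (G : I -> seq bits -> algC) :
  adv_exp m W k hist (fun om => \sum_i w i * G i om) = \sum_i w i * adv_exp m W k hist (G i).
Proof.
elim: k hist => //= k IH hist; under eq_bigr => a _ do rewrite IH mulr_sumr.
rewrite exchange_big; apply: eq_bigr => i _; rewrite mulr_sumr.
by apply: eq_bigr => a _; rewrite mulrCA.
Qed.

Lemma adv_exp_affine k hist a b (G : seq bits -> algC) :
  adv_exp m W k hist (fun om => a + b * G om) = a + b * adv_exp m W k hist G.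
Proof.
elim: k hist => //= k IH hist; under eq_bigr => c _ do rewrite IH mulrDr.
rewrite big_split /= -mulr_suml meas_prob_sum mul1r; congr (_ + _); rewrite mulr_sumr.
by apply: eq_bigr => c _; rewrite mulrCA.
Qed.

Lemma eq_adv_exp k hist (G G' : seq bits -> algC) :
  G =1 G' -> adv_exp m W k hist G = adv_exp m W k hist G'.
Proof. by move=> E; elim: k hist => //= k IH hist; apply: eq_bigr => a _; rewrite IH. Qed.

Lemma adv_exp_real k hist (G : seq bits -> algC) :
  (forall om, G om \is Num.real) -> adv_exp m W k hist G \is Num.real.
Proof.
move=> Gr; elim: k hist => //= k IH hist; apply: rpred_sum => a _.
by rewrite rpredM // ger0_real // meas_prob_ge0.
Qed.

(** Outcomes are fixed one measurement at a time, each by averaging given the earlier ones;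
    adaptivity is therefore harmless. *)
Lemma adv_exp_le k hist (G : seq bits -> algC) c :
  (forall om, G om \is Num.real) -> c \is Num.real -> adv_exp m W k hist G <= c ->
  exists l, [/\ size l = k, all (fun o => size o == m) l & G (hist ++ l) <= c].
Proof.
move=> Gr cr; elim: k hist => [|k IH] hist /= H; first by exists [::]; rewrite cats0.
have [|a Ha] := average_le (meas_prob_ge0 (W hist)) (meas_prob_sum _) _ cr H.
  by move=> a; exact: adv_exp_real.
have [l [Hs Hl Hc]] := IH _ Ha.
exists (bits_of m a :: l); split; rewrite /= ?Hs ?Hl ?size_mkseq ?eqxx //.
by rewrite -cat_rcons.
Qed.

Definition valid_sample (s : seq bits * bits) : bool :=
  [&& size s.1 == M, all (fun o => size o == m) s.1 & size s.2 == rl].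

Lemma two_expn_gt0 k : 0 < 2 ^+ k :> algC. Proof. by rewrite exprn_gt0 ?ltr0n. Qed.

Lemma uniform_sum : \sum_(r < 2 ^ rl) (2 ^+ rl)^-1 = 1 :> algC.
Proof.
rewrite sumr_const card_ord -(mulr_natl _ (2 ^ rl)) natrX divff //.
by rewrite (gt_eqF (two_expn_gt0 _)).
Qed.

Lemma sample_mean_le F c : (forall om r, F om r \is Num.real) -> c \is Num.real ->
  sample_mean F <= c -> exists2 s, valid_sample s & F s.1 s.2 <= c.
Proof.
move=> Fr cr H; have [|l [Hs Hl Hc]] := adv_exp_le _ cr H.
  move=> om; apply: rpred_sum => r _; rewrite rpredM // rpredV rpredX //.
  by apply: ger0_real; rewrite ler0n.
have [|||r Hr] := @average_le _ (fun _ : 'I_(2 ^ rl) => (2 ^+ rl)^-1)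
  (fun r : 'I_(2 ^ rl) => F l (bits_of rl r)) c _ uniform_sum _ cr.
- by move=> _; rewrite invr_ge0 ltW // two_expn_gt0.
- by move=> a; apply: Fr.
- by under eq_bigr => a _ do rewrite mulrC.
by exists (l, bits_of rl r); rewrite /valid_sample /= ?Hs ?Hl ?size_mkseq ?eqxx.
Qed.

Lemma sample_mean_lin (I : finType) (w : I -> algC) F :
  sample_mean (fun om r => \sum_i w i * F i om r) = \sum_i w i * sample_mean (F i).
Proof.
rewrite /sample_mean -adv_exp_lin; apply: eq_adv_exp => om.
under eq_bigr => r _ do rewrite mulr_suml.
rewrite exchange_big; apply: eq_bigr => i _; rewrite mulr_sumr.
by apply: eq_bigr => r _; rewrite mulrA.
Qed.

Lemma sample_mean_affine a b F :
  sample_mean (fun om r => a + b * F om r) = a + b * sample_mean F.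
Proof.
rewrite /sample_mean -adv_exp_affine; apply: eq_adv_exp => om.
under eq_bigr => r _ do rewrite mulrDl -mulrA.
by rewrite big_split /= -!mulr_sumr uniform_sum mulr1.
Qed.

Section Derandomize.
Variables (n : nat) (good : n.-tuple bool -> seq bits -> bits -> bool).
Hypothesis good_mean : forall x, 2%:R / 3%:R <= sample_mean (fun om r => (good x om r)%:R).

(** The values 2/3 and 3/2 as an affine function of the indicator, so that the mean weight is an
    affine function of the success probability. *)
Let weight (b : bool) : algC := 3%:R / 2%:R - 5%:R / 6%:R * b%:R.
Let potential (l : seq (seq bits * bits)) x : algC := \prod_(s <- l) weight (good x s.1 s.2).

Lemma weightE b : weight b = if b then 2%:R / 3%:R else 3%:R / 2%:R.
Proof. by rewrite /weight; case: b; rewrite ?mulr1 ?mulr0 ?subr0 //; field. Qed.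

Lemma weight_ge0 b : 0 <= weight b.
Proof. by rewrite weightE; case: b; rewrite divr_ge0 ?ler0n. Qed.

Lemma potential_ge0 l x : 0 <= potential l x.
Proof. by apply: prodr_ge0 => s _; apply: weight_ge0. Qed.

(** The method of conditional expectations. The total starts at 2^n, one for each input; by
    linearity its mean after one more sample shrinks by 17/18, and some single sample does at least
    as well as the mean. *)
Lemma potential_decreases k : exists2 l, size l = k &
  all valid_sample l /\ \sum_x potential l x <= (17%:R / 18%:R) ^+ k * 2 ^+ n.
Proof.
elim: k => [|k [l Hl [Hv Hp]]].
  exists [::] => //; split=> //; under eq_bigr => x _ do rewrite /potential big_nil.
  by rewrite sumr_const card_tuple card_bool expr0 mul1r natrX.
have real_pot x : potential l x \is Num.real by apply: ger0_real; apply: potential_ge0.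
have [|||s vs Hs] := @sample_mean_le
  (fun om r => \sum_x potential l x * weight (good x om r))
  (17%:R / 18%:R * \sum_x potential l x).
- move=> om r; apply: rpred_sum => x _; rewrite rpredM // ger0_real //; exact: weight_ge0.
- by rewrite rpredM // ?rpred_sum // rpred_div // ?realn.
- rewrite sample_mean_lin mulr_sumr; apply: ler_sum => x _; rewrite mulrC.
  apply: ler_wpM2r; first exact: potential_ge0.
  rewrite (_ : sample_mean _ = sample_mean (fun om r => 3%:R / 2%:R + - (5%:R / 6%:R) * (good x om r)%:R)).
    rewrite sample_mean_affine.
    apply: (@le_trans _ _ (3%:R / 2%:R + - (5%:R / 6%:R) * (2%:R / 3%:R))); last first.
      by rewrite le_eqVlt; apply/orP; left; apply/eqP; field.
    rewrite lerD2l !mulNr lerN2; apply: ler_wpM2l (good_mean x).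
    by rewrite divr_ge0 ?ler0n.
  apply: eq_adv_exp => om; apply: eq_bigr => r _; congr (_ / _).
  by rewrite /weight mulNr.
exists (s :: l); first by rewrite /= Hl.
split; first by rewrite /= vs.
apply: le_trans (_ : 17%:R / 18%:R * \sum_x potential l x <= _).
  apply: le_trans Hs; rewrite le_eqVlt; apply/orP; left; apply/eqP.
  by apply: eq_bigr => x _; rewrite /potential big_cons mulrC.
rewrite exprS -(mulrA (17%:R / 18%:R)); apply: ler_wpM2l Hp; by rewrite divr_ge0 ?ler0n.
Qed.

Lemma bernoulli_le (x : algC) k : 0 <= x -> 1 + k%:R * x <= (1 + x) ^+ k.
Proof.
move=> x0; elim: k => [|k IH]; first by rewrite mul0r addr0 expr0.
rewrite exprS; apply: le_trans (ler_wpM2l _ IH); last by rewrite addr_ge0 ?ler01.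
rewrite -natr1 mulrDl mul1r mulrDl mul1r mulrDr mulr1 addrA lerD2l.
by rewrite lerDl mulrCA mulr_ge0 ?ler0n // mulr_ge0.
Qed.

Lemma derandomize : exists2 l, size l = (17 * n.+1)%N &
  all valid_sample l /\
  forall x, (size l < 2 * count (fun s => good x s.1 s.2) l)%N.
Proof.
have [l Hl [Hv Hp]] := potential_decreases (17 * n.+1).
exists l => //; split=> // x.
(* The inverse ratio is 1 + 1/17, whose 17th power is at least 2 by Bernoulli's inequality. So 17
   samples halve the total, and n + 1 such rounds bring 2^n down to 1/2. *)
have half : (17%:R / 18%:R) ^+ 17 <= 2%:R^-1 :> algC.
  rewrite -[17%:R / 18%:R]invf_div exprVn lef_pV2 ?posrE ?ltr0n ?exprn_gt0 ?divr_gt0 ?ltr0n //.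
  have -> : 18%:R / 17%:R = 1 + 17%:R^-1 :> algC by field.
  apply: le_trans (bernoulli_le 17 _); last by rewrite invr_ge0 ler0n.
  by rewrite divff ?pnatr_eq0.
have lt1 : potential l x < 1.
  apply: le_lt_trans (_ : \sum_x potential l x < 1).
    rewrite (bigD1 x) //= lerDl sumr_ge0 // => y _; exact: potential_ge0.
  apply: le_lt_trans Hp _; rewrite exprM.
  apply: le_lt_trans (_ : 2%:R^-1 ^+ n.+1 * 2 ^+ n < 1).
    apply: ler_wpM2r; first by rewrite ltW // two_expn_gt0.
    by rewrite lerXn2r // ?nnegrE ?invr_ge0 ?ler0n // exprn_ge0 // divr_ge0 ?ler0n.
  rewrite exprS -mulrA -exprMn mulVf ?pnatr_eq0 // expr1n mulr1.
  by rewrite invf_lt1 ?ltr0n // ltr1n.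
have Hpot : potential l x =
  (2%:R / 3%:R) ^+ count (fun s => good x s.1 s.2) l *
  (3%:R / 2%:R) ^+ count (predC (fun s => good x s.1 s.2)) l.
  rewrite /potential; elim: (l) => [|s l' IH]; first by rewrite big_nil !expr0 mulr1.
  rewrite big_cons IH /=; case: (good x s.1 s.2) => /=; rewrite add0n add1n exprS.
    by rewrite weightE mulrA.
  by rewrite weightE mulrCA.
have := count_predC (fun s => good x s.1 s.2) l; move: lt1; rewrite Hpot.
set g := count _ l; set b := count (predC _) l => lt1 E.
rewrite -E ltnNge; apply/negP => Hgb.
have {}Hgb : (g <= b)%N by move: Hgb; rewrite mul2n -addnn leq_add2l.
move: lt1; apply/negP; rewrite -real_leNgt ?realE ?ler01 //.
  (* Each right vote cancels against a wrong one, and the wrong votes left over contribute a power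
     of 3/2, which is at least 1. *)
  rewrite -(subnKC Hgb) exprD mulrA -exprMn.
  have -> : 2%:R / 3%:R * (3%:R / 2%:R) = 1 :> algC by field.
  rewrite expr1n mul1r exprn_ege1 // ler_pdivlMr ?ltr0n // mul1r ler_nat //.
by apply/orP; left; rewrite mulr_ge0 // exprn_ge0 // divr_ge0 ?ler0n.
Qed.

End Derandomize.
End Averaging.

(** * From shadow models to advice *)

Lemma adv_exp_mono m W k hist (G G' : seq bits -> algC) :
  (forall om, G om <= G' om) -> adv_exp m W k hist G <= adv_exp m W k hist G'.
Proof.
move=> H; elim: k hist => //= k IH hist; apply: ler_sum => a _.
by rewrite ler_wpM2l // meas_prob_ge0.
Qed.

Lemma encode_cons (x : bits) om (r : bits) :
  encode (x :: om ++ [:: r]) = enc_bits x ++ Sep :: encode (om ++ [:: r]).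
Proof. by case: om. Qed.

Lemma encode_nonblank xs : nonblank (encode xs).
Proof.
elim: xs => //= x [_|y xs IH]; rewrite ?nonblank_cat /= ?enc_bits_nonblank //.
Qed.

Lemma size_encode xs : (size (encode xs) <= sumn (map (fun x => (size x).+1) xs))%N.
Proof.
elim: xs => //= x [_|y xs IH]; rewrite ?size_cat /= size_map; first by lia.
by move: IH => /=; lia.
Qed.

Lemma last_bit_field s : nonblank s ->
  odd (nat_of_field (nth [::] (split_sep s) 0)) = last_bit false s.
Proof.
move=> sn; rewrite /nat_of_field.
suff W a : odd (foldl (fun acc a => (acc * 2 + (if a is S1 then 1 else 0))%N) a
    (nth [::] (split_sep s) 0)) = last_bit (odd a) s by exact: W.
elim: s a sn => [|c s IH] a //= /andP[cn sn].
have [f [fs E]] := split_sep_cons s; rewrite E /= in IH.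
by case: c cn => //= _; rewrite E /= IH // oddD oddM andbF.
Qed.

(** The output is plus or minus some t >= 0. With the wrong sign its distance to 1 - 2 * p is |1 - 2
    * p| + t >= 1/3, also when t = 0; so the sign bit alone is a safe vote. *)
Lemma vote_of_close s (p : algC) : nonblank s -> 0 <= p ->
  `|(1 - 2 * p) - dyadic s| < 3%:R / 20%:R ->
  (2%:R / 3%:R <= p -> last_bit false s) /\ (p <= 1 / 3%:R -> ~~ last_bit false s).
Proof.
move=> sn p0; rewrite /dyadic last_bit_field //.
rewrite -mulrA; set t := (nat_of_field _)%:R / _.
have t0 : 0 <= t by rewrite divr_ge0 ?ler0n ?exprn_ge0.
have small : 3%:R / 20%:R <= 3%:R^-1 :> algC.
  by rewrite -subr_ge0 (_ : _ - _ = 11%:R / 60%:R) ?divr_ge0 ?ler0n //; field.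
case: (last_bit false s) => /= H; split=> // Hp; exfalso.
- have : 3%:R^-1 <= `|(1 - 2 * p) - (-1) ^+ 1 * t|.
    rewrite expr1 mulN1r opprK ger0_norm; last first.
      rewrite addr_ge0 // subr_ge0; apply: le_trans (ler_wpM2l (ler0n _ 2) Hp) _.
      by rewrite mulrA mulr1 ler_pdivrMr ?ltr0n // mul1r ler_nat.
    apply: le_trans (_ : 1 - 2 * (1 / 3%:R) <= _).
      by rewrite le_eqVlt; apply/orP; left; apply/eqP; field.
    by rewrite -[X in X <= _]addr0 lerD // lerD2l lerN2 ler_wpM2l // ler0n.
  by move=> H3; have := le_lt_trans (le_trans small H3) H; rewrite ltxx.
- have : 3%:R^-1 <= `|(1 - 2 * p) - (-1) ^+ 0 * t|.
    rewrite expr0 mul1r -normrN !opprD !opprK.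
    have E : 3%:R^-1 <= - 1 + 2 * p + t.
      apply: le_trans (_ : - 1 + 2 * (2%:R / 3%:R) <= _).
        by rewrite le_eqVlt; apply/orP; left; apply/eqP; field.
      by rewrite -[X in X <= _]addr0 lerD // lerD2l ler_wpM2l // ler0n.
    by rewrite ger0_norm //; apply: le_trans E; rewrite invr_ge0 ler0n.
  by move=> H3; have := le_lt_trans (le_trans small H3) H; rewrite ltxx.
Qed.

Lemma tm_out_nonblank T c w : nonblank (tm_out T c w).
Proof.
rewrite /tm_out; case: ifP => // _; rewrite /output_of.
by elim: (_ :: _) => //= -[].
Qed.

Lemma accept_prob_ge0 q C x : 0 <= accept_prob q C x.
Proof. by apply: sumr_ge0 => a _; rewrite exprn_ge0. Qed.

Section Advice.
Variables (L : language) (A : TM) (cA K q N n m M rl : nat) (W : seq bits -> circuit).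
Variables (f : bits -> algC) (C : circuit).
Hypothesis K0 : (0 < K)%N.
Hypothesis q0 : (0 < q)%N.
Hypothesis nq : (n <= q)%N.
Hypothesis HqN : (q.-1 * K < N <= q * K)%N.
Hypothesis fE : forall x : bits, size x = n -> f (spread_bits K N x) = 1 - 2 * accept_prob q C x.
Hypothesis HL : forall x : bits, size x = n ->
  (L x -> 2%:R / 3%:R <= accept_prob q C x) /\ (~ L x -> accept_prob q C x <= 1 / 3%:R).
Hypothesis Hs : forall x : bits, size x = N ->
  2%:R / 3%:R <= shadow_success (fun a b => `|a - b| < 3%:R / 20%:R) (f x) A cA m M rl W x.

Lemma advice_exists : exists ws : seq (seq sym),
  [/\ size ws = (17 * n.+1)%N, all nonblank ws,
      all (fun w => size w <= M * m.+1 + rl + 2)%N ws &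
      forall x : bits, size x = n -> L x <->
        ohead (foldl (fun V w => cast (out_vote A cA (enc_bits (spread_bits K N x) ++ w)) V)
                 [::] ws) = Some true].
Proof.
(* [L] is a mere predicate; its truth value on x enters only the choice of the advice, which may be
   classical. *)
pose Ld (x : bits) : bool := excluded_middle_informative (L x).
pose good (x : n.-tuple bool) om r :=
  out_vote A cA (encode (spread_bits K N x :: om ++ [:: r])) == Ld x.
have [|l Hl [Hv Hg]] := @derandomize m M rl W n good.
  move=> x; have := Hs (_ : size (spread_bits K N x) = N); rewrite size_mkseq => /(_ erefl) H.
  apply: le_trans H _; rewrite fE ?size_tuple // /shadow_success /sample_mean.
  apply: adv_exp_mono => om; apply: ler_sum => r _; apply: ler_wpM2r.
    by rewrite invr_ge0 exprn_ge0 ?ler0n.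
  (* A close output casts the right vote, so votes are right at least as often as outputs are
     close. *)
  rewrite ler_nat /=; case Hc : (`|_| < _) => //.
  have [H1 H2] := vote_of_close (tm_out_nonblank _ _ _) (accept_prob_ge0 q C x) Hc.
  have [L1 L2] := HL (size_tuple x).
  rewrite /good /out_vote /Ld; case: excluded_middle_informative => /= Lx.
    by rewrite (H1 (L1 Lx)).
  by rewrite (negbTE (H2 (L2 Lx))).
(* Measurement outcomes and random bits are the part of the input of [A] that does not depend on x;
   this is what the advice stores verbatim. *)
pose tail (s : seq bits * bits) := Sep :: encode (s.1 ++ [:: s.2]).
exists (map tail l); split.
- by rewrite size_map.
- by apply/allP => _ /mapP[s _ ->]; rewrite /= encode_nonblank.
- apply/allP => _ /mapP[s /(allP Hv) /and3P[/eqP s1 s2 /eqP s3] ->] /=.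
  have := size_encode (s.1 ++ [:: s.2]); rewrite map_cat sumn_cat /= s3.
  have : (sumn [seq (size x).+1 | x <- s.1] <= M * m.+1)%N.
    rewrite -s1; elim: (s.1) s2 => //= o om IH /andP[/eqP -> /IH].
    by rewrite mulSn; lia.
  rewrite addn0 addnS addn2 ltnS => H1 H2; apply: leq_trans H2 _.
  by rewrite ltnS leq_add2r.
move=> x Hx; have Hx' : size x == n by apply/eqP.
have := Hg (Tuple Hx').
have Ev s : out_vote A cA (enc_bits (spread_bits K N x) ++ tail s) =
    (if Ld x then good (Tuple Hx') s.1 s.2 else ~~ good (Tuple Hx') s.1 s.2).
  by rewrite /good encode_cons /=; case: (Ld x); case: (out_vote _ _ _).
set g := fun s => good (Tuple Hx') s.1 s.2 => Hcnt.
have EV : forall V, foldl (fun V w => cast (out_vote A cA (enc_bits (spread_bits K N x) ++ w)) V)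
    V (map tail l) = foldl (fun V s => cast (if Ld x then g s else ~~ g s) V) V l.
  by elim: (l) => //= s l' IH V; rewrite IH Ev.
rewrite EV /Ld; case: excluded_middle_informative => /= Lx.
  by rewrite foldl_cast.
rewrite foldl_cast_false; first by split.
by rewrite (@eq_count _ _ g) // => s /=; rewrite negbK.
Qed.

End Advice.

Lemma shadow_BQP_sub_PPoly :
  (forall (G : TM) (cG : nat), poly_time G cG ->
      exists c : nat,
        admits_shadow (qmodel G cG) (pbound c)
          (fun a b => `|a - b| < 3%:R / 20%:R) (2%:R / 3%:R)) ->
   BQP_sub_PPoly.
Proof.
move=> Hsh L [G [cG [q [cq [HG Hq HL]]]]].
have [G' [cG' [HG' EG']]] := shift_TM HG.
have [c [A [cA [rl [m [M [crl [cs [W [HA Hrl HmM _ Hs]]]]]]]]]] := Hsh G' cG' HG'.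
have [T [cT [HT ET]]] := majority_TM HA.
(* [NB] bounds N <= q * 2^k, [wb] the length of one stored sample at that N, and [B] counts three
   bits for each token of 17 * (n + 1) runs, a run having a token per sample symbol, one per
   position and the final one. *)
pose NB n := (pbound cq n * (8 * n ^ 2 + 2))%N.
pose wb n := (pbound c (NB n) * (pbound c (NB n)).+1 + pbound crl (NB n) + 2)%N.
pose B n := (3 * (17 * n.+1 * (wb n + NB n + 1)))%N.
have main n : exists adv : bits, (size adv <= B n)%N /\
    forall x : bits, size x = n -> L x <-> majority_out A cA (encode [:: x; adv]) = [:: S1].
  (* Without qubits there is no v = q - 1 to encode. Then n = 0, the single outcome has first bit 0,
     so the empty word is rejected, as it is by the machine on empty advice. *)
  case: (posnP (q n)) => [qn0|qn0].
    exists [::]; split=> // x Hx.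
    have n0 : n = 0%N by have [] := andP (Hq n); rewrite qn0; lia.
    have x0 : x = [::] by apply: size0nil; rewrite Hx n0.
    have q00 : q 0%N = 0%N by move: qn0; rewrite n0.
    have [H1 _] := HL x; rewrite x0 /= q00 in H1.
    rewrite x0; split; last by [].
    move/H1; rewrite /accept_prob big1; first by rewrite lt_geF // divr_gt0 ?ltr0n.
    by move=> a; rewrite (@bitn_small a 0 0) //; exact: ltn_ord.
  have [N [k [Ed HN Hk]]] := decode_code n (q n).-1.
  rewrite prednK // in HN; set K := (2 ^ k)%N in HN Hk.
  have K0 : (0 < K)%N by rewrite expn_gt0.
  have [nq qb] := andP (Hq n).
  have NBN : (N <= NB n)%N.
    by case/andP: HN => _ H; apply: leq_trans H _; apply: leq_mul.
  set C := circuit_of (tm_out G cG (unary n)).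
  have fE (x : bits) : size x = n ->
      qmodel G' cG' (spread_bits K N x) = 1 - 2 * accept_prob (q n) C x.
    move=> Hx; rewrite /qmodel size_mkseq EG'; last by elim: (N).
    rewrite /shift_out size_nseq Ed circuit_of_shift.
    by apply: (accept_shifted K0 qn0 HN); rewrite Hx.
  have HLn (x : bits) : size x = n ->
      (L x -> 2%:R / 3%:R <= accept_prob (q n) C x) /\
      (~ L x -> accept_prob (q n) C x <= 1 / 3%:R).
    by move=> Hx; have := HL x; rewrite Hx.
  have Hsn (x : bits) : size x = N -> 2%:R / 3%:R <=
      shadow_success (fun a b => `|a - b| < 3%:R / 20%:R) (qmodel G' cG' x) A cA
        (m N) (M N) (rl N) (W N) x.
    by move=> Hx; have := Hs x; rewrite Hx.
  have [ws [Sws nws bws Hws]] := advice_exists K0 qn0 nq HN fE HLn Hsn.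
  pose sl := slots K n 0 N.
  exists (flatten (map token_bits (flatten (map (run_tokens sl) ws)))); split.
    have S3 ts : size (flatten (map token_bits ts)) = (3 * size ts)%N.
      by elim: ts => //= t ts ->; rewrite mulnS.
    rewrite S3 /B leq_mul2l /= -Sws.
    have wbn : (M N * (m N).+1 + rl N + 2 <= wb n)%N.
      have [mN MN] := HmM N.
      have cN := pbound_mono c NBN; have rN := pbound_mono crl NBN.
      rewrite /wb leq_add2r; apply: leq_add; last by apply: leq_trans (Hrl N) rN.
      by apply: leq_mul; [apply: leq_trans MN cN | rewrite ltnS; apply: leq_trans mN cN].
    elim: ws bws {Sws nws Hws} => //= w ws IH /andP[bw /IH H].
    rewrite size_cat mulSn; apply: leq_add H.
    rewrite /run_tokens !size_cat !size_map !size_rev size_map size_iota /=.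
    by lia.
  move=> x Hx; rewrite /majority_out /= leading_bits_enc tokens_enc catrevE cats0.
  have [|| Hc Hf] := @slots_spread_bits K (q n) N x K0; first by rewrite Hx.
    by case/andP: HN.
  rewrite Hx -/sl in Hc Hf.
  rewrite bstep_runs //= ?Hc // Hf.
  apply: iff_trans (Hws x Hx) _.
  by split=> [->|]; [rewrite eqxx | case: eqP].
(* The advice is only known to exist for each n, as N depends on the arbitrary function q; choice
   turns it into a function of n. *)
pose adv n := proj1_sig (constructive_indefinite_description _ (main n)).
have Hadv n : (size (adv n) <= B n)%N /\
    forall x : bits, size x = n -> L x <-> majority_out A cA (encode [:: x; adv n]) = [:: S1].
  exact: proj2_sig (constructive_indefinite_description _ (main n)).
have [ca Hca] : polyb B by rewrite /B /wb /NB; polyb_tac.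
exists T, cT, adv, ca; split=> //.
  by move=> n; apply: leq_trans (Hadv n).1 (Hca n).
move=> x; rewrite ET; last exact: encode_nonblank.
exact: (Hadv (size x)).2.
Qed.

(** Accuracy 1/10 lies strictly below 0.15 and confidence 1 - 1/3 is the required 2/3; once these
    are fixed, the resource bound at n + 10 + 3 is polynomial in n alone. *)
Lemma shadowfiable_admits f : shadowfiable f ->
  exists c, admits_shadow f (pbound c) (fun a b => `|a - b| < 3%:R / 20%:R) (2%:R / 3%:R).
Proof.
move=> [c H].
have [||||A [cA [rl [m [M [crl [cs [W [H1 H2 H3 H4 H5]]]]]]]]] :=
  H (10%:R^-1) (3%:R^-1) _ _ 10%N 3%N _ _; rewrite ?invr_gt0 ?ltr0n ?invrK //.
have [c' Hc'] : polyb (fun n => pbound c (n + 10 + 3)) by polyb_tac.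
exists c', A, cA, rl, m, M, crl, cs, W; split=> //.
  by move=> n; have [a b] := H3 n; split; [apply: leq_trans a _ | apply: leq_trans b _].
move=> x; apply: le_trans (_ : 1 - 3%:R^-1 <= _).
  by rewrite le_eqVlt; apply/orP; left; apply/eqP; field.
apply: le_trans (H5 x) _; rewrite /shadow_success.
apply: adv_exp_mono => om; apply: ler_sum => r _; apply: ler_wpM2r.
  by rewrite invr_ge0 exprn_ge0 ?ler0n.
rewrite ler_nat /=; case Hle : (`|_| <= _) => //.
suff -> : `|f x - dyadic (tm_out A cA (encode (x :: om ++ [:: bits_of (rl (size x)) r])))|
    < 3%:R / 20%:R by [].
apply: le_lt_trans Hle _.
by rewrite -subr_gt0 (_ : _ - _ = 20%:R^-1) ?invr_gt0 ?ltr0n //; field.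
Qed.

Theorem theorem2 :
  ((forall (G : TM) (cG : nat), poly_time G cG ->
      exists c : nat,
        admits_shadow (qmodel G cG) (pbound c)
          (fun a b => `|a - b| < 3%:R / 20%:R) (2%:R / 3%:R)) ->
   BQP_sub_PPoly)
  /\
  (~ BQP_sub_PPoly ->
   exists (G : TM) (cG : nat), poly_time G cG /\ ~ shadowfiable (qmodel G cG)).
Proof.
split; first exact: shadow_BQP_sub_PPoly.
move=> nsub; apply: NNPP => nex; apply: nsub; apply: shadow_BQP_sub_PPoly => G cG HG.
apply: shadowfiable_admits; apply: NNPP => ns; apply: nex.
by exists G, cG.
Qed.
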